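(* Let $\{(\theta_n,S_n)\}_{n\ge 1}$ be generated by the AdaGrad-Norm recursion $$S_n=S_{n-1}+\|G_n\|^2,\qquad \theta_{n+1}=\theta_n-\frac{\alpha_0}{\sqrt{S_n}}\,G_n,\qquad n\ge 1,$$ with deterministic $\theta_1\in\mathbb R^d$, $S_0>0$ and $\alpha_0>0$. (i) Suppose that $g$ satisfies global smoothness and non-flatness at infinity, and that the oracle satisfies conditional unbiasedness and the affine conditional second-moment bound (all defined in the context). Then $$\mathbb E\Big[\sup_{n\ge1} g(\theta_n)\Big]<\infty .$$ (ii) Under the assumptions of part (i), $$\mathbb E\Big[\sup_{n\ge1}\|\theta_n\|\Big]<\infty ;$$ in particular, $\sup_{n\ge1}\|\theta_n\|<\infty$ almost surely. (iii) If, in addition to the assumptions of part (i), the local conditional relative-moment condition and the weak Sard condition hold, then $$\|\nabla g(\theta_n)\|\to0\ \text{ almost surely},\qquad \mathbb E\|\nabla g(\theta_n)\|^2\to0 .$$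
   Context: Setting. $g:\mathbb R^d\to\mathbb R$ is continuously differentiable and bounded below, normalized so that $\inf_{\theta}g(\theta)=0$ (hence $g\ge0$; the infimum need not be attained). $(\Omega,\mathscr F,\mathbb P)$ is a probability space with a filtration $\{\mathscr F_n\}_{n\ge0}$. For each $n\ge1$, $\theta_n$ and $S_{n-1}$ are $\mathscr F_{n-1}$-measurable, and the stochastic gradient $G_n$ (an $\mathbb R^d$-valued random vector, the oracle output at $\theta_n$) is $\mathscr F_n$-measurable. $\|\cdot\|$ is the Euclidean norm. Global smoothness: there is $L>0$ with $\|\nabla g(\theta)-\nabla g(\theta')\|\le L\|\theta-\theta'\|$ for all $\theta,\theta'\in\mathbb R^d$. Non-flatness at infinity: $\liminf_{\|\theta\|\to\infty}\|\nabla g(\theta)\|>0$. Conditional unbiasedness: $\mathbb E[G_n\mid\mathscr F_{n-1}]=\nabla g(\theta_n)$ for every $n\ge1$. Affine conditional second moment: there are constants $\beta,\sigma\ge0$ such that $\mathbb E[\|G_n\|^2\mid\mathscr F_{n-1}]\le\beta\|\nabla g(\theta_n)\|^2+\sigma^2$ for every $n\ge1$. Local conditional relative-moment condition: there exist $\delta_0,\rho>0$ and $\kappa_\rho<\infty$ such that, with $\mathcal L_n:=\{\|\nabla g(\theta_n)\|\le\delta_0\}$, almost surely for every $n$, $$\mathbf 1_{\mathcal L_n}\mathbb E[\|G_n\|^{2+\rho}\mid\mathscr F_{n-1}]\le\kappa_\rho\mathbf 1_{\mathcal L_n}\mathbb E[\|G_n\|^2\mid\mathscr F_{n-1}].$$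 Weak Sard condition: the set of critical values $\{g(\theta):\nabla g(\theta)=0\}$ is nowhere dense in $\mathbb R$. *)

(* Defs.v *)
From HB Require Import structures.
From mathcomp Require Import all_boot all_order all_algebra.
From mathcomp Require Import all_classical all_reals all_analysis.
From mathcomp Require Import measurable_realfun.
Set Implicit Arguments.
Unset Strict Implicit.
Unset Printing Implicit Defensive.
Import Order.TTheory GRing.Theory Num.Theory.
Import numFieldNormedType.Exports.

Local Open Scope classical_set_scope.
Local Open Scope ring_scope.

(* The library norm `|x| on 'rV[R]_d is the sup norm, hence this one. Both
   induce the same topology, so the library's [continuous], [differentiable]
   and [open] can be used as they are. *)
Definition enorm (R : realType) (d : nat) (x : 'rV[R]_d) : R :=
  Num.sqrt (\sum_(i < d) x ord0 i ^+ 2).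

Definition grad (R : realType) (d : nat) (g : 'rV[R]_d -> R) (x : 'rV[R]_d) :
    'rV[R]_d :=
  \row_(i < d) 'D_(delta_mx ord0 i) g x.

Definition continuously_differentiable (R : realType) (d : nat)
    (g : 'rV[R]_d -> R) : Prop :=
  (forall x, differentiable g x) /\ continuous (grad g).

(* [inf] is 0 by convention on sets without a lower bound, so boundedness has
   to be required separately. *)
Definition bounded_below_inf0 (R : realType) (d : nat) (g : 'rV[R]_d -> R) :
    Prop :=
  has_lbound (range g) /\ inf (range g) = 0.

Definition globally_smooth (R : realType) (d : nat) (g : 'rV[R]_d -> R) :
    Prop :=
  exists2 L : R, 0 < L &
    forall x y, enorm (grad g x - grad g y) <= L * enorm (x - y).

Definition enorm_infty (R : realType) (d : nat) : set_system 'rV[R]_d :=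
  [set V | \forall r \near +oo, forall x : 'rV[R]_d, r <= enorm x -> V x].

Definition nonflat_at_infinity (R : realType) (d : nat) (g : 'rV[R]_d -> R) :
    Prop :=
  (0 < limf_einf (fun x => (enorm (grad g x))%:E) (@enorm_infty R d))%E.

Definition nowhere_dense (T : topologicalType) (A : set T) : Prop :=
  interior (closure A) = set0.

Definition weak_Sard (R : realType) (d : nat) (g : 'rV[R]_d -> R) : Prop :=
  nowhere_dense (g @` [set x | grad g x = 0]).

Definition Borel (T : ptopologicalType) := g_sigma_algebraType (@open T).

Section Probability.
Variables (R : realType) (dO : measure_display) (Omega : measurableType dO).
Variable P : probability Omega R.

Definition filtration (F : nat -> set (set Omega)) : Prop :=
  [/\ forall n, sigma_algebra setT (F n),
      forall n, F n `<=` measurable &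
      forall m n, (m <= n)%N -> F m `<=` F n].

(* Measurability with respect to a sub-sigma-algebra H, which is a plain set
   system and not a type-class instance on Omega. *)
Definition measurable_wrt (H : set (set Omega)) (d' : measure_display)
    (T : measurableType d') (X : Omega -> T) : Prop :=
  forall B : set T, measurable B -> H (X @^-1` B).

(* Z is a version of E[Y | H], for integrable Y. *)
Definition cond_expectation (H : set (set Omega)) (Y Z : Omega -> R) : Prop :=
  [/\ P.-integrable setT (EFin \o Y),
      P.-integrable setT (EFin \o Z),
      measurable_wrt H Z &
      forall A, H A ->
        (\int[P]_(w in A) (Z w)%:E = \int[P]_(w in A) (Y w)%:E)%E].

(* Z is a version of the generalized conditional expectation E[Y | H] of a
   nonnegative Y, which exists in [0, +oo] without any integrability. *)
Definition cond_expectation_ge0 (H : set (set Omega)) (Y Z : Omega -> \bar R) :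
    Prop :=
  [/\ forall w, (0 <= Y w)%E,
      forall w, (0 <= Z w)%E,
      measurable_wrt H Z &
      forall A, H A -> (\int[P]_(w in A) Z w = \int[P]_(w in A) Y w)%E].

Variables (d : nat) (g : 'rV[R]_d -> R) (F : nat -> set (set Omega)).
Variables (theta G : nat -> Omega -> 'rV[R]_d) (S : nat -> Omega -> R).

(* In this definition and the next ones, n.+1 is the step number n >= 1 of
   the recursion. The values theta 0 and G 0 are never used. *)
Definition adagrad_measurability : Prop :=
  forall n,
    [/\ measurable_wrt (F n) (theta n.+1 : Omega -> Borel 'rV[R]_d),
        measurable_wrt (F n) (S n) &
        measurable_wrt (F n.+1) (G n.+1 : Omega -> Borel 'rV[R]_d)].

Definition adagrad_norm (alpha0 S0 : R) (theta1 : 'rV[R]_d) : Prop :=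
  [/\ forall w, S 0%N w = S0,
      forall w, theta 1%N w = theta1,
      forall n w, S n.+1 w = S n w + enorm (G n.+1 w) ^+ 2 &
      forall n w, theta n.+2 w =
        theta n.+1 w - (alpha0 / Num.sqrt (S n.+1 w)) *: G n.+1 w].

Definition conditionally_unbiased : Prop :=
  forall n (i : 'I_d),
    cond_expectation (F n) (fun w => G n.+1 w ord0 i)
      (fun w => grad g (theta n.+1 w) ord0 i).

Definition affine_second_moment : Prop :=
  exists beta sigma : R, [/\ 0 <= beta, 0 <= sigma &
    forall n, exists2 Z : Omega -> \bar R,
      cond_expectation_ge0 (F n) (fun w => (enorm (G n.+1 w) ^+ 2)%:E) Z &
      {ae P, forall w,
        (Z w <= (beta * enorm (grad g (theta n.+1 w)) ^+ 2 + sigma ^+ 2)%:E)%E}].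

Definition small_gradient_event (delta0 : R) (n : nat) : set Omega :=
  [set w | enorm (grad g (theta n w)) <= delta0].

Definition local_relative_moment : Prop :=
  exists delta0 rho kappa : R, [/\ 0 < delta0, 0 < rho &
    exists Zrho Z2 : nat -> Omega -> \bar R,
      [/\ forall n, cond_expectation_ge0 (F n)
            (fun w => (enorm (G n.+1 w) `^ (2 + rho))%:E) (Zrho n),
          forall n, cond_expectation_ge0 (F n)
            (fun w => (enorm (G n.+1 w) ^+ 2)%:E) (Z2 n) &
          {ae P, forall w, forall n,
            ((\1_(small_gradient_event delta0 n.+1) w)%:E * Zrho n w <=
             kappa%:E *
               ((\1_(small_gradient_event delta0 n.+1) w)%:E * Z2 n w))%E}]].

End Probability.

(* Main.v *)
Require Import Defs.
From HB Require Import structures.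
From mathcomp Require Import all_boot all_order all_algebra.
From mathcomp Require Import all_classical all_reals all_analysis.
From mathcomp Require Import measurable_realfun.
From mathcomp Require Import ring lra.
Import Order.TTheory GRing.Theory Num.Theory.
Import numFieldNormedType.Exports.
Local Open Scope classical_set_scope.
Local Open Scope ring_scope.

(** Write X = 1 + g (theta), gam for the norm of the gradient of g, q for the
   norm of the stochastic gradient, S and S' = S + q^2 for the accumulator before
   and after a step.  Smoothness gives gam^2 <= 4 L X, and every step has length
   at most alpha0, so X changes by at most a constant factor per step.

   Two Lyapunov functions carry the boundedness.  The first is X^4 / sqrt S
   (summable_grad_energy).  The step size 1 / sqrt S' depends on the stochastic
   gradient; it is compared with the surrogate 1 / sqrt (S + X), which is known
   before the draw (surrogate_step).  The remaining errors carry the factor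
   q^2 / S' and a power of X lower than X^4, so they are absorbed by the decrease
   of the weight 1 / sqrt S in front of X^4 (quartic_over_sqrt_step).  Hence the
   expected sum of X^2 gam^2 / S is finite, and, where the gradient exceeds a
   fixed level, so is the expected sum of X^2 q^2 / S (summable_noise_energy).

   The second Lyapunov function is the square of the excess of X over a level M
   (excess_sqr_step).  By non-flatness the gradient is bounded below near and
   above that level, so the drift of this function is at most a summable noise
   energy.  A maximal inequality (Ex_sqrt_runmax) turns this into a bound for
   the expectation of the square root of its running maximum, that is of the
   running maximum of X: this is part (i), see integral_sup_X.  It uses that
   sqrt m + B / sqrt m, with m the running maximum of B, does not increase when B
   sets a record.  Part (ii) follows because non-flatness forces g to grow at
   least linearly (nonflat_linear_growth).

   For part (iii) the same maximal inequality gives the almost sure convergence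
   of square-integrable martingales (ae_martingale_cauchy), applied to the
   noise in the value of g and in the coordinates of theta at those steps where
   the gradient exceeds a fixed level.  Single steps become negligible: where
   the gradient is large by summability of the noise energy, where it is small
   by the relative-moment condition (ae_small_gradient_noise).  The rest is
   deterministic (gradient_vanishes, trajectory_gradient_vanishes).  While the
   gradient stays above a level, the objective decreases in proportion to the
   displacement, up to a small error.  If the objective oscillated, it would
   cross upwards, in small steps, an interval without critical values, where the
   gradient is bounded below: impossible.  So it converges.  The gradient is
   small infinitely often, since otherwise S would stay bounded while gam^2 / S
   is summable.  It cannot return to a fixed positive level infinitely often,
   since each return would lower the objective by a fixed amount.  Convergence
   of the second moments is then dominated convergence, with the supremum of
   part (i) as the bound. *)

(** * Euclidean geometry and smooth functions *)

Section Euclid.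
Context {R : realType} {d : nat}.
Implicit Types (x y : 'rV[R]_d).

(** The inner product that induces enorm. *)
Definition dotp x y : R := \sum_(i < d) x ord0 i * y ord0 i.

Lemma enorm_ge0 x : 0 <= enorm x.
Proof. exact: sqrtr_ge0. Qed.

Lemma sqr_enorm x : enorm x ^+ 2 = \sum_(i < d) x ord0 i ^+ 2.
Proof. by rewrite sqr_sqrtr// sumr_ge0// => i _; exact: sqr_ge0. Qed.

Lemma dotpxx x : dotp x x = enorm x ^+ 2.
Proof. by rewrite sqr_enorm; apply: eq_bigr => i _; rewrite expr2. Qed.

Lemma dotpC x y : dotp x y = dotp y x.
Proof. by apply: eq_bigr => i _; rewrite mulrC. Qed.

Lemma dotpDl x y z : dotp (x + y) z = dotp x z + dotp y z.
Proof. by rewrite -big_split; apply: eq_bigr => i _; rewrite !mxE mulrDl. Qed.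

Lemma dotpZl (a : R) x z : dotp (a *: x) z = a * dotp x z.
Proof. by rewrite mulr_sumr; apply: eq_bigr => i _; rewrite !mxE mulrA. Qed.

Lemma dotpZr (a : R) x z : dotp x (a *: z) = a * dotp x z.
Proof. by rewrite dotpC dotpZl dotpC. Qed.

Lemma dotpBl x y z : dotp (x - y) z = dotp x z - dotp y z.
Proof. by rewrite -scaleN1r dotpDl dotpZl mulN1r. Qed.

Lemma dotpBr x y z : dotp z (x - y) = dotp z x - dotp z y.
Proof. by rewrite dotpC dotpBl !(dotpC z). Qed.

Lemma enormZ (a : R) x : enorm (a *: x) = `|a| * enorm x.
Proof.
apply: (@pexpIrn _ 2) => //; rewrite ?nnegrE ?enorm_ge0 ?mulr_ge0 ?enorm_ge0//.
by rewrite exprMn -!dotpxx dotpZl dotpZr mulrA -expr2 real_normK ?num_real.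
Qed.

Lemma enormN x : enorm (- x) = enorm x.
Proof. by rewrite -scaleN1r enormZ normrN1 mul1r. Qed.

Lemma coord_le_enorm x i : `|x ord0 i| <= enorm x.
Proof.
rewrite -(@ler_pXn2r _ 2) ?nnegrE ?enorm_ge0// sqr_enorm real_normK ?num_real//.
by rewrite (bigD1 i)//= lerDl sumr_ge0// => j _; exact: sqr_ge0.
Qed.

Lemma enorm_eq0 x : enorm x = 0 -> x = 0.
Proof.
move=> x0; apply/rowP => i; rewrite mxE; apply/eqP.
by have := coord_le_enorm x i; rewrite x0 normr_le0.
Qed.

(** Expand the square of the norm of enorm y *: x - enorm x *: y. *)
Lemma dotp_le x y : dotp x y <= enorm x * enorm y.
Proof.
have [x0|x0] := eqVneq (enorm x) 0.
  by rewrite x0 mul0r (enorm_eq0 _ x0) -(scale0r 0) dotpZl mul0r.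
have [y0|y0] := eqVneq (enorm y) 0.
  by rewrite y0 mulr0 (enorm_eq0 _ y0) -(scale0r 0) dotpZr mul0r.
have px : 0 < enorm x by rewrite lt_neqAle eq_sym x0 enorm_ge0.
have py : 0 < enorm y by rewrite lt_neqAle eq_sym y0 enorm_ge0.
rewrite -(ler_pM2l (mulr_gt0 px py)).
have := sqr_ge0 (enorm (enorm y *: x - enorm x *: y)).
rewrite -dotpxx dotpBl !dotpBr !dotpZl !dotpZr !dotpxx (dotpC y x).
nra.
Qed.

Lemma ler_norm_dotp x y : `|dotp x y| <= enorm x * enorm y.
Proof.
rewrite ler_norml dotp_le andbT lerNl -mulN1r -dotpZl scaleN1r.
by apply: le_trans (dotp_le _ _) _; rewrite enormN.
Qed.

Lemma ler_enormD x y : enorm (x + y) <= enorm x + enorm y.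
Proof.
rewrite -(@ler_pXn2r _ 2) ?nnegrE ?addr_ge0 ?enorm_ge0//.
rewrite -dotpxx dotpDl ![dotp _ (x + y)]dotpC !dotpDl (dotpC y x) !dotpxx.
by have := dotp_le x y; nra.
Qed.

Lemma ler_dist_enorm x y : `|enorm x - enorm y| <= enorm (x - y).
Proof.
have h (u v : 'rV[R]_d) : enorm u - enorm v <= enorm (u - v).
  by rewrite lerBlDr; have := ler_enormD (u - v) v; rewrite subrK.
by rewrite ler_norml h andbT lerNl opprB -(enormN (x - y)) opprB h.
Qed.

Lemma enorm_le_sum x : enorm x <= \sum_(i < d) `|x ord0 i|.
Proof.
have s0 : 0 <= \sum_(i < d) `|x ord0 i| by exact: sumr_ge0.
rewrite -(@ler_pXn2r _ 2) ?nnegrE ?enorm_ge0// sqr_enorm.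
rewrite expr2 mulr_suml ler_sum// => i _.
rewrite -real_normK ?num_real// expr2 ler_wpM2l//.
by rewrite (bigD1 i)//= lerDl sumr_ge0.
Qed.

Lemma coord_le_norm x i : `|x ord0 i| <= `|x|.
Proof.
by rewrite [leRHS]/Num.norm /= mx_normrE; apply/bigmax_geP; right; exists (ord0, i).
Qed.

Lemma norm_le_enorm x : `|x| <= enorm x.
Proof.
rewrite [leLHS]/Num.norm /= mx_normrE.
by apply: bigmax_le => [|[i j] _ /=]; rewrite ?enorm_ge0// ord1 coord_le_enorm.
Qed.

Lemma continuous_enorm : continuous (@enorm R d).
Proof.
move=> x.
apply: (proj2 (@cvgrPdist_lt _ R^o _ (nbhs x) _ (@enorm R d) (enorm x))) => e e0.
apply/nbhs_ballP; exists (d.+1%:R^-1 * e); first by rewrite /= mulr_gt0.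
move=> z; rewrite -ball_normE /= => xz; apply: le_lt_trans (ler_dist_enorm _ _) _.
apply: le_lt_trans (enorm_le_sum _) _.
apply: (@le_lt_trans _ _ (\sum_(i < d) `|x - z|)).
  by apply: ler_sum => i _; exact: coord_le_norm.
rewrite sumr_const card_ord -mulr_natl.
apply: (@le_lt_trans _ _ (d.+1%:R * `|x - z|)); last by rewrite -ltr_pdivlMl.
by rewrite ler_wpM2r// ler_nat.
Qed.

End Euclid.

Section Smooth.
Context {R : realType} {d : nat}.
Implicit Types (g : 'rV[R]_d -> R) (x h : 'rV[R]_d) (L : R).

Lemma derive_dotp_grad g x h : differentiable g x -> 'D_h g x = dotp (grad g x) h.
Proof.
move=> dg; rewrite deriveE// {1}(row_sum_delta h) linear_sum /=.
by apply: eq_bigr => i _; rewrite linearZ /= mxE deriveE// mulrC.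
Qed.

Lemma mean_value_grad g x h : (forall y, differentiable g y) ->
  exists2 c : R, 0 <= c <= 1 & g (x + h) - g x = dotp (grad g (x + c *: h)) h.
Proof.
move=> dg.
have dphi (t : R) : is_derive t 1 (fun s : R => g (x + s *: h)) ('D_h g (x + t *: h)).
  have dl : is_diff t (fun s : R => x + s *: h) (fun s => s *: h).
    have -> : (fun s : R => s *: h) = (0 : R -> 'rV[R]_d) + ( *:%R^~ h).
      by apply/funext => s; rewrite [RHS]/GRing.add/= add0r.
    have -> : (fun s : R => x + s *: h) = cst x + ( *:%R^~ h) by [].
    apply: is_diffD.
  have dc : differentiable (g \o (fun s : R => x + s *: h)) t.
    by apply: differentiable_comp; [exact: ex_diff|exact: dg].
  apply: DeriveDef; first exact/derivable1_diffP.
  rewrite (@deriveE _ _ _ (g \o (fun s : R => x + s *: h)))// diff_comp//.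
  by rewrite diff_val /= scale1r deriveE.
have cphi : {within `[0 : R, 1], continuous (fun s : R => g (x + s *: h))}.
  by apply: derivable_within_continuous => t _; case: (dphi t).
have [c] := @MVT_segment R _ _ 0 1 ler01 (fun t _ => dphi t) cphi.
rewrite in_itv/= => c01; rewrite scale1r scale0r addr0 subr0 mulr1.
by rewrite derive_dotp_grad// => ?; exists c.
Qed.

(** The gradient in the mean value theorem is taken on the segment from x to
   x + h, hence within L * enorm h of the gradient at x. *)
Lemma smooth_taylor g L x h : (forall y, differentiable g y) -> 0 < L ->
  (forall y z, enorm (grad g y - grad g z) <= L * enorm (y - z)) ->
  `|g (x + h) - g x - dotp (grad g x) h| <= L * enorm h ^+ 2.
Proof.
move=> dg L0 hL.
have [c /andP[c0 c1] ->] := mean_value_grad g x h dg.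
rewrite -dotpBl; apply: le_trans (ler_norm_dotp _ _) _.
apply: (@le_trans _ _ (L * (c * enorm h) * enorm h)).
  rewrite ler_wpM2r ?enorm_ge0//; apply: le_trans (hL _ _) _.
  by rewrite addrC addKr enormZ ger0_norm.
rewrite expr2 -[leLHS]mulrA; apply: ler_wpM2l; first exact: ltW.
by apply: ler_wpM2r; [exact: enorm_ge0|apply: ler_piMl => //; exact: enorm_ge0].
Qed.

(** With step 1 / (2 L) the linear gain is twice the Taylor error. *)
Lemma gradient_step_descent g L x : (forall y, differentiable g y) -> 0 < L ->
  (forall y z, enorm (grad g y - grad g z) <= L * enorm (y - z)) ->
  g (x - (2 * L)^-1 *: grad g x) <= g x - enorm (grad g x) ^+ 2 / (4 * L).
Proof.
move=> dg L0 hL.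
have := smooth_taylor g L x (- (2 * L)^-1 *: grad g x) dg L0 hL.
have L2 : 0 <= (2 * L)^-1 by rewrite invr_ge0 mulr_ge0// ltW.
rewrite ler_norml => /andP[_].
rewrite dotpZr dotpxx enormZ normrN (ger0_norm L2) scaleNr.
set q := enorm _; set g' := g _ => h.
suff -> : q ^+ 2 / (4 * L) = (2 * L)^-1 * q ^+ 2 - L * ((2 * L)^-1 * q) ^+ 2 by lra.
by field; rewrite gt_eqF.
Qed.

(** A gradient step cannot bring g below 0. *)
Lemma sqr_grad_le g L x : (forall y, differentiable g y) -> 0 < L ->
  (forall y z, enorm (grad g y - grad g z) <= L * enorm (y - z)) ->
  (forall y, 0 <= g y) ->
  enorm (grad g x) ^+ 2 <= 4 * L * g x.
Proof.
move=> dg L0 hL g0.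
have := gradient_step_descent g L x dg L0 hL.
move/(le_trans (g0 _)); rewrite subr_ge0 ler_pdivrMr; last by lra.
by rewrite [g x * _]mulrC.
Qed.

Lemma nonflat_at_infinityP g : nonflat_at_infinity g ->
  exists r e : R, 0 < e /\ forall x, r <= enorm x -> e <= enorm (grad g x).
Proof.
rewrite /nonflat_at_infinity /limf_einf oppe_gt0 limf_esupE.
move=> /ereal_inf_lt[_ [V [r [_ rV]] <-]] sV.
have [e e0 he] : exists2 e : R, 0 < e &
    (ereal_sup ((\- (fun x => (enorm (grad g x))%:E)) @` V) <= (- e)%:E)%E.
  move: sV; case: (ereal_sup _) => [s||]//=.
    by rewrite lte_fin => s0; exists (- s); rewrite ?oppr_gt0// opprK.
  by move=> _; exists 1 => //; rewrite leNye.
exists (r + 1), e; split => // x xr.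
have : ((- enorm (grad g x))%:E <= (- e)%:E)%E.
  apply: le_trans he; apply: ereal_sup_ubound; exists x => //.
  by apply: (rV (r + 1)) => //; rewrite ltrDl.
by rewrite lee_fin lerN2.
Qed.

(** Outside the ball of radius r every gradient step of length l lowers g by at
   least e * l / 2, so the descent path enters the ball after a total length of
   at most 2 * g x / e. *)
Lemma nonflat_linear_growth g L (r e : R) x : (forall y, differentiable g y) ->
  0 < L ->
  (forall y z, enorm (grad g y - grad g z) <= L * enorm (y - z)) ->
  (forall y, 0 <= g y) -> 0 < e ->
  (forall y, r <= enorm y -> e <= enorm (grad g y)) ->
  enorm x <= r + 2 / e * g x.
Proof.
move=> dg L0 hL g0 e0 hr.
pose c := e ^+ 2 / (4 * L).
have c0 : 0 < c by rewrite divr_gt0 ?exprn_gt0// mulr_gt0.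
have [n] : exists n : nat, g x <= n%:R * c.
  exists (Num.truncn (g x / c)).+1; rewrite -ler_pdivrMr//.
  by rewrite ltW// truncnS_gt.
elim: n x => [|n IH] x.
  rewrite mul0r => gx; have g00 : g x = 0 by apply/eqP; rewrite eq_le gx g0.
  rewrite g00 mulr0 addr0 leNgt; apply/negP => /ltW/hr er.
  have := sqr_grad_le g L x dg L0 hL g0; rewrite g00 mulr0.
  by apply/negP; rewrite -ltNge exprn_gt0// (lt_le_trans e0).
move=> gx; have [xr|/ltW/hr er] := leP (enorm x) r.
  by rewrite (le_trans xr)// lerDl mulr_ge0// divr_ge0// ltW.
have := gradient_step_descent g L x dg L0 hL.
set x' := x - _; set q := enorm _ in er * => gx'.
have e2q : e ^+ 2 <= q ^+ 2 by rewrite ler_pXn2r// nnegrE ltW// (lt_le_trans e0).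
have /IH hx' : g x' <= n%:R * c.
  have cq : c <= q ^+ 2 / (4 * L) by rewrite ler_pM2r// invr_gt0 mulr_gt0.
  by rewrite -natr1 mulrDl mul1r in gx; lra.
have xx' : enorm x <= enorm x' + q / (2 * L).
  have -> : x = x' + (2 * L)^-1 *: grad g x by rewrite subrK.
  apply: le_trans (ler_enormD _ _) _; rewrite lerD2l enormZ -/q.
  by rewrite ger0_norm 1?mulrC// invr_ge0 mulr_ge0// ltW.
have h3 : q / (2 * L) <= 2 / e * (q ^+ 2 / (4 * L)).
  have -> : 2 / e * (q ^+ 2 / (4 * L)) = q / (2 * L) * (q / e) by field; rewrite !gt_eqF.
  rewrite ler_peMr//; last by rewrite ler_pdivlMr// mul1r.
  by rewrite divr_ge0 ?mulr_ge0 ?enorm_ge0// ltW.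
have : 2 / e * g x' <= 2 / e * (g x - q ^+ 2 / (4 * L)) by rewrite ler_wpM2l// divr_ge0// ltW.
by rewrite mulrBr; lra.
Qed.

(** The critical values are nowhere dense, so some interval [a', b'] inside
   ]a, b[ contains none of them.  The points of the ball with values in [a', b']
   form a compact set, on which the gradient norm attains its minimum, and this
   minimum is positive. *)
Lemma weak_Sard_gap g (r a b : R) : (forall y, differentiable g y) ->
  continuous (grad g) -> weak_Sard g -> a < b ->
  exists a' b' e : R, [/\ a < a', a' < b', b' < b, 0 < e &
    forall x, enorm x <= r -> a' <= g x <= b' -> e <= enorm (grad g x)].
Proof.
move=> dg cg sg ab.
have [a' [b' [aa' ab' bb' hab]]] : exists a' b' : R, [/\ a < a', a' < b', b' < b &
    forall x, a' <= g x <= b' -> grad g x <> 0].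
  set A := g @` [set x | grad g x = 0] in sg.
  have : ~ (`]a, b[%classic `<=` closure A).
    move=> ab_; have : interior (closure A) ((a + b) / 2).
      apply: (@filterS _ _ _ `]a, b[%classic) => //.
      apply: open_nbhs_nbhs; split; first exact: interval_open.
      by rewrite /= in_itv/=; lra.
    by move: sg; rewrite /weak_Sard /nowhere_dense -/A => ->.
  move=> /existsNP[y] /not_implyP[]; rewrite /= in_itv/= => /andP[ay yb].
  move=> /existsNP[B] /not_implyP[/nbhs_ballP[e /= e0 yeB] AB].
  have [m [m0 mea mby me]] : exists m : R, [/\ 0 < m, m < y - a, m < b - y & m < e].
    exists (Num.min (Num.min (y - a) (b - y)) e / 2).
    have : 0 < Num.min (Num.min (y - a) (b - y)) e by rewrite !lt_min; lra.
    have : Num.min (Num.min (y - a) (b - y)) e <= y - a by rewrite !ge_min lexx.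
    have : Num.min (Num.min (y - a) (b - y)) e <= b - y by rewrite !ge_min lexx orbT.
    have : Num.min (Num.min (y - a) (b - y)) e <= e by rewrite !ge_min lexx orbT.
    by split; lra.
  exists (y - m), (y + m); split; try lra.
  move=> x /andP[x1 x2] gx0; apply: AB; exists (g x); split; first by exists x.
  apply: yeB; rewrite -ball_normE /= ltr_norml; lra.
exists a', b'.
pose K := [set x : 'rV[R]_d | enorm x <= r /\ a' <= g x <= b'].
have cg0 : continuous g by move=> x; exact: differentiable_continuous.
have cen := @continuous_enorm R d.
have cK : compact K.
  apply: bounded_closed_compact.
    exists r; split; first exact: num_real.
    move=> s rs x [xr _] /=.
    by rewrite (le_trans (norm_le_enorm x))// (le_trans xr)// ltW.
  have -> : K = (@enorm R d) @^-1` [set y | y <= r] `&`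
     (g @^-1` [set y | a' <= y] `&` g @^-1` [set y | y <= b']).
    apply/seteqP; split => x /=; first by move=> [? /andP[]].
    by move=> [? [? ?]]; split => //; exact/andP.
  apply: closedI; first by apply: closed_comp => // ? _; exact: cen.
  apply: closedI; apply: closed_comp => // ? _; exact: cg0.
have [K0|K0] := eqVneq K set0.
  exists 1; split => // x xr hx; have : K x by [].
  by rewrite K0.
have cn : {within K, continuous (fun x => enorm (grad g x))}.
  apply: continuous_subspaceT => x; apply: continuous_comp; [exact: cg|exact: cen].
have [c cK' hc] := EVT_min_rV (proj1 (set0P _) K0) cK cn.
exists (enorm (grad g c)); split => //.
  rewrite lt_neqAle enorm_ge0 andbT eq_sym; apply/eqP => /enorm_eq0.
  by apply: hab; move: cK'; rewrite inE => -[].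
by move=> x xr hx; apply: hc; rewrite inE.
Qed.

End Smooth.

(** * Functions measurable for a sub-sigma-algebra *)

Section SubMeas.
Context {R : realType} {dO : measure_display} {Omega : measurableType dO}.
Implicit Types (H : set (set Omega)) (f h : Omega -> R).

(** Measurability for H as measurability on the type that carries the
   sigma-algebra generated by H, so that the usual closure properties apply. *)
Definition Hmeas H f := measurable_fun [set: g_sigma_algebraType H] f.

Definition sub_sigma H := sigma_algebra setT H /\ H `<=` measurable.

Lemma HmeasP H f : sub_sigma H -> measurable_wrt H f -> Hmeas H f.
Proof.
move=> sH mf _ Y mY; rewrite setTI.
by rewrite measurable_g_measurableTypeE; [exact: mf|exact: sH.1].
Qed.

Lemma Hmeas_preimage H f Y : sub_sigma H -> Hmeas H f -> measurable Y ->
  H (f @^-1` Y).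
Proof.
move=> sH mf mY; rewrite -[X in X _](measurable_g_measurableTypeE sH.1).
by rewrite -[_ @^-1` _]setTI; exact: mf.
Qed.

Lemma HmeasW H H' f : sub_sigma H -> sub_sigma H' -> H `<=` H' ->
  Hmeas H f -> Hmeas H' f.
Proof.
move=> sH sH' HH' mf _ Y mY; rewrite setTI.
by rewrite measurable_g_measurableTypeE; [apply: HH'; exact: (Hmeas_preimage _ _ _ sH)|exact: sH'.1].
Qed.

Lemma Hmeas_measurable H f : sub_sigma H -> Hmeas H f -> measurable_fun [set: Omega] f.
Proof.
by move=> sH mf _ Y mY; rewrite setTI; apply: sH.2; exact: Hmeas_preimage.
Qed.

Lemma Hmeas_cst H (c : R) : Hmeas H (fun=> c).
Proof. exact: measurable_cst. Qed.

Lemma HmeasD H f h : Hmeas H f -> Hmeas H h -> Hmeas H (fun w => f w + h w).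
Proof. exact: measurable_funD. Qed.

Lemma HmeasB H f h : Hmeas H f -> Hmeas H h -> Hmeas H (fun w => f w - h w).
Proof. exact: measurable_funB. Qed.

Lemma HmeasM H f h : Hmeas H f -> Hmeas H h -> Hmeas H (fun w => f w * h w).
Proof. exact: measurable_funM. Qed.

Lemma HmeasX H f n : Hmeas H f -> Hmeas H (fun w => f w ^+ n).
Proof. exact: measurable_funX. Qed.

Lemma Hmeas_max H f h : Hmeas H f -> Hmeas H h ->
  Hmeas H (fun w => Num.max (f w) (h w)).
Proof. exact: measurable_maxr. Qed.

Lemma Hmeas_sqrt H f : Hmeas H f -> Hmeas H (fun w => Num.sqrt (f w)).
Proof.
move=> mf; have ms : measurable_fun [set: R] (@Num.sqrt R).
  by apply: continuous_measurable_fun; exact: sqrt_continuous.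
exact: (measurableT_comp ms mf).
Qed.

Lemma Hmeas_powR H f (a : R) : Hmeas H f -> Hmeas H (fun w => f w `^ a).
Proof. by move=> mf; exact: (measurableT_comp (measurable_powR a) mf). Qed.

Lemma HmeasV H f : (forall w, 0 < f w) -> Hmeas H f -> Hmeas H (fun w => (f w)^-1).
Proof.
move=> f0 mf; have -> : (fun w => (f w)^-1) = (fun w => f w `^ (- 1)).
  by apply/funext => w; rewrite powR_inv1// ltW.
exact: Hmeas_powR.
Qed.

Lemma Hmeas_sum H n (f : nat -> Omega -> R) : (forall i, (i < n)%N -> Hmeas H (f i)) ->
  Hmeas H (fun w => \sum_(i < n) f i w).
Proof.
elim: n => [|n IH] mf.
  under eq_fun do rewrite big_ord0; exact: Hmeas_cst.
under eq_fun do rewrite big_ord_recr; apply: HmeasD; last exact: mf.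
by apply: IH => i ni; apply: mf; rewrite ltnS ltnW.
Qed.

Lemma Hmeas_sumI H d (f : 'I_d -> Omega -> R) : (forall i, Hmeas H (f i)) ->
  Hmeas H (fun w => \sum_(i < d) f i w).
Proof.
move=> mf; have -> : (fun w => \sum_(i < d) f i w) =
    (fun w => \sum_(i <- enum 'I_d) f i w).
  by apply/funext => w; rewrite big_enum.
elim: (enum _) => [|i s IH].
  under eq_fun do rewrite big_nil; exact: Hmeas_cst.
by under eq_fun do rewrite big_cons; exact: HmeasD.
Qed.

Definition ind_ge (c x : R) : R := if c <= x then 1 else 0.

Lemma Hmeas_ind_ge H c f : Hmeas H f -> Hmeas H (fun w => ind_ge c (f w)).
Proof.
move=> mf; apply: measurable_fun_ifT.
- by apply: measurable_fun_ler => //; exact: measurable_cst.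
- exact: measurable_cst.
- exact: measurable_cst.
Qed.

Lemma ind_ge01 (c x : R) : 0 <= ind_ge c x <= 1.
Proof. by rewrite /ind_ge; case: ifP; rewrite lexx ler01. Qed.

(** Preimages of open sets under k are open, hence Borel. *)
Lemma Hmeas_continuous H d (k : 'rV[R]_d -> R) (X : Omega -> 'rV[R]_d) :
  sub_sigma H -> continuous k ->
  measurable_wrt H (X : Omega -> Borel 'rV[R]_d) ->
  Hmeas H (fun w => k (X w)).
Proof.
move=> sH ck mX; apply: HmeasP => // Y mY.
apply: (mX (k @^-1` Y)).
suff : measurable_fun [set: Borel 'rV[R]_d] k by move=> /(_ measurableT Y mY); rewrite setTI.
apply: (measurability _ (RGenOpens.measurableE R)) => _ [_ [a [b ->] <-]].
rewrite setTI; apply: sub_sigma_algebra.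
by apply: open_comp; [move=> ? _; exact: ck|exact: interval_open].
Qed.

End SubMeas.

(** * Expectations weighted by known quantities *)

Section Expect.
Context {R : realType} {dO : measure_display} {Omega : measurableType dO}
  (P : probability Omega R).
Implicit Types (H : set (set Omega)) (f h : Omega -> R).

Definition integ f : Prop := P.-integrable [set: Omega] (EFin \o f).

Definition Ex f : R := Rintegral P [set: Omega] f.

Lemma integ_measurable f : integ f -> measurable_fun [set: Omega] f.
Proof. by move=> /measurable_int/measurable_EFinP. Qed.

Lemma integD f h : integ f -> integ h -> integ (fun w => f w + h w).
Proof.
move=> fi hi; have := integrableD measurableT fi hi.
by apply: eq_integrable => // w _.
Qed.

Lemma integZ (c : R) f : integ f -> integ (fun w => c * f w).
Proof.
move=> fi; have := integrableZl measurableT c fi.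
by apply: eq_integrable => // w _.
Qed.

Lemma integB f h : integ f -> integ h -> integ (fun w => f w - h w).
Proof.
move=> fi hi; have := integrableB measurableT fi hi.
by apply: eq_integrable => // w _.
Qed.

Lemma integ_le f h : measurable_fun [set: Omega] f ->
  (forall w, `|f w| <= h w) -> integ h -> integ f.
Proof.
move=> mf fh; apply: le_integrable => //; first exact/measurable_EFinP.
by move=> w _; rewrite /= lee_fin (le_trans (fh w))// ler_norm.
Qed.

Lemma integ_bounded (c : R) f : measurable_fun [set: Omega] f ->
  (forall w, `|f w| <= c) -> integ f.
Proof.
move=> mf fc; apply: (integ_le _ (fun=> c)) => //.
exact: (@finite_measure_integrable_cst _ _ _ P setT c).
Qed.

Lemma integ_cst (c : R) : integ (fun=> c).
Proof. by apply: (integ_bounded `|c|). Qed.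

Lemma integM (c : R) f h : measurable_fun [set: Omega] h -> integ f ->
  (forall w, `|h w| <= c) -> integ (fun w => h w * f w).
Proof.
move=> mh fi hc; apply: (integ_le _ (fun w => c * `|f w|)).
- by apply: measurable_funM => //; exact: integ_measurable.
- by move=> w; rewrite normrM ler_wpM2r.
- by apply: integZ; exact: integrable_norm.
Qed.

Lemma integ_sum n (f : nat -> Omega -> R) : (forall i, (i < n)%N -> integ (f i)) ->
  integ (fun w => \sum_(i < n) f i w).
Proof.
elim: n => [|n IH] fi.
  by under eq_fun do rewrite big_ord0; exact: integ_cst.
under eq_fun do rewrite big_ord_recr; apply: integD; last exact: fi.
by apply: IH => i ni; apply: fi; rewrite ltnS ltnW.
Qed.

Lemma ExD f h : integ f -> integ h -> Ex (fun w => f w + h w) = Ex f + Ex h.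
Proof. by move=> fi hi; rewrite /Ex RintegralD. Qed.

Lemma ExB f h : integ f -> integ h -> Ex (fun w => f w - h w) = Ex f - Ex h.
Proof. by move=> fi hi; rewrite /Ex RintegralB. Qed.

Lemma ExZ (c : R) f : integ f -> Ex (fun w => c * f w) = c * Ex f.
Proof. by move=> fi; rewrite /Ex RintegralZl. Qed.

Lemma Ex_cst (c : R) : Ex (fun=> c) = c.
Proof.
rewrite /Ex Rintegral_cst// (_ : fine _ = 1) ?mulr1//.
by rewrite [X in fine X](@probability_setT _ _ _ P).
Qed.

Lemma Ex_le f h : integ f -> integ h -> (forall w, f w <= h w) -> Ex f <= Ex h.
Proof. by move=> fi hi fh; apply: le_Rintegral. Qed.

Lemma Ex_ge0 f : (forall w, 0 <= f w) -> 0 <= Ex f.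
Proof. by move=> f0; apply: Rintegral_ge0. Qed.

Lemma Ex_sum n (f : nat -> Omega -> R) : (forall i, (i < n)%N -> integ (f i)) ->
  Ex (fun w => \sum_(i < n) f i w) = \sum_(i < n) Ex (f i).
Proof.
elim: n => [|n IH] fi.
  by under eq_fun do rewrite big_ord0; rewrite Ex_cst big_ord0.
under eq_fun do rewrite big_ord_recr; rewrite ExD ?big_ord_recr/= ?IH//; last exact: fi.
- by move=> i ni; apply: fi; rewrite ltnS ltnW.
- by apply: integ_sum => i ni; apply: fi; rewrite ltnS ltnW.
Qed.

Lemma ExE f : integ f -> (Ex f)%:E = (\int[P]_w (f w)%:E)%E.
Proof. by move=> fi; rewrite /Ex /Rintegral fineK//; exact: integrable_fin_num. Qed.

Lemma integ_ge0 f (c : \bar R) : measurable_fun [set: Omega] f ->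
  (forall w, 0 <= f w) -> (\int[P]_w (f w)%:E <= c)%E -> (c < +oo)%E -> integ f.
Proof.
move=> mf f0 fc cy; apply/integrableP; split; first exact/measurable_EFinP.
apply: le_lt_trans cy; apply: le_trans fc; rewrite le_eqVlt; apply/orP; left.
by apply/eqP; apply: eq_integral => w _; rewrite /= ger0_norm.
Qed.

Lemma Rintegral_ind_ge H f D : sub_sigma H -> Hmeas H f -> integ D -> forall c : R,
  Ex (fun w => ind_ge c (f w) * D w) =
  Rintegral P (f @^-1` [set x | c <= x]) D.
Proof.
move=> sH mf iD c; rewrite Rintegral_mkcond /Ex; apply: eq_Rintegral => w _.
rewrite /ind_ge patchE; case: ifP => cf; first by rewrite mul1r mem_set.
by rewrite mul0r memNset//= cf.
Qed.

(** For h with values in [0, 1], split off the leading binary digit: h * D is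
   half the sum of D restricted to the event 1/2 <= h, which has nonnegative
   integral, and of h' * D, where h' is again a weight in [0, 1].  Iterating, the
   integral of h * D is at least minus 2^-k times the integral of |D|. *)
Lemma Ex_weight_ge0 H D : sub_sigma H -> integ D ->
  (forall A, H A -> 0 <= Rintegral P A D) ->
  forall (c : R) h, Hmeas H h -> (forall w, 0 <= h w <= c) ->
  0 <= Ex (fun w => h w * D w).
Proof.
move=> sH iD D0.
have iD' := integrable_norm iD.
pose B := Ex (fun w => `|D w|).
have key k : forall h, Hmeas H h -> (forall w, 0 <= h w <= 1) ->
    - (2^-1 ^+ k * B) <= Ex (fun w => h w * D w).
  elim: k => [|k IH] h mh h01.
    have mh' := Hmeas_measurable _ _ sH mh.
    rewrite expr0 mul1r -mulN1r -ExZ//; apply: Ex_le => [||w].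
    - exact: integZ.
    - apply: (integM 1) => // w.
      by have /andP[h0 h1] := h01 w; rewrite ger0_norm.
    - have /andP[h0 h1] := h01 w; rewrite mulN1r lerNl -mulrN.
      by apply: le_trans (ler_norm _) _; rewrite normrM normrN ger0_norm// ler_piMl.
  pose h' w := 2 * h w - ind_ge 2^-1 (h w).
  have mh'' : Hmeas H h'.
    by apply: HmeasB; [apply: HmeasM => //; exact: Hmeas_cst|exact: Hmeas_ind_ge].
  have h'01 w : 0 <= h' w <= 1.
    by rewrite /h' /ind_ge; have := h01 w; case: ifPn => ?; lra.
  have mi := Hmeas_measurable _ _ sH (Hmeas_ind_ge _ 2^-1 _ mh).
  have i1 : integ (fun w => ind_ge 2^-1 (h w) * D w).
    apply: (integM 1) => // w.
    by have /andP[? ?] := ind_ge01 2^-1 (h w); rewrite ger0_norm.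
  have i2 : integ (fun w => h' w * D w).
    apply: (integM 1) => //; first exact: Hmeas_measurable mh''.
    by move=> w; have /andP[? ?] := h'01 w; rewrite ger0_norm.
  have -> : (fun w => h w * D w) = (fun w => 2^-1 * (ind_ge 2^-1 (h w) * D w + h' w * D w)).
    by apply/funext => w; rewrite /h'; field.
  rewrite ExZ; last exact: integD.
  rewrite ExD// (Rintegral_ind_ge H)//.
  have := IH _ mh'' h'01.
  have : 0 <= Rintegral P (h @^-1` [set x | 2^-1 <= x]) D.
    apply: D0; apply: (Hmeas_preimage _ _ _ sH) => //.
    rewrite (_ : [set x | _] = `[2^-1, +oo[%classic) ?set_itvE//.
    by rewrite -set_itvcy; exact: measurable_itv.
  by rewrite exprS; lra.
have key2 h : Hmeas H h -> (forall w, 0 <= h w <= 1) -> 0 <= Ex (fun w => h w * D w).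
  move=> mh h01; rewrite leNgt; apply/negP => neg.
  have B0 : 0 <= B by apply: Ex_ge0.
  set x := Ex _ in neg.
  have : 2^-1 ^+ k * B @[k --> \oo] --> 0 * B.
    by apply: cvgM; [apply: cvg_expr; rewrite ger0_norm ?invr_ge0// invf_lt1// ltr1n|exact: cvg_cst].
  rewrite mul0r => /cvgrPdist_lt/(_ (- x)).
  rewrite oppr_gt0 => /(_ neg)[k _ /(_ k (leqnn k))] /=.
  rewrite sub0r normrN ger0_norm; last by rewrite mulr_ge0// exprn_ge0.
  by have := key k h mh h01; rewrite -/x; lra.
move=> c h mh hc; have [c0|c0] := ltP 0 c; last first.
  rewrite (_ : (fun w => _) = (fun=> 0)) ?Ex_cst//.
  by apply/funext => w; have := hc w => hcw; rewrite (_ : h w = 0) ?mul0r//; lra.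
have := key2 (fun w => c^-1 * h w).
have -> : (fun w => c^-1 * h w * D w) = (fun w => c^-1 * (h w * D w)).
  by apply/funext => w; rewrite mulrA.
rewrite ExZ; last first.
  apply: (integM c) => //; first exact: Hmeas_measurable mh.
  by move=> w; have /andP[? ?] := hc w; rewrite ger0_norm.
rewrite pmulr_rge0 ?invr_gt0//; apply.
  by apply: HmeasM => //; exact: Hmeas_cst.
move=> w; have /andP[? ?] := hc w.
apply/andP; split; last by rewrite mulrC ler_pdivrMr// mul1r.
by rewrite mulr_ge0// invr_ge0 ltW.
Qed.

Lemma Ex_weight_le H U V : sub_sigma H -> integ U -> integ V ->
  (forall A, H A -> Rintegral P A U <= Rintegral P A V) ->
  forall (c : R) h, Hmeas H h -> (forall w, 0 <= h w <= c) ->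
  Ex (fun w => h w * U w) <= Ex (fun w => h w * V w).
Proof.
move=> sH iU iV UV c h mh hc.
have mh' := Hmeas_measurable _ _ sH mh.
have hc' w : `|h w| <= c by have /andP[? ?] := hc w; rewrite ger0_norm.
have : 0 <= Ex (fun w => h w * (V w - U w)).
  apply: (Ex_weight_ge0 _ _ sH _ _ c) => //; first exact: integB.
  move=> A HA; rewrite RintegralB ?subr_ge0; first exact: UV.
  - exact: sH.2.
  - by apply: integrableS iV => //; exact: sH.2.
  - by apply: integrableS iU => //; exact: sH.2.
under eq_fun do rewrite mulrBr.
by rewrite ExB ?subr_ge0//; apply: (integM c).
Qed.

(** Adding a constant to h makes it nonnegative. *)
Lemma Ex_weight_eq H U V : sub_sigma H -> integ U -> integ V ->
  (forall A, H A -> Rintegral P A U = Rintegral P A V) ->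
  forall (c : R) h, Hmeas H h -> (forall w, `|h w| <= c) ->
  Ex (fun w => h w * U w) = Ex (fun w => h w * V w).
Proof.
move=> sH iU iV UV c h mh hc.
have c0 : 0 <= c by exact: le_trans (hc point).
have mh' := Hmeas_measurable _ _ sH mh.
have le2 U' V' : integ U' -> integ V' ->
    (forall A, H A -> Rintegral P A U' = Rintegral P A V') ->
    Ex (fun w => h w * U' w) <= Ex (fun w => h w * V' w).
  move=> iU' iV' UV'.
  have iz (W : Omega -> R) : integ W -> integ (fun w => h w * W w) by move=> ?; apply: (integM c).
  have e1 (W : Omega -> R) : integ W ->
      Ex (fun w => (h w + c) * W w) = Ex (fun w => h w * W w) + c * Ex W.
    move=> iW; under eq_fun do rewrite mulrDl.
    by rewrite ExD ?ExZ//; [exact: iz|exact: integZ].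
  have : Ex (fun w => (h w + c) * U' w) <= Ex (fun w => (h w + c) * V' w).
    apply: (Ex_weight_le H _ _ sH iU' iV' _ (c + c)).
    - by move=> A HA; rewrite UV'.
    - by apply: HmeasD => //; exact: Hmeas_cst.
    - by move=> w; have := hc w; rewrite ler_norml => hw; lra.
  rewrite !e1//.
  have : Ex U' = Ex V' by apply: UV'; case: sH => -[H0 HC _] _; rewrite -(setD0 setT); exact: HC.
  by move=> ->; lra.
by apply: le_anti; rewrite !le2// => A HA; rewrite UV.
Qed.

End Expect.

(** * Maximal inequality and monotone limits *)

Section RunMax.
Context {R : realType}.
Implicit Types (s : R) (b : nat -> R).

Fixpoint runmax s b n : R :=
  if n is n'.+1 then Num.max (runmax s b n') (b n) else Num.max s (b 0%N).

Lemma runmax_ge_floor s b n : s <= runmax s b n.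
Proof.
elim: n => [|n IH] /=; first by rewrite le_max lexx.
by rewrite le_max IH.
Qed.

Lemma runmax_nondecreasing s b : nondecreasing_seq (runmax s b).
Proof. by apply/nondecreasing_seqP => n /=; rewrite le_max lexx. Qed.

Lemma runmax_ge s b k n : (k <= n)%N -> b k <= runmax s b n.
Proof.
move=> /(runmax_nondecreasing s b); apply: le_trans.
by case: k => [|k] /=; rewrite le_max lexx orbT.
Qed.

Lemma runmax_le s b n (M : R) : s <= M -> (forall k, (k <= n)%N -> b k <= M) ->
  runmax s b n <= M.
Proof.
move=> sM; elim: n => [|n IH] bM /=; rewrite ge_max; first by rewrite sM bM.
by rewrite bM// andbT; apply: IH => k kn; apply: bM; rewrite ltnW.
Qed.

(** At a new record b > m the left-hand side is 2 * sqrt b, which the inequality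
   of arithmetic and geometric means bounds by the right-hand side. *)
Lemma sqrt_record_step (m b : R) : 0 < m -> 0 <= b ->
  Num.sqrt (Num.max m b) + b / Num.sqrt (Num.max m b) <= Num.sqrt m + b / Num.sqrt m.
Proof.
move=> m0 b0; have [bm|mb] := leP b m; first by [].
have u0 : 0 < Num.sqrt m by rewrite sqrtr_gt0.
have v0 : 0 < Num.sqrt b by rewrite sqrtr_gt0 (lt_trans m0).
have -> : b / Num.sqrt b = Num.sqrt b.
  by rewrite -{1}(sqr_sqrtr b0) expr2 mulfK ?gt_eqF.
rewrite -(ler_pM2r u0) [leRHS]mulrDl divfK ?gt_eqF//.
by have := sqr_ge0 (Num.sqrt m - Num.sqrt b); have := sqr_sqrtr b0; nra.
Qed.

End RunMax.

Section Maximal.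
Context {R : realType} {dO : measure_display} {Omega : measurableType dO}
  (P : probability Omega R).
Implicit Types (F : nat -> set (set Omega)) (B e : nat -> Omega -> R).

Lemma Hmeas_runmax F B (s : R) : (forall n, sub_sigma (F n)) ->
  (forall n, F n `<=` F n.+1) -> (forall n, Hmeas (F n) (B n)) ->
  forall n, Hmeas (F n) (fun w => runmax s (fun k => B k w) n).
Proof.
move=> sF FS mB; elim=> [|n IH].
  by apply: Hmeas_max => //; exact: Hmeas_cst.
by apply: Hmeas_max => //; apply: HmeasW IH.
Qed.

Lemma integ_runmax B (s : R) : (forall n w, 0 <= B n w) -> (forall n, integ P (B n)) ->
  forall n, integ P (fun w => runmax s (fun k => B k w) n).
Proof.
move=> B0 iB.
have mB n : measurable_fun [set: Omega] (B n) by exact: integ_measurable (iB n).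
have mr n : measurable_fun [set: Omega] (fun w => runmax s (fun k => B k w) n).
  by elim: n => [|n IH]; apply: measurable_maxr.
elim=> [|n IH].
  apply: (integ_le _ _ (fun w => `|s| + B 0%N w)) => //.
    move=> w /=; have [_|_] := leP s (B 0%N w); last by rewrite lerDl.
    by rewrite ger0_norm// lerDr.
  by apply: integD => //; exact: integ_cst.
apply: (integ_le _ _ (fun w => `|runmax s (fun k => B k w) n| + B n.+1 w)) => //.
  move=> w /=; have [_|_] := leP (runmax s (fun k => B k w) n) (B n.+1 w).
    by rewrite ger0_norm// lerDr.
  by rewrite lerDl.
by apply: integD => //; exact: integrable_norm.
Qed.

(** Doob-type maximal inequality for the square root of the running maximum m
   of an almost supermartingale B.  The process sqrt m + B / sqrt m is again an
   almost supermartingale, because a record of B does not increase it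
   (sqrt_record_step) and because the weight 1 / sqrt m is known one step
   ahead.  This weight satisfies c^2 * B <= 1, so the drift condition is only
   required for such weights. *)
Lemma Ex_sqrt_runmax F B e (s : R) : 0 < s -> (forall n, sub_sigma (F n)) ->
  (forall n, F n `<=` F n.+1) -> (forall n, Hmeas (F n) (B n)) ->
  (forall n w, 0 <= B n w) -> (forall n w, 0 <= e n w) ->
  (forall n, integ P (B n)) -> (forall n, integ P (e n)) ->
  (forall n (c : Omega -> R), Hmeas (F n) c ->
     (forall w, 0 <= c w <= (Num.sqrt s)^-1) ->
     (forall w, c w ^+ 2 * B n w <= 1) ->
     Ex P (fun w => c w * (B n.+1 w - B n w)) <= Ex P (fun w => c w * e n w)) ->
  forall N, integ P (fun w => Num.sqrt (runmax s (fun k => B k w) N)) /\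
  Ex P (fun w => Num.sqrt (runmax s (fun k => B k w) N)) <=
    Num.sqrt s + (Num.sqrt s)^-1 * (Ex P (B 0%N) + \sum_(n < N) Ex P (e n)).
Proof.
move=> s0 sF FS mB B0 e0 iB ie drift N.
pose m n w := runmax s (fun k => B k w) n.
have sm n w : s <= m n w by exact: runmax_ge_floor.
have m0 n w : 0 < m n w by exact: lt_le_trans (sm n w).
have r0 n w : 0 < Num.sqrt (m n w) by rewrite sqrtr_gt0.
have rs0 : 0 < Num.sqrt s by rewrite sqrtr_gt0.
have mm n : Hmeas (F n) (m n) by exact: Hmeas_runmax.
have mr n : Hmeas (F n) (fun w => Num.sqrt (m n w)) by exact: Hmeas_sqrt.
pose c n w := (Num.sqrt (m n w))^-1.
have mc n : Hmeas (F n) (c n) by exact: HmeasV.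
have c0 n w : 0 <= c n w <= (Num.sqrt s)^-1.
  by rewrite invr_ge0 ltW//= lef_pV2 ?posrE// ler_wsqrtr.
have cn n w : `|c n w| <= (Num.sqrt s)^-1.
  by have /andP[? ?] := c0 n w; rewrite ger0_norm.
have mc' n : measurable_fun [set: Omega] (c n) by exact: Hmeas_measurable (mc n).
have mr' n : measurable_fun [set: Omega] (fun w => Num.sqrt (m n w)).
  exact: Hmeas_measurable (mr n).
have ir n : integ P (fun w => Num.sqrt (m n w)).
  apply: (integ_le _ _ (fun w => 1 + m n w)) => // [w|].
    rewrite ger0_norm ?sqrtr_ge0//.
    have := sqr_sqrtr (ltW (m0 n w)); have := sqr_ge0 (Num.sqrt (m n w) - 1).
    by rewrite -/(m n w); nra.
  by apply: integD; [exact: integ_cst|exact: integ_runmax].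
have icB n k : integ P (fun w => c n w * B k w) by exact: integM (cn n).
have ice n : integ P (fun w => c n w * e n w) by exact: integM (cn n).
split; first exact: ir.
pose f n w := Num.sqrt (m n w) + c n w * B n w.
have if_ n : integ P (f n) by exact: integD.
have step n : Ex P (f n.+1) <= Ex P (f n) + (Num.sqrt s)^-1 * Ex P (e n).
  apply: (@le_trans _ _ (Ex P (fun w => f n w + c n w * (B n.+1 w - B n w)))).
    apply: Ex_le => // [|w].
      apply: integD => //; apply: integM (cn n) => //; exact: integB.
    apply: (@le_trans _ _ (Num.sqrt (m n w) + c n w * B n.+1 w)).
      by have := sqrt_record_step (m n w) (B n.+1 w) (m0 n w) (B0 _ _); rewrite ![_ / _]mulrC.
    by rewrite /f; lra.
  rewrite ExD//; last by apply: integM (cn n) => //; exact: integB.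
  rewrite lerD2l; apply: le_trans (drift n (c n) (mc n) (c0 n) _) _.
    move=> w; rewrite /c exprVn (sqr_sqrtr (ltW (m0 n w))) mulrC ler_pdivrMr// mul1r.
    exact: runmax_ge.
  rewrite -ExZ//; apply: Ex_le => // [|w]; first exact: integZ.
  by have /andP[? ?] := c0 n w; rewrite ler_wpM2r.
have total n : Ex P (f n) <= Num.sqrt s +
    (Num.sqrt s)^-1 * (Ex P (B 0%N) + \sum_(i < n) Ex P (e i)).
  elim: n => [|n IH].
    rewrite big_ord0 addr0 -[X in X + _](Ex_cst P) -ExZ// -ExD; last 2 first.
    - exact: integ_cst.
    - exact: integZ.
    apply: Ex_le => // [|w].
      by apply: integD; [exact: integ_cst|exact: integZ].
    by have := sqrt_record_step s (B 0%N w) s0 (B0 _ _); rewrite ![_ / _]mulrC.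
  apply: le_trans (step n) _; rewrite big_ord_recr/=; move: IH.
  by move: (Ex P (f n)) (Num.sqrt s)^-1 (\sum_(_ < _) _) => x y z; lra.
apply: (le_trans _ (total N)); apply: Ex_le => [||w]; [exact: ir|exact: if_|].
by rewrite lerDl mulr_ge0//; have /andP[] := c0 N w.
Qed.

End Maximal.

Section SupMonotone.
Context {R : realType} {dO : measure_display} {Omega : measurableType dO}
  (P : probability Omega R).

Lemma measurable_sup_range (u : nat -> Omega -> R) :
  (forall n, measurable_fun [set: Omega] (u n)) ->
  measurable_fun [set: Omega] (fun w => ereal_sup (range (fun n => (u n w)%:E))).
Proof.
move=> mu.
have -> : (fun w => ereal_sup (range (fun n => (u n w)%:E))) =
    (fun w => esups (fun n => (u n w)%:E) 0).
  apply/funext => w; rewrite /esups /sdrop; congr ereal_sup.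
  by apply/seteqP; split => x [n _ <-]; exists n.
by apply: measurable_fun_esups => n; exact/measurable_EFinP.
Qed.

Lemma sup_range_ge0 (u : nat -> R) : (forall n, 0 <= u n) ->
  (0 <= ereal_sup (range (fun n => (u n)%:E)))%E.
Proof.
move=> u0; apply: le_ereal_sup_tmp; exists (u 0%N)%:E; first by exists 0%N.
by rewrite lee_fin.
Qed.

(** Monotone convergence, with the limit written as a supremum. *)
Lemma integral_sup_nondecreasing (u : nat -> Omega -> R) (C : R) :
  (forall n w, 0 <= u n w) -> (forall w, nondecreasing_seq (fun n => u n w)) ->
  (forall n, integ P (u n)) -> (forall n, Ex P (u n) <= C) ->
  (\int[P]_w ereal_sup (range (fun n => (u n w)%:E)) <= C%:E)%E.
Proof.
move=> u0 und iu uC.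
have cvgu w : (fun n => (u n w)%:E) @ \oo --> ereal_sup (range (fun n => (u n w)%:E)).
  by apply: ereal_nondecreasing_cvgn => m n mn; rewrite lee_fin und.
under eq_integral do rewrite -(cvg_lim _ (cvgu _))//.
rewrite monotone_convergence//.
- apply: lime_le.
    apply: ereal_nondecreasing_is_cvgn => m n mn.
    apply: ge0_le_integral => //.
    + by move=> w _; rewrite lee_fin.
    + by apply/measurable_EFinP; exact: integ_measurable (iu m).
    + by apply/measurable_EFinP; exact: integ_measurable (iu n).
    + by move=> w _; rewrite lee_fin und.
  by apply: nearW => n; rewrite -ExE// lee_fin.
- by move=> n; apply/measurable_EFinP; exact: integ_measurable (iu n).
- by move=> n w _; rewrite lee_fin.
- by move=> w _ m n mn; rewrite lee_fin und.
Qed.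

Lemma integral_sup_runmax (u : nat -> Omega -> R) (C : R) :
  (forall n w, 0 <= u n w) -> (forall n, integ P (u n)) ->
  (forall n, Ex P (fun w => runmax 0 (fun k => u k w) n) <= C) ->
  (\int[P]_w ereal_sup (range (fun n => (u n w)%:E)) <= C%:E)%E.
Proof.
move=> u0 iu uC.
have h := integral_sup_nondecreasing (fun n w => runmax 0 (fun k => u k w) n) C _ _ _ uC.
apply: le_trans (h _ _ _) => //.
- apply: ge0_le_integral => //.
  + by move=> w _; exact: sup_range_ge0.
  + by apply: measurable_sup_range => n; exact: integ_measurable (iu n).
  + by apply: measurable_sup_range => n; apply: integ_measurable; exact: integ_runmax.
  + move=> w _; apply: ge_ereal_sup => _ [n _ <-].
    apply: le_ereal_sup_tmp; exists (runmax 0 (fun k => u k w) n)%:E; first by exists n.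
    by rewrite lee_fin runmax_ge.
- by move=> n w; exact: runmax_ge_floor.
- by move=> w; exact: runmax_nondecreasing.
- exact: integ_runmax.
Qed.

Lemma ae_lty (f : Omega -> \bar R) : measurable_fun [set: Omega] f ->
  (forall w, 0 <= f w)%E -> (\int[P]_w f w < +oo)%E -> {ae P, forall w, (f w < +oo)%E}.
Proof.
move=> mf f0 fi.
have : P.-integrable setT f.
  apply/integrableP; split => //; apply: le_lt_trans fi.
  by rewrite le_eqVlt; apply/orP; left; apply/eqP; apply: eq_integral => w _; rewrite gee0_abs.
move=> /(integrable_ae measurableT); apply: filterS => w /(_ I).
by rewrite ge0_fin_numE.
Qed.

Lemma ae_summable (a : nat -> Omega -> R) (C : R) : (forall n w, 0 <= a n w) ->
  (forall n, integ P (a n)) -> (forall N, \sum_(n < N) Ex P (a n) <= C) ->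
  {ae P, forall w, exists M : R, forall N, \sum_(n < N) a n w <= M}.
Proof.
move=> a0 ia aC; pose u N w := \sum_(n < N) a n w.
have u0 N w : 0 <= u N w by exact: sumr_ge0.
have iu N : integ P (u N) by exact: integ_sum.
have h := integral_sup_nondecreasing u C u0 _ iu _.
have {}h : (\int[P]_w ereal_sup (range (fun n => (u n w)%:E)) <= C%:E)%E.
  apply: h.
    by move=> w; apply/nondecreasing_seqP => n; rewrite /u big_ord_recr/= lerDl.
  by move=> n; rewrite Ex_sum.
have f0 w : (0 <= ereal_sup (range (fun n => (u n w)%:E)))%E.
  exact: sup_range_ge0.
have ms : measurable_fun [set: Omega] (fun w => ereal_sup (range (fun n => (u n w)%:E))).
  by apply: measurable_sup_range => n; exact: integ_measurable (iu n).
have := ae_lty _ ms f0 (le_lt_trans h (ltry _)).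
apply: filterS => w; move: (f0 w).
case E : (ereal_sup _) => [r||]// _ _; exists r => N.
by rewrite -lee_fin -E; apply: ereal_sup_ubound; exists N.
Qed.

End SupMonotone.

(** * Real inequalities for one step *)

Ltac nneg := repeat first [ done | solve [apply: ltW; done] | apply: sqr_ge0
  | apply: mulr_ge0 | apply: addr_ge0 | apply: exprn_ge0 | rewrite invr_ge0 ].

Section OneStep.
Context {R : realType}.

(* throughout u = sqrt S, u' = sqrt (S + q^2) *)

Lemma le_of_sqr (x y : R) : 0 <= y -> x ^+ 2 <= y ^+ 2 -> x <= y.
Proof. by move=> y0 h; rewrite leNgt; apply/negP => yx; move: h; nra. Qed.

(** Errors of relative size (q / u')^2, divided by u, are paid by the decrease
   of 1 / u, whose sum over all steps telescopes. *)
Lemma decay_ge (u u' q : R) : 0 < u -> 0 < u' -> u' ^+ 2 = u ^+ 2 + q ^+ 2 ->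
  (q / u') ^+ 2 / u <= 2 * (u^-1 - u'^-1).
Proof.
move=> u0 u'0 e; have uu : u <= u' by apply: le_of_sqr; rewrite ?(ltW u'0)// e lerDl sqr_ge0.
have -> : (q / u') ^+ 2 / u = (u' - u) / (u * u') * ((u' + u) / u').
  have -> : (q / u') ^+ 2 / u = q ^+ 2 / (u' ^+ 2 * u) by field; rewrite !gt_eqF.
  have -> : q ^+ 2 = u' ^+ 2 - u ^+ 2 by rewrite e; ring.
  by field; rewrite !gt_eqF.
have -> : u^-1 - u'^-1 = (u' - u) / (u * u') by field; rewrite !gt_eqF.
rewrite mulrC ler_wpM2r//.
  by rewrite divr_ge0 ?subr_ge0// mulr_ge0// ltW.
by rewrite ler_pdivrMr//; lra.
Qed.

Lemma decay_mul_le (u u' q : R) : 0 < u -> 0 < u' -> 0 <= q -> u' ^+ 2 = u ^+ 2 + q ^+ 2 ->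
  0 <= (u^-1 - u'^-1) * q <= q ^+ 2 / u ^+ 2.
Proof.
move=> u0 u'0 q0 e.
have uu : u <= u' by apply: le_of_sqr; rewrite ?(ltW u'0)// e lerDl sqr_ge0.
have qu : q <= u' by apply: le_of_sqr; rewrite ?(ltW u'0)// e lerDr sqr_ge0.
have -> : u^-1 - u'^-1 = (u' - u) / (u * u') by field; rewrite !gt_eqF.
apply/andP; split; first by rewrite mulr_ge0// divr_ge0 ?subr_ge0// mulr_ge0// ltW.
have -> : (u' - u) / (u * u') * q = (u' - u) * q / (u * u') by field; rewrite !gt_eqF.
rewrite ler_pdivrMr ?mulr_gt0//.
have -> : q ^+ 2 / u ^+ 2 * (u * u') = q ^+ 2 * u' / u by field; rewrite !gt_eqF.
rewrite ler_pdivlMr//.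
have -> : q ^+ 2 * u' = q * (q * u') by ring.
have -> : (u' - u) * q * u = q * ((u' - u) * u) by ring.
rewrite ler_wpM2l//.
have h : (u' - u) * (u' + u) = q ^+ 2 by rewrite -subr_sqr e; ring.
have : (u' - u) * u <= q ^+ 2 by rewrite -h ler_wpM2l ?subr_ge0// lerDr ltW.
by move/le_trans; apply; rewrite expr2 ler_wpM2l.
Qed.

Lemma ratio_le1 (u u' q : R) : 0 < u -> 0 < u' -> 0 <= q -> u' ^+ 2 = u ^+ 2 + q ^+ 2 ->
  0 <= q / u' <= 1.
Proof.
move=> u0 u'0 q0 e; apply/andP; split; first by rewrite divr_ge0// ltW.
rewrite ler_pdivrMr// mul1r.
by apply: le_of_sqr; rewrite ?(ltW u'0)// e lerDr sqr_ge0.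
Qed.

Lemma ratio_sqr_le (u u' q : R) : 0 < u -> 0 < u' -> u' ^+ 2 = u ^+ 2 + q ^+ 2 ->
  (q / u') ^+ 2 <= q ^+ 2 / u ^+ 2.
Proof.
move=> u0 u'0 e; rewrite expr_div_n ler_wpM2l ?sqr_ge0// lef_pV2 ?posrE ?exprn_gt0//.
by rewrite e lerDl sqr_ge0.
Qed.

(** The surrogate step size 1 / t, t = sqrt (S + X), is known before the
   gradient is drawn; replacing 1 / u' by it costs only terms that carry the
   factor (q / u')^2, or are absorbed by gam^2 after conditioning. *)
Lemma surrogate_step (u u' q t d gam v X : R) : 0 < u -> 0 < u' -> 0 <= q -> 0 < t ->
  0 < v -> 0 <= X -> 0 <= gam ->
  u' ^+ 2 = u ^+ 2 + q ^+ 2 -> t ^+ 2 = u ^+ 2 + X -> `|d| <= gam * q ->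
  - (d / u') <= - (d / t) + (gam ^+ 2 * q ^+ 2 / (4 * v) + gam ^+ 2 / 4 +
     (v + X) * (q / u') ^+ 2) / t.
Proof.
move=> u0 u'0 q0 t0 v0 X0 gam0 e et dq.
have qu : q <= u' by apply: le_of_sqr; rewrite ?(ltW u'0)// e lerDr sqr_ge0.
set rho := q / u'.
have rho0 : 0 <= rho by rewrite divr_ge0// ltW.
pose y := Num.sqrt X.
have y0 : 0 <= y by exact: sqrtr_ge0.
have yX : y ^+ 2 = X by rewrite sqr_sqrtr.
have yt : y <= t by apply: le_of_sqr; rewrite ?(ltW t0)// et yX lerDr sqr_ge0.
have h1 : `|t - u'| <= y + q.
  have hh : `|t - u'| * (t + u') <= (y + q) * (t + u').
    have tu0 : 0 <= t + u' by rewrite addr_ge0// ltW.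
    rewrite -[X in _ * X <= _](ger0_norm tu0) -normrM.
    have -> : (t - u') * (t + u') = X - q ^+ 2 by rewrite -subr_sqr e et; ring.
    apply: (@le_trans _ _ (X + q ^+ 2)).
      by rewrite ler_norml; have := sqr_ge0 q; lra.
    by rewrite -yX; nra.
  by rewrite -(@ler_pM2r _ (t + u')) ?addr_gt0.
have h2 : d / t - d / u' <= gam * rho * (y + q) / t.
  have -> : d / t - d / u' = d * (u' - t) / (t * u') by field; rewrite !gt_eqF.
  have -> : gam * rho * (y + q) / t = gam * q * (y + q) / (t * u').
    by rewrite /rho; field; rewrite !gt_eqF.
  rewrite ler_pM2r ?invr_gt0 ?mulr_gt0//.
  apply: le_trans (ler_norm _) _; rewrite normrM distrC.
  by apply: ler_pM.
have h3 : gam * rho * (y + q) <=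
    gam ^+ 2 * q ^+ 2 / (4 * v) + gam ^+ 2 / 4 + (v + X) * rho ^+ 2.
  have a1 : gam * rho * q <= gam ^+ 2 * q ^+ 2 / (4 * v) + v * rho ^+ 2.
    rewrite -subr_ge0.
    have -> : gam ^+ 2 * q ^+ 2 / (4 * v) + v * rho ^+ 2 - gam * rho * q =
        (gam * q - 2 * v * rho) ^+ 2 / (4 * v) by field; rewrite gt_eqF.
    by rewrite divr_ge0 ?sqr_ge0// mulr_ge0// ltW.
  have a2 : gam * rho * y <= gam ^+ 2 / 4 + X * rho ^+ 2.
    by rewrite -yX; have := sqr_ge0 (gam / 2 - y * rho); nra.
  by rewrite mulrDr [(v + X) * _]mulrDl; lra.
have : gam * rho * (y + q) / t <= (gam ^+ 2 * q ^+ 2 / (4 * v) + gam ^+ 2 / 4 +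
     (v + X) * rho ^+ 2) / t by rewrite ler_pM2r ?invr_gt0.
by lra.
Qed.

Lemma increment_sqr_le (al L X X' rho d' gam : R) : 0 < al -> 0 < L -> 1 <= X ->
  0 <= rho <= 1 -> 0 <= gam -> gam ^+ 2 <= 4 * L * X ->
  `|d'| <= gam * rho ->
  `|X' - X + al * d'| <= L * al ^+ 2 * rho ^+ 2 ->
  (X' - X) ^+ 2 <= (8 * L * al ^+ 2 + 2 * L ^+ 2 * al ^+ 4) * X * rho ^+ 2.
Proof.
move=> al0 L0 X1 /andP[r0 r1] g0 gX dd hD.
have h : `|X' - X| <= al * (gam * rho) + L * al ^+ 2 * rho ^+ 2.
  have -> : X' - X = (X' - X + al * d') - al * d' by ring.
  apply: le_trans (ler_normB _ _) _; rewrite addrC; apply: lerD => //.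
  by rewrite normrM (gtr0_norm al0) ler_wpM2l// ltW.
rewrite -real_normK ?num_real//.
apply: (@le_trans _ _ ((al * (gam * rho) + L * al ^+ 2 * rho ^+ 2) ^+ 2)).
  by rewrite ler_pXn2r// nnegrE ?(le_trans _ h).
apply: (@le_trans _ _ (2 * (al * (gam * rho)) ^+ 2 + 2 * (L * al ^+ 2 * rho ^+ 2) ^+ 2)).
  by have := sqr_ge0 (al * (gam * rho) - L * al ^+ 2 * rho ^+ 2); nra.
have -> : 2 * (al * (gam * rho)) ^+ 2 = 2 * al ^+ 2 * rho ^+ 2 * gam ^+ 2 by ring.
have -> : 2 * (L * al ^+ 2 * rho ^+ 2) ^+ 2 = 2 * L ^+ 2 * al ^+ 4 * rho ^+ 2 * rho ^+ 2 by ring.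
have a1 : 2 * al ^+ 2 * rho ^+ 2 * gam ^+ 2 <= 2 * al ^+ 2 * rho ^+ 2 * (4 * L * X).
  by apply: ler_wpM2l => //; nneg.
have a2 : 2 * L ^+ 2 * al ^+ 4 * rho ^+ 2 * rho ^+ 2 <= 2 * L ^+ 2 * al ^+ 4 * rho ^+ 2 * X.
  apply: ler_wpM2l; first by nneg.
  by apply: le_trans X1; rewrite expr_le1.
apply: le_trans (lerD a1 a2) _; rewrite le_eqVlt; apply/orP; left; apply/eqP; ring.
Qed.

(** Second-order Taylor expansion of X^4: the terms of order 3 and 4 are
   dominated by the one of order 2, because the increment is at most c * X. *)
Lemma fourth_power_step (X X' c : R) : 1 <= X -> 0 <= X' -> 1 <= c -> X' <= c * X ->
  X' ^+ 4 <= X ^+ 4 + 4 * X ^+ 3 * (X' - X) + (6 + 4 * c + c ^+ 2) * X ^+ 2 * (X' - X) ^+ 2.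
Proof.
move=> X1 X'0 c1 cX; set D := X' - X.
have X0 : 0 <= X by exact: le_trans X1.
have -> : X' = X + D by rewrite /D; ring.
have D1 : `|D| <= c * X by rewrite ler_norml /D; nra.
have -> : (X + D) ^+ 4 = X ^+ 4 + 4 * X ^+ 3 * D + D ^+ 2 * (6 * X ^+ 2 + 4 * X * D + D ^+ 2) by ring.
have -> : (6 + 4 * c + c ^+ 2) * X ^+ 2 * D ^+ 2 =
  D ^+ 2 * (6 * X ^+ 2 + 4 * X * (c * X) + (c * X) ^+ 2) by ring.
rewrite lerD2l ler_wpM2l ?sqr_ge0//.
have a1 : 4 * X * D <= 4 * X * (c * X).
  by apply: ler_wpM2l; [nneg|exact: le_trans (ler_norm _) D1].
have a2 : D ^+ 2 <= (c * X) ^+ 2.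
  by rewrite -real_normK ?num_real// ler_pXn2r// nnegrE// (le_trans _ D1).
by lra.
Qed.

(** For y above K / b the difference is nonpositive. *)
Lemma septic_absorb (K b y : R) : 0 <= K -> 0 < b -> 0 <= y ->
  K * y ^+ 7 - b * y ^+ 8 <= K * (K / b) ^+ 7.
Proof.
move=> K0 b0 y0.
have -> : K * y ^+ 7 - b * y ^+ 8 = y ^+ 7 * (K - b * y) by ring.
have [h|h] := leP y (K / b).
  apply: (@le_trans _ _ (y ^+ 7 * K)).
    by rewrite ler_wpM2l ?exprn_ge0// gerBl mulr_ge0// ltW.
  by rewrite mulrC ler_wpM2l// ler_pXn2r// nnegrE// divr_ge0// ltW.
apply: (@le_trans _ _ 0); last by rewrite mulr_ge0// exprn_ge0// divr_ge0// ltW.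
rewrite mulr_ge0_le0 ?exprn_ge0// subr_le0 mulrC -ler_pdivrMr//; exact: ltW.
Qed.

(** One step of the recursion: u and u' are the square roots of the
   accumulators before and after, q the norm of the stochastic gradient, gam
   the norm of the true one, d their inner product, X and X' are 1 plus the
   objective before and after. *)
Record one_step (al L c u u' q d gam X X' : R) : Prop := OneStepFacts {
  os_u : 0 < u; os_u' : 0 < u'; os_q : 0 <= q; os_gam : 0 <= gam;
  os_uu' : u' ^+ 2 = u ^+ 2 + q ^+ 2;
  os_X : 1 <= X; os_X' : 1 <= X';
  os_gamX : gam ^+ 2 <= 4 * L * X;
  os_d : `|d| <= gam * q;
  os_XX' : X <= c * X'; os_X'X : X' <= c * X;
  os_taylor : `|X' - X + al * (d / u')| <= L * al ^+ 2 * (q / u') ^+ 2 }.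

Lemma one_step_increment_sqr (al L c u u' q d gam X X' : R) : 0 < al -> 0 < L ->
  one_step al L c u u' q d gam X X' ->
  (X' - X) ^+ 2 <= (8 * L * al ^+ 2 + 2 * L ^+ 2 * al ^+ 4) * X * (q / u') ^+ 2.
Proof.
move=> al0 L0 [u0 u'0 q0 g0 e X1 X'1 gX dq XX' X'X T].
apply: (increment_sqr_le _ _ _ _ _ (d / u') gam) => //; first exact: (ratio_le1 u).
by rewrite normrM normfV (gtr0_norm u'0) mulrA ler_pM2r// invr_gt0.
Qed.

(** The constants produced by the errors are absorbed by the decrease of the
   weight 1 / u in front of the highest power X^4. *)
Lemma quartic_over_sqrt_step (al L c V : R) : 0 < al -> 0 < L -> 1 <= c -> 0 <= V ->
  exists2 K : R, 0 <= K & forall u u' q d gam X X' t v : R,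
    one_step al L c u u' q d gam X X' ->
    0 < t -> t ^+ 2 = u ^+ 2 + X -> 0 < v -> v <= V * X ->
    X' ^+ 4 / u' <= X ^+ 4 / u -
      4 * al * X ^+ 3 / (u * t) * (d - gam ^+ 2 * q ^+ 2 / (4 * v) - gam ^+ 2 / 4) +
      K * (u^-1 - u'^-1).
Proof.
move=> al0 L0 c1 V0.
pose C1 := 8 * L * al ^+ 2 + 2 * L ^+ 2 * al ^+ 4.
pose C3 := 6 + 4 * c + c ^+ 2.
pose K1 := 4 * L * al ^+ 2 + C3 * C1 + 4 * al * (V + 1).
have c0 : 0 < c by exact: lt_le_trans c1.
have C10 : 0 <= C1 by rewrite /C1; nneg.
have C30 : 0 <= C3 by rewrite /C3; nneg.
have K10 : 0 <= K1 by rewrite /K1; nneg.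
pose K := 2 * K1 * (2 * K1 / c^-1 ^+ 4) ^+ 7.
exists K => [|u u' q d gam X X' t v os t0 et v0 vX]; first by rewrite /K; nneg.
have Dsq := one_step_increment_sqr _ _ _ _ _ _ _ _ _ _ al0 L0 os.
case: os => u0 u'0 q0 g0 e X1 X'1 gX dq XX' X'X T.
have X0 : 0 < X by exact: lt_le_trans X1.
have X'0 : 0 < X' by exact: lt_le_trans X'1.
set rho2 := (q / u') ^+ 2 in T Dsq *.
have r0 : 0 <= rho2 by exact: sqr_ge0.
have h1 : X' ^+ 4 <= X ^+ 4 - 4 * al * X ^+ 3 * (d / u') + (4 * L * al ^+ 2 + C3 * C1) * X ^+ 3 * rho2.
  apply: le_trans (fourth_power_step _ _ _ X1 (ltW X'0) c1 X'X) _.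
  have b1 : 4 * X ^+ 3 * (X' - X) <= 4 * X ^+ 3 * (- (al * (d / u')) + L * al ^+ 2 * rho2).
    by apply: ler_wpM2l; [nneg|move: T; rewrite ler_norml => /andP[_]; lra].
  have b2 : C3 * X ^+ 2 * (X' - X) ^+ 2 <= C3 * X ^+ 2 * (C1 * X * rho2).
    by apply: ler_wpM2l; first nneg.
  rewrite -/C3; apply: le_trans (lerD (lerD (lexx _) b1) b2) _.
  by rewrite le_eqVlt; apply/orP; left; apply/eqP; ring.
have h2 := surrogate_step _ _ _ _ _ _ _ _ u0 u'0 q0 t0 v0 (ltW X0) g0 e et dq.
rewrite -/rho2 in h2.
pose y := Num.sqrt X.
have y0 : 0 <= y by exact: sqrtr_ge0.
have yX : y ^+ 2 = X by rewrite sqr_sqrtr// ltW.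
have y1 : 1 <= y by apply: le_of_sqr => //; rewrite yX expr1n.
have yt : y <= t by apply: le_of_sqr; [exact: ltW|rewrite et yX lerDr sqr_ge0].
have h3 : (v + X) / t <= (V + 1) * y.
  rewrite ler_pdivrMr//; apply: (@le_trans _ _ ((V + 1) * (y * y))).
    by rewrite -expr2 yX; lra.
  by rewrite -mulrA ler_wpM2l ?addr_ge0// ler_wpM2l.
set w := 4 * al * X ^+ 3 / (u * t).
set Q := gam ^+ 2 * q ^+ 2 / (4 * v) in h2 *.
have h4 : - (4 * al * X ^+ 3 * (d / u')) <=
   - (4 * al * X ^+ 3 / t) * (d - Q - gam ^+ 2 / 4) + 4 * al * (V + 1) * (y ^+ 7 * rho2).
  have : 4 * al * X ^+ 3 * - (d / u') <= 4 * al * X ^+ 3 *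
      (- (d / t) + (Q + gam ^+ 2 / 4 + (v + X) * rho2) / t).
    by apply: ler_wpM2l => //; nneg.
  have : 4 * al * X ^+ 3 * ((v + X) / t * rho2) <= 4 * al * X ^+ 3 * ((V + 1) * y * rho2).
    by apply: ler_wpM2l; [nneg|apply: ler_wpM2r].
  have -> : 4 * al * X ^+ 3 * ((V + 1) * y * rho2) = 4 * al * (V + 1) * (y ^+ 7 * rho2).
    by rewrite -yX; ring.
  have -> : 4 * al * X ^+ 3 * (- (d / t) + (Q + gam ^+ 2 / 4 + (v + X) * rho2) / t) =
     - (4 * al * X ^+ 3 / t) * (d - Q - gam ^+ 2 / 4) + 4 * al * X ^+ 3 * ((v + X) / t * rho2).
    by field; rewrite gt_eqF.
  by lra.
have h5 : X ^+ 3 * rho2 <= y ^+ 7 * rho2.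
  apply: ler_wpM2r => //; rewrite -yX -exprM; exact: ler_weXn2l.
have h6 : X' ^+ 4 <= X ^+ 4 - (4 * al * X ^+ 3 / t) * (d - Q - gam ^+ 2 / 4) + K1 * y ^+ 7 * rho2.
  have : (4 * L * al ^+ 2 + C3 * C1) * (X ^+ 3 * rho2) <= (4 * L * al ^+ 2 + C3 * C1) * (y ^+ 7 * rho2).
    by apply: ler_wpM2l => //; nneg.
  by rewrite /K1; lra.
have h7 : rho2 / u <= 2 * (u^-1 - u'^-1) by exact: decay_ge.
have l0 : 0 <= u^-1 - u'^-1.
  rewrite subr_ge0 lef_pV2 ?posrE//; apply: le_of_sqr; first exact: ltW.
  by rewrite e lerDl sqr_ge0.
have h8 : c^-1 ^+ 4 * y ^+ 8 <= X' ^+ 4.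
  have -> : y ^+ 8 = X ^+ 4 by rewrite -yX -exprM.
  rewrite -exprMn ler_pXn2r ?nnegrE ?mulr_ge0 ?invr_ge0 ?(ltW X0) ?(ltW X'0) ?(ltW c0)//.
  by rewrite mulrC ler_pdivrMr// mulrC.
have h9 : K1 * y ^+ 7 * (rho2 / u) <= 2 * K1 * y ^+ 7 * (u^-1 - u'^-1).
  have : K1 * y ^+ 7 * (rho2 / u) <= K1 * y ^+ 7 * (2 * (u^-1 - u'^-1)).
    by apply: ler_wpM2l => //; nneg.
  by lra.
have h10 : (2 * K1 * y ^+ 7 - c^-1 ^+ 4 * y ^+ 8) * (u^-1 - u'^-1) <= K * (u^-1 - u'^-1).
  apply: ler_wpM2r => //; apply: septic_absorb => //; first by nneg.
  by rewrite exprn_gt0// invr_gt0.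
have h11 : c^-1 ^+ 4 * y ^+ 8 * (u^-1 - u'^-1) <= X' ^+ 4 * (u^-1 - u'^-1).
  by apply: ler_wpM2r.
have h12 : X' ^+ 4 / u <= X ^+ 4 / u - w * (d - Q - gam ^+ 2 / 4) + K1 * y ^+ 7 * (rho2 / u).
  have -> : X ^+ 4 / u - w * (d - Q - gam ^+ 2 / 4) + K1 * y ^+ 7 * (rho2 / u) =
    (X ^+ 4 - (4 * al * X ^+ 3 / t) * (d - Q - gam ^+ 2 / 4) + K1 * y ^+ 7 * rho2) / u.
    by rewrite /w; field; rewrite !gt_eqF.
  by rewrite ler_pM2r ?invr_gt0.
by move: h9 h10 h11 h12; rewrite -!/w; move: (y ^+ 7) (y ^+ 8) => y7 y8; lra.
Qed.

(** The threshold M is chosen so that neither side is positive unless the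
   gradient is bounded below (chi = 1); there the noise terms q^2 / u^2 are
   summable in expectation. *)
Lemma excess_sqr_step (al L c M : R) : 0 < al -> 0 < L -> 1 <= c -> 0 <= M ->
  exists2 K : R, 0 <= K & forall u u' q d gam X X' chi : R,
    one_step al L c u u' q d gam X X' ->
    (chi = 0 \/ chi = 1) -> (M <= c * X -> chi = 1) ->
    Num.max (X' - M) 0 ^+ 2 <= Num.max (X - M) 0 ^+ 2 -
      2 * al * (Num.max (X - M) 0 * chi / u) * d + K * (X ^+ 2 * chi * (q ^+ 2 / u ^+ 2)).
Proof.
move=> al0 L0 c1 M0.
pose C1 := 8 * L * al ^+ 2 + 2 * L ^+ 2 * al ^+ 4.
pose K := 2 * al * (2 * L + 1) + 2 * L * al ^+ 2 + C1.
have C10 : 0 <= C1 by rewrite /C1; nneg.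
exists K => [|u u' q d gam X X' chi os chi01 Mchi]; first by rewrite /K; nneg.
have Dsq := one_step_increment_sqr _ _ _ _ _ _ _ _ _ _ al0 L0 os.
case: os => u0 u'0 q0 g0 e X1 X'1 gX dq XX' X'X T.
have X0 : 0 < X by exact: lt_le_trans X1.
have c0 : 0 < c by exact: lt_le_trans c1.
have [cXM|McX] := ltP (c * X) M.
  have X'M : X' - M <= 0 by lra.
  have XM : X - M <= 0 by have : X <= c * X by [rewrite ler_peMl// ltW]; lra.
  rewrite !max_r// expr0n/= !mul0r mulr0 mul0r subr0 add0r.
  by case: chi01 => ->; rewrite ?mulr0 ?mul0r ?mulr0// mulr1; rewrite /K; nneg.
rewrite Mchi//= !mulr1; set m := Num.max (X - M) 0.
have m0 : 0 <= m by rewrite le_max lexx orbT.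
have mX : m <= X by rewrite ge_max; lra.
set N := q ^+ 2 / u ^+ 2.
have N0 : 0 <= N by rewrite /N; nneg.
have rN : (q / u') ^+ 2 <= N by exact: ratio_sqr_le.
have h1 : Num.max (X' - M) 0 ^+ 2 <= m ^+ 2 + 2 * m * (X' - X) + (X' - X) ^+ 2.
  rewrite /m; have [a|a] := leP (X' - M) 0; have [b|b] := leP (X - M) 0.
  - by rewrite expr0n/=; have := sqr_ge0 (X' - X); lra.
  - rewrite expr0n/=; have := sqr_ge0 (X - M + (X' - X)); nra.
  - nra.
  - have -> : X' - M = X - M + (X' - X) by ring.
    nra.
have h2 : - (d / u') <= - (d / u) + gam * N.
  have /andP[l1 l2] := decay_mul_le _ _ _ u0 u'0 q0 e.
  have : (u^-1 - u'^-1) * d <= gam * N.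
    apply: (@le_trans _ _ ((u^-1 - u'^-1) * (gam * q))).
      apply: ler_wpM2l; last exact: le_trans (ler_norm _) dq.
      rewrite subr_ge0 lef_pV2 ?posrE//; apply: le_of_sqr; first exact: ltW.
      by rewrite e lerDl sqr_ge0.
    by rewrite mulrCA ler_wpM2l.
  by rewrite mulrBl; lra.
have gam1 : gam <= (2 * L + 1) * X by have := sqr_ge0 (gam - 1); nra.
have h3 : 2 * m * (X' - X) <= - (2 * al * (m / u) * d) + (2 * al * (2 * L + 1) + 2 * L * al ^+ 2) * (X ^+ 2 * N).
  have a1 : X' - X <= - (al * (d / u)) + (al * gam + L * al ^+ 2) * N.
    have : al * - (d / u') <= al * (- (d / u) + gam * N) by rewrite ler_pM2l.
    have : L * al ^+ 2 * (q / u') ^+ 2 <= L * al ^+ 2 * N by apply: ler_wpM2l => //; nneg.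
    by move: T; rewrite ler_norml => /andP[_]; lra.
  have a2 : 2 * m * (X' - X) <= 2 * m * (- (al * (d / u)) + (al * gam + L * al ^+ 2) * N).
    by apply: ler_wpM2l => //; nneg.
  have a3 : m * gam <= (2 * L + 1) * X ^+ 2.
    have : m * gam <= X * ((2 * L + 1) * X) by apply: ler_pM.
    by lra.
  have a4 : m <= X ^+ 2 by nra.
  have a5 : 2 * al * N * (m * gam) <= 2 * al * N * ((2 * L + 1) * X ^+ 2).
    by apply: ler_wpM2l => //; nneg.
  have a6 : 2 * L * al ^+ 2 * N * m <= 2 * L * al ^+ 2 * N * X ^+ 2.
    by apply: ler_wpM2l => //; nneg.
  by lra.
have h4 : (X' - X) ^+ 2 <= C1 * (X ^+ 2 * N).
  apply: le_trans Dsq _; rewrite -/C1 -mulrA; apply: ler_wpM2l => //.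
  apply: ler_pM => //; [exact: ltW|exact: sqr_ge0|].
  by rewrite expr2 ler_peMl// ltW.
by rewrite /K; lra.
Qed.

End OneStep.

Arguments os_u {R al L c u u' q d gam X X'} _.
Arguments os_u' {R al L c u u' q d gam X X'} _.
Arguments os_q {R al L c u u' q d gam X X'} _.
Arguments os_gam {R al L c u u' q d gam X X'} _.
Arguments os_uu' {R al L c u u' q d gam X X'} _.
Arguments os_X {R al L c u u' q d gam X X'} _.
Arguments os_X' {R al L c u u' q d gam X X'} _.
Arguments os_gamX {R al L c u u' q d gam X X'} _.
Arguments os_d {R al L c u u' q d gam X X'} _.
Arguments os_XX' {R al L c u u' q d gam X X'} _.
Arguments os_X'X {R al L c u u' q d gam X X'} _.
Arguments os_taylor {R al L c u u' q d gam X X'} _.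

(** * Lyapunov estimates along a run *)

Set Implicit Arguments.
Unset Strict Implicit.
Unset Printing Implicit Defensive.

Section BoundedMeasurable.
Context {R : realType} {dO : measure_display} {Omega : measurableType dO}.
Implicit Types (H : set (set Omega)) (f h : Omega -> R).

Definition bmeas H f : Prop := Hmeas H f /\ exists C : R, forall w, `|f w| <= C.

Lemma bmeas_cst H (c : R) : bmeas H (fun=> c).
Proof. by split; [exact: Hmeas_cst|exists `|c|]. Qed.

Lemma bmeasD H f h : bmeas H f -> bmeas H h -> bmeas H (fun w => f w + h w).
Proof.
move=> [mf [C fC]] [mh [D hD]]; split; first exact: HmeasD.
by exists (C + D) => w; apply: le_trans (ler_normD _ _) _; exact: lerD.
Qed.

Lemma bmeasM H f h : bmeas H f -> bmeas H h -> bmeas H (fun w => f w * h w).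
Proof.
move=> [mf [C fC]] [mh [D hD]]; split; first exact: HmeasM.
by exists (C * D) => w; rewrite normrM; apply: ler_pM.
Qed.

Lemma bmeasB H f h : bmeas H f -> bmeas H h -> bmeas H (fun w => f w - h w).
Proof.
move=> [mf [C fC]] [mh [D hD]]; split; first exact: HmeasB.
by exists (C + D) => w; apply: le_trans (ler_normB _ _) _; exact: lerD.
Qed.

Lemma bmeasX H f n : bmeas H f -> bmeas H (fun w => f w ^+ n).
Proof.
move=> [mf [C fC]]; split; first exact: HmeasX.
by exists (C ^+ n) => w; rewrite normrX; apply: lerXn2r; rewrite ?nnegrE// (le_trans _ (fC w)).
Qed.

Lemma bmeas_max H f h : bmeas H f -> bmeas H h -> bmeas H (fun w => Num.max (f w) (h w)).
Proof.
move=> [mf [C fC]] [mh [D hD]]; split; first exact: Hmeas_max.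
exists (C + D) => w; have := fC w; have := hD w; have := normr_ge0 (f w).
by have := normr_ge0 (h w); case: (leP (f w) (h w)); lra.
Qed.

Lemma bmeas_ind_ge H c f : Hmeas H f -> bmeas H (fun w => ind_ge c (f w)).
Proof.
move=> mf; split; first exact: Hmeas_ind_ge.
by exists 1 => w; have /andP[? ?] := ind_ge01 c (f w); rewrite ger0_norm.
Qed.

Lemma bmeasV H f (s : R) : 0 < s -> (forall w, s <= f w) -> Hmeas H f ->
  bmeas H (fun w => (f w)^-1).
Proof.
move=> s0 sf mf; have f0 w : 0 < f w by exact: lt_le_trans (sf w).
split; first exact: HmeasV.
exists s^-1 => w; rewrite gtr0_norm ?invr_gt0//.
by rewrite lef_pV2 ?posrE.
Qed.

Lemma bmeas_sqrtV H f (s : R) : 0 < s -> (forall w, s <= f w) -> Hmeas H f ->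
  bmeas H (fun w => (Num.sqrt (f w))^-1).
Proof.
move=> s0 sf mf; apply: (@bmeasV _ _ (Num.sqrt s)); first by rewrite sqrtr_gt0.
  by move=> w; rewrite ler_wsqrtr.
exact: Hmeas_sqrt.
Qed.

Context (P : probability Omega R).

Lemma bmeas_integ H f : sub_sigma H -> bmeas H f -> integ P f.
Proof.
by move=> sH [mf [C fC]]; apply: (integ_bounded _ C) => //; exact: Hmeas_measurable mf.
Qed.

Lemma bmeas_integM H f h : sub_sigma H -> bmeas H f -> integ P h ->
  integ P (fun w => f w * h w).
Proof.
by move=> sH [mf [C fC]] ih; apply: (integM _ C) => //; exact: Hmeas_measurable mf.
Qed.

End BoundedMeasurable.

Section Run.
Context {R : realType} {dO : measure_display} {Omega : measurableType dO}.
Implicit Types (F : nat -> set (set Omega)) (X q d gam S : nat -> Omega -> R).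

(** The scalar data of a run: S is the accumulator, X is 1 plus the objective,
   and q, gam, d are the norms and the inner product of the stochastic and the
   true gradient.  All conditional assumptions are stated through bounded
   weights known before the step. *)
Record scalar_run (P : probability Omega R) F X q d gam S
    (al L c beta sig S0 : R) : Prop := ScalarRun {
  sr_al : 0 < al; sr_L : 0 < L; sr_c : 1 <= c; sr_beta : 0 <= beta;
  sr_sig : 0 <= sig; sr_S0 : 0 < S0;
  sr_F : forall n, sub_sigma (F n);
  sr_FS : forall n, F n `<=` F n.+1;
  sr_mX : forall n, bmeas (F n) (X n);
  sr_mgam : forall n, bmeas (F n) (gam n);
  sr_mS : forall n, Hmeas (F n) (S n);
  sr_mq : forall n, Hmeas (F n.+1) (q n);
  sr_md : forall n, Hmeas (F n.+1) (d n);
  sr_Sinit : forall w, S 0%N w = S0;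
  sr_Sstep : forall n w, S n.+1 w = S n w + q n w ^+ 2;
  sr_step : forall n w, one_step al L c (Num.sqrt (S n w)) (Num.sqrt (S n.+1 w))
     (q n w) (d n w) (gam n w) (X n w) (X n.+1 w);
  sr_iq : forall n, integ P (fun w => q n w ^+ 2);
  sr_id : forall n, integ P (d n);
  sr_Ed : forall n h, bmeas (F n) h ->
     Ex P (fun w => h w * d n w) = Ex P (fun w => h w * gam n w ^+ 2);
  sr_Eq : forall n h, bmeas (F n) h -> (forall w, 0 <= h w) ->
     Ex P (fun w => h w * q n w ^+ 2) <=
     Ex P (fun w => h w * (beta * gam n w ^+ 2 + sig)) }.

#[global] Arguments sr_mS {P F X q d gam S al L c beta sig S0} _ n.
#[global] Arguments sr_mq {P F X q d gam S al L c beta sig S0} _ n.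
#[global] Arguments sr_md {P F X q d gam S al L c beta sig S0} _ n.
#[global] Arguments sr_FS {P F X q d gam S al L c beta sig S0} _ n.

Context (P : probability Omega R).

Context (F : nat -> set (set Omega)) (X q d gam S : nat -> Omega -> R)
  (al L c beta sig S0 : R).

Local Notation run := (scalar_run P F X q d gam S al L c beta sig S0).

Lemma run_S_ge : run -> forall n w, S0 <= S n w.
Proof.
move=> r; elim=> [|n IH] w; first by rewrite (sr_Sinit r).
by rewrite (sr_Sstep r) (le_trans (IH w))// lerDl sqr_ge0.
Qed.

Lemma run_S_gt0 : run -> forall n w, 0 < S n w.
Proof. by move=> r n w; exact: lt_le_trans (sr_S0 r) (run_S_ge r n w). Qed.

Lemma run_bmeas_SV : run -> forall n, bmeas (F n) (fun w => (S n w)^-1).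
Proof. by move=> r n; exact: (bmeasV (sr_S0 r) (run_S_ge r n) (sr_mS r n)). Qed.

Lemma run_bmeas_sqrtSV : run -> forall n, bmeas (F n) (fun w => (Num.sqrt (S n w))^-1).
Proof. by move=> r n; exact: (bmeas_sqrtV (sr_S0 r) (run_S_ge r n) (sr_mS r n)). Qed.

(** The Lyapunov function is X^4 / sqrt S.  Its drift is minus W * gam^2 / 2,
   with the weight W = 4 al X^3 / (sqrt S * sqrt (S + X)), up to K times the
   decrease of 1 / sqrt S; and X^2 / S is at most a constant times W. *)
Lemma summable_grad_energy : run -> exists2 C : R, 0 <= C &
  forall N, \sum_(n < N) Ex P (fun w => X n w ^+ 2 * gam n w ^+ 2 / S n w) <= C.
Proof.
move=> r.
have al0 := sr_al r; have L0 := sr_L r; have be0 := sr_beta r; have si0 := sr_sig r.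
pose V := 4 * L * beta + sig + 1.
have V0 : 0 <= V by rewrite /V; nneg.
have [K K0 step] := quartic_over_sqrt_step al L c V al0 L0 (sr_c r) V0.
pose v n w := beta * gam n w ^+ 2 + sig + 1.
have v1 n w : 1 <= v n w by rewrite /v lerDr; nneg.
have v0 n w : 0 < v n w by exact: lt_le_trans (v1 n w).
pose t n w := Num.sqrt (S n w + X n w).
have S_0 := run_S_gt0 r.
have X1 n w : 1 <= X n w by exact: os_X (sr_step r n w).
have X0 n w : 0 <= X n w by exact: le_trans (X1 n w).
have SX0 n w : S0 <= S n w + X n w by rewrite (le_trans (run_S_ge r n w))// lerDl.
have t0 n w : 0 < t n w by rewrite sqrtr_gt0 (lt_le_trans (sr_S0 r)).
have u0 n w : 0 < Num.sqrt (S n w) by rewrite sqrtr_gt0.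
have btV n : bmeas (F n) (fun w => (t n w)^-1).
  apply: bmeas_sqrtV (sr_S0 r) (SX0 n) _.
  by apply: HmeasD; [exact: sr_mS r n|exact: (sr_mX r n).1].
have bgam2 n : bmeas (F n) (fun w => gam n w ^+ 2) by apply: bmeasX; exact: sr_mgam r n.
have bvV n : bmeas (F n) (fun w => (v n w)^-1).
  apply: (bmeasV ltr01 (v1 n)); apply: (bmeasD _ (bmeas_cst _ _)).1.
  by apply: bmeasD (bmeas_cst _ _); apply: bmeasM (bmeas_cst _ _) _.
pose W n w := 4 * al * X n w ^+ 3 * ((Num.sqrt (S n w))^-1 * (t n w)^-1).
have bW n : bmeas (F n) (W n).
  apply: bmeasM; last by apply: bmeasM => //; exact: run_bmeas_sqrtSV.
  by apply: bmeasM; [exact: bmeas_cst|apply: bmeasX; exact: sr_mX r n].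
have W0 n w : 0 <= W n w.
  by rewrite /W; have ? := ltW (u0 n w); have ? := ltW (t0 n w); have ? := X0 n w; nneg.
pose A n w := X n w ^+ 4 / Num.sqrt (S n w).
have bA n : bmeas (F n) (A n).
  by apply: bmeasM; [apply: bmeasX; exact: sr_mX r n|exact: run_bmeas_sqrtSV].
have A0 n w : 0 <= A n w by rewrite /A; have ? := ltW (u0 n w); have ? := X0 n w; nneg.
have iA n : integ P (A n) by exact: bmeas_integ (sr_F r n) (bA n).
have iu n : integ P (fun w => (Num.sqrt (S n w))^-1).
  exact: bmeas_integ (sr_F r n) (run_bmeas_sqrtSV r n).
have iWg n : integ P (fun w => W n w * gam n w ^+ 2).
  by apply: bmeas_integ (sr_F r n) _; exact: bmeasM.
pose Z n w := W n w * gam n w ^+ 2 / (4 * v n w).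
have bZ n : bmeas (F n) (Z n).
  have -> : Z n = (fun w => W n w * gam n w ^+ 2 * (4^-1 * (v n w)^-1)).
    by apply/funext => w; rewrite /Z invfM.
  by apply: bmeasM; [exact: bmeasM|exact: bmeasM (bmeas_cst _ _) _].
have Z0 n w : 0 <= Z n w.
  by rewrite /Z; have ? := W0 n w; have ? := ltW (v0 n w); nneg.
have key n : Ex P (A n.+1) + 2^-1 * Ex P (fun w => W n w * gam n w ^+ 2) <=
    Ex P (A n) + K * (Ex P (fun w => (Num.sqrt (S n w))^-1) -
                      Ex P (fun w => (Num.sqrt (S n.+1 w))^-1)).
  have iWd : integ P (fun w => W n w * d n w) by exact: bmeas_integM (sr_F r n) _ (sr_id r n).
  have iZq : integ P (fun w => Z n w * q n w ^+ 2) by exact: bmeas_integM (sr_F r n) _ (sr_iq r n).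
  have h1 : Ex P (A n.+1) <= Ex P (fun w => (A n w - W n w * d n w + Z n w * q n w ^+ 2 +
       4^-1 * (W n w * gam n w ^+ 2)) + K * ((Num.sqrt (S n w))^-1 - (Num.sqrt (S n.+1 w))^-1)).
    apply: Ex_le => // [|w].
      apply: integD; last by apply: integZ; exact: integB.
      by apply: integD; [apply: integD => //; exact: integB|exact: integZ].
    have := step _ _ _ _ _ _ _ (t n w) (v n w) (sr_step r n w) (t0 n w) _ (v0 n w) _.
    rewrite /A => h; apply: le_trans (h _ _) _.
    - by rewrite !sqr_sqrtr// ?ltW// (lt_le_trans (sr_S0 r)).
    - have := os_gamX (sr_step r n w); have := X1 n w; rewrite /v /V => x1 gx.
      have : beta * gam n w ^+ 2 <= beta * (4 * L * X n w) by apply: ler_wpM2l.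
      by have : sig <= sig * X n w by [rewrite ler_peMr]; lra.
    - rewrite le_eqVlt; apply/orP; left; apply/eqP; rewrite /Z /W.
      by field; rewrite !gt_eqF.
  rewrite ExD in h1; last 2 first.
  - by apply: integD; [apply: integD => //; exact: integB|exact: integZ].
  - by apply: integZ; exact: integB.
  rewrite ExZ ?ExB// in h1; last exact: integB.
  rewrite ExD in h1; last 2 first.
  - by apply: integD => //; exact: integB.
  - exact: integZ.
  rewrite ExZ// ExD// in h1; last exact: integB.
  rewrite ExB// (sr_Ed r) // in h1.
  have h2 : Ex P (fun w => Z n w * q n w ^+ 2) <= 4^-1 * Ex P (fun w => W n w * gam n w ^+ 2).
    apply: le_trans (sr_Eq r (bZ n) (Z0 n)) _.
    rewrite -ExZ//; apply: Ex_le => [||w].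
    - apply: bmeas_integ (sr_F r n) _; apply: bmeasM => //.
      by apply: bmeasD (bmeas_cst _ _); apply: bmeasM (bmeas_cst _ _) _.
    - exact: integZ.
    - apply: (@le_trans _ _ (Z n w * v n w)).
        by apply: ler_wpM2l => //; rewrite /v lerDl.
      rewrite le_eqVlt; apply/orP; left; apply/eqP; rewrite /Z.
      by field; rewrite gt_eqF.
  clear -h1 h2; lra.
have sumW N : 2^-1 * \sum_(n < N) Ex P (fun w => W n w * gam n w ^+ 2) + Ex P (A N) <=
    Ex P (A 0%N) + K * (Ex P (fun w => (Num.sqrt (S 0%N w))^-1) -
                      Ex P (fun w => (Num.sqrt (S N w))^-1)).
  elim: N => [|N IH]; first by rewrite big_ord0; lra.
  by rewrite big_ord_recr/=; have := key N; lra.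
pose C := 2 * (Ex P (A 0%N) + K * Ex P (fun w => (Num.sqrt (S 0%N w))^-1)).
pose k := (1 + S0^-1) / (4 * al).
have k0 : 0 <= k by have := sr_S0 r; rewrite /k => ?; nneg.
have uV0 n w : 0 <= (Num.sqrt (S n w))^-1 by rewrite invr_ge0 ltW.
have C0 : 0 <= C by rewrite /C mulr_ge0// addr_ge0 ?mulr_ge0 ?Ex_ge0.
exists (k * C) => [|N]; first exact: mulr_ge0.
have bnd n : Ex P (fun w => X n w ^+ 2 * gam n w ^+ 2 / S n w) <=
    k * Ex P (fun w => W n w * gam n w ^+ 2).
  rewrite -ExZ//; apply: Ex_le => [||w].
  - apply: bmeas_integ (sr_F r n) _; apply: bmeasM; last exact: run_bmeas_SV.
    by apply: bmeasM => //; apply: bmeasX; exact: sr_mX r n.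
  - exact: integZ.
  have x1 := X1 n w; have x0 := X0 n w; have s0 := S_0 n w.
  have ut : Num.sqrt (S n w) * t n w <= S n w * X n w * (1 + S0^-1).
    apply: le_of_sqr; first by have ? := ltW s0; have ? := ltW (sr_S0 r); nneg.
    rewrite exprMn !sqr_sqrtr ?(ltW s0) ?addr_ge0 ?(ltW s0)//.
    have hX : X n w <= S n w * X n w / S0.
      by rewrite ler_pdivlMr ?(sr_S0 r)// mulrC ler_wpM2r// run_S_ge.
    have hSX : S n w <= S n w * X n w by rewrite ler_peMr// ltW.
    have h1 : S n w + X n w <= S n w * X n w * (1 + S0^-1) by lra.
    have b1 : 1 <= 1 + S0^-1 by rewrite lerDl invr_ge0 ltW// (sr_S0 r).
    rewrite exprMn expr2.
    have a1 : S n w <= S n w * X n w * (1 + S0^-1).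
      by apply: le_trans hSX _; rewrite ler_peMr// mulr_ge0// ltW.
    rewrite -expr2 -exprMn expr2; apply: ler_pM => //; [exact: ltW|].
    by rewrite addr_ge0// ltW.
  rewrite mulrAC [leRHS]mulrA; apply: ler_wpM2r; first exact: sqr_ge0.
  rewrite /W.
  rewrite -invfM.
  have -> : k * (4 * al * X n w ^+ 3 * (Num.sqrt (S n w) * t n w)^-1) =
     (1 + S0^-1) * X n w ^+ 3 / (Num.sqrt (S n w) * t n w).
    by rewrite /k; field; rewrite !gt_eqF ?(sr_S0 r).
  rewrite ler_pdivlMr ?mulr_gt0// mulrAC ler_pdivrMr//.
  have -> : (1 + S0^-1) * X n w ^+ 3 * S n w = X n w ^+ 2 * (S n w * X n w * (1 + S0^-1)) by ring.
  by apply: ler_wpM2l => //; exact: sqr_ge0.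
apply: (@le_trans _ _ (\sum_(n < N) k * Ex P (fun w => W n w * gam n w ^+ 2))).
  by apply: ler_sum => n _; exact: bnd.
rewrite -mulr_sumr ler_wpM2l// /C.
have := sumW N; have : 0 <= Ex P (A N) by exact: Ex_ge0.
have : 0 <= K * Ex P (fun w => (Num.sqrt (S N w))^-1) by apply: mulr_ge0 => //; exact: Ex_ge0.
by lra.
Qed.

End Run.

Section RunConsequences.
Context {R : realType} {dO : measure_display} {Omega : measurableType dO}.
Context (P : probability Omega R).
Context (F : nat -> set (set Omega)) (X q d gam S : nat -> Omega -> R)
  (al L c beta sig S0 : R).

Local Notation run := (scalar_run P F X q d gam S al L c beta sig S0).

Lemma run_bmeas_noise_weight (de : R) : run -> forall n,
  bmeas (F n) (fun w => X n w ^+ 2 * ind_ge de (gam n w) / S n w).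
Proof.
move=> r n; apply: bmeasM; last exact: run_bmeas_SV r n.
apply: bmeasM; first by apply: bmeasX; exact: sr_mX r n.
by apply: bmeas_ind_ge; exact: (sr_mgam r n).1.
Qed.

Lemma run_integ_noise (de : R) : run -> forall n,
  integ P (fun w => X n w ^+ 2 * ind_ge de (gam n w) * (q n w ^+ 2 / S n w)).
Proof.
move=> r n; have := bmeas_integM (sr_F r n) (run_bmeas_noise_weight de r n) (sr_iq r n).
by apply: eq_integrable => // w _ /=; congr (_%:E); ring.
Qed.

(** Where the gradient exceeds de, the conditional second moment of the
   stochastic gradient is at most a constant times gam^2. *)
Lemma summable_noise_energy (de : R) : 0 < de -> run -> exists2 C : R, 0 <= C &
  forall N, \sum_(n < N) Ex P (fun w =>
     X n w ^+ 2 * ind_ge de (gam n w) * (q n w ^+ 2 / S n w)) <= C.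
Proof.
move=> de0 r; have [C C0 hC] := summable_grad_energy r.
have be0 := sr_beta r; have si0 := sr_sig r.
pose k := beta + sig / de ^+ 2.
have k0 : 0 <= k by rewrite /k; nneg.
exists (k * C) => [|N]; first exact: mulr_ge0.
apply: (@le_trans _ _ (\sum_(n < N) k * Ex P (fun w => X n w ^+ 2 * gam n w ^+ 2 / S n w))); last first.
  by rewrite -mulr_sumr ler_wpM2l.
apply: ler_sum => n _.
pose h w := X n w ^+ 2 * ind_ge de (gam n w) / S n w.
have bh : bmeas (F n) h := run_bmeas_noise_weight de r n.
have bg2 : bmeas (F n) (fun w => gam n w ^+ 2) by apply: bmeasX; exact: sr_mgam r n.
have h0 w : 0 <= h w.
  have ? := ltW (run_S_gt0 r n w); have /andP[? _] := ind_ge01 de (gam n w).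
  by rewrite /h; nneg.
have iE : integ P (fun w => X n w ^+ 2 * gam n w ^+ 2 / S n w).
  apply: bmeas_integ (sr_F r n) _; apply: bmeasM; last exact: run_bmeas_SV r n.
  by apply: bmeasM => //; apply: bmeasX; exact: sr_mX r n.
have -> : (fun w => X n w ^+ 2 * ind_ge de (gam n w) * (q n w ^+ 2 / S n w)) =
    (fun w => h w * q n w ^+ 2) by apply/funext => w; rewrite /h; ring.
apply: le_trans (sr_Eq r bh h0) _; rewrite -ExZ//; apply: Ex_le => [||w].
- apply: bmeas_integ (sr_F r n) _; apply: bmeasM => //.
  by apply: bmeasD (bmeas_cst _ _); apply: bmeasM (bmeas_cst _ _) _.
- exact: integZ.
have iS : 0 <= (S n w)^-1 by rewrite invr_ge0 ltW// (run_S_gt0 r).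
rewrite /h /ind_ge; case: ifPn => [dg|_]; last by rewrite mulr0 !mul0r; nneg.
rewrite mulr1.
have -> : k * (X n w ^+ 2 * gam n w ^+ 2 / S n w) = (X n w ^+ 2 / S n w) * (k * gam n w ^+ 2) by ring.
apply: ler_wpM2l; first by nneg.
rewrite /k mulrDl lerD2l mulrAC ler_pdivlMr ?exprn_gt0//.
by apply: ler_wpM2l => //; apply: lerXn2r; rewrite ?nnegrE ?(ltW de0)// (le_trans (ltW de0)).
Qed.

Lemma run_X_ge1 : run -> forall n w, 1 <= X n w.
Proof. by move=> r n w; exact: os_X (sr_step r n w). Qed.

(** The Lyapunov function is the squared excess of X over a level M below which
   the gradient may vanish. *)
Lemma integral_sup_X (M0 e : R) : 0 < e -> run ->
  (forall n w, M0 <= X n w -> e <= gam n w) ->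
  exists C : R, (\int[P]_w ereal_sup (range (fun n => (X n w)%:E)) <= C%:E)%E.
Proof.
move=> e0 r hM0; have X1 := run_X_ge1 r.
have c1 := sr_c r; have c0 : 0 < c by exact: lt_le_trans c1.
pose M := c * `|M0|.
have M_0 : 0 <= M by rewrite mulr_ge0// ltW.
have [K K0 step] := excess_sqr_step al L c M (sr_al r) (sr_L r) c1 M_0.
have [C C0 hC] := summable_noise_energy e0 r.
pose m n w := Num.max (X n w - M) 0.
have m0 n w : 0 <= m n w by rewrite le_max lexx orbT.
pose chi n w := ind_ge e (gam n w).
pose B n w := m n w ^+ 2.
pose N_ n w := X n w ^+ 2 * chi n w * (q n w ^+ 2 / S n w).
have iN n : integ P (N_ n) by exact: run_integ_noise.
have N0 n w : 0 <= N_ n w.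
  have ? := ltW (run_S_gt0 r n w); have /andP[? _] := ind_ge01 e (gam n w).
  by rewrite /N_ /chi; nneg.
have bm n : bmeas (F n) (m n).
  by apply: bmeas_max (bmeas_cst _ _); apply: bmeasB (bmeas_cst _ _); exact: sr_mX r n.
have bB n : bmeas (F n) (B n) by exact: bmeasX.
have iB n : integ P (B n) by exact: bmeas_integ (sr_F r n) (bB n).
have chi01 n w : chi n w = 0 \/ chi n w = 1 by rewrite /chi /ind_ge; case: ifP; [right|left].
have Mchi n w : M <= c * X n w -> chi n w = 1.
  rewrite /M ler_pM2l// => MX; rewrite /chi /ind_ge hM0//.
  exact: le_trans (ler_norm _) MX.
have bG n : bmeas (F n) (fun w => m n w * chi n w / Num.sqrt (S n w)).
  apply: bmeasM; last exact: run_bmeas_sqrtSV r n.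
  by apply: bmeasM => //; apply: bmeas_ind_ge; exact: (sr_mgam r n).1.
have B0 n w : 0 <= B n w by exact: sqr_ge0.
have drift n (k : Omega -> R) : bmeas (F n) k -> (forall w, 0 <= k w) ->
   Ex P (fun w => k w * (B n.+1 w - B n w)) <= Ex P (fun w => k w * (K * N_ n w)).
  move=> bk k0.
  have ikN : integ P (fun w => k w * (K * N_ n w)).
    by apply: bmeas_integM (sr_F r n) bk _; exact: integZ.
  pose h w := k w * (m n w * chi n w / Num.sqrt (S n w)).
  have bh : bmeas (F n) h by exact: bmeasM.
  have h0 w : 0 <= h w.
    have /andP[? _] := ind_ge01 e (gam n w); have ? := sqrtr_ge0 (S n w).
    by rewrite /h /chi; nneg.
  have ihd : integ P (fun w => h w * d n w) by exact: bmeas_integM (sr_F r n) bh (sr_id r n).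
  apply: (@le_trans _ _ (Ex P (fun w => k w * (K * N_ n w) - 2 * al * (h w * d n w)))).
    apply: Ex_le => [||w].
    - by apply: bmeas_integM (sr_F r n) bk _; exact: integB.
    - by apply: integB => //; exact: integZ.
    - have := step _ _ _ _ _ _ _ (chi n w) (sr_step r n w) (chi01 n w) (Mchi n w).
      rewrite -/(m n w) -/(m n.+1 w) -/(B n w) -/(B n.+1 w) sqr_sqrtr ?(ltW (run_S_gt0 r n w))//.
      rewrite -/(N_ n w) => h1.
      have : k w * (B n.+1 w - B n w) <= k w * (- (2 * al * (m n w * chi n w / Num.sqrt (S n w)) * d n w) + K * N_ n w).
        by apply: ler_wpM2l => //; lra.
      by rewrite /h; lra.
  rewrite ExB//; last exact: integZ.
  rewrite ExZ// (sr_Ed r bh) gerBl mulr_ge0//; first by rewrite mulr_ge0// ltW// (sr_al r).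
  by apply: Ex_ge0 => w; have ? := h0 w; nneg.
have := @Ex_sqrt_runmax R dO Omega P F B (fun n w => K * N_ n w) 1 ltr01 (sr_F r) (sr_FS r)
   (fun n => (bB n).1) B0 _ iB _ _.
move=> H; have {H}H : forall N, integ P (fun w => Num.sqrt (runmax 1 (fun k => B k w) N)) /\
  Ex P (fun w => Num.sqrt (runmax 1 (fun k => B k w) N)) <= 1 + (Ex P (B 0%N) + K * C).
  move=> N; have [|||iR hR] := H _ _ _ N.
  - by move=> n w; exact: mulr_ge0.
  - by move=> n; exact: integZ.
  - move=> n k mk k1 _; apply: drift => [|w]; last by have /andP[] := k1 w.
    split=> //; exists (Num.sqrt 1)^-1 => w; have /andP[? ?] := k1 w.
    by rewrite ger0_norm.
  split=> //; apply: le_trans hR _; rewrite sqrtr1 invr1 mul1r lerD2l lerD2l.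
  apply: (@le_trans _ _ (\sum_(n < N) K * Ex P (N_ n))).
    by apply: ler_sum => n _; rewrite ExZ.
  by rewrite -mulr_sumr ler_wpM2l.
exists (M + (1 + (Ex P (B 0%N) + K * C))).
apply: integral_sup_runmax.
- by move=> n w; exact: le_trans (X1 n w).
- by move=> n; exact: bmeas_integ (sr_F r n) (sr_mX r n).
move=> N; have [iR hR] := H N.
apply: (@le_trans _ _ (Ex P (fun w => M + Num.sqrt (runmax 1 (fun k => B k w) N)))).
  apply: Ex_le => [||w].
  - apply: integ_runmax; first by move=> n w; exact: le_trans (X1 n w).
    by move=> n; exact: bmeas_integ (sr_F r n) (sr_mX r n).
  - by apply: integD => //; exact: integ_cst.
  - apply: runmax_le => [|k kN]; first by rewrite addr_ge0// sqrtr_ge0.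
    have : m k w <= Num.sqrt (runmax 1 (fun k => B k w) N).
      rewrite -[leLHS]ger0_norm// -sqrtr_sqr ler_wsqrtr//.
      exact: (@runmax_ge _ 1 (fun k => B k w)).
    have : X k w - M <= m k w by rewrite le_max lexx.
    by lra.
rewrite ExD ?Ex_cst//; last exact: integ_cst.
by rewrite lerD2l.
Qed.

End RunConsequences.

(** * Martingale convergence *)

Section CauchySeries.
Context {R : realType}.
Implicit Types (x y : nat -> R).

Definition cauchy_series x : Prop := forall e : R, 0 < e ->
  exists N, forall a b, (N <= a)%N -> (a <= b)%N -> `|\sum_(a <= i < b) x i| <= e.

Lemma sum_ord_nat x b : \sum_(i < b) x i = \sum_(0 <= i < b) x i.
Proof. by rewrite big_mkord. Qed.

Lemma bounded_cauchy_series x (C : R) : (forall n, 0 <= x n) ->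
  (forall N, \sum_(n < N) x n <= C) -> cauchy_series x.
Proof.
move=> x0 xC e e0.
pose A := range (fun N : nat => \sum_(n < N) x n).
have supA : has_sup A.
  by split; [exists (\sum_(n < 0) x n), 0%N|exists C => _ [N _ <-]].
have [_ [N _ <-] hN] := sup_adherent e0 supA.
exists N => a b Na ab; rewrite ger0_norm ?sumr_ge0//.
have hb : \sum_(n < b) x n <= sup A by apply: sup_upper_bound => //; exists b.
have := hN; rewrite !sum_ord_nat (big_cat_nat (n := a)) //= in hb *.
move: hb; rewrite (big_cat_nat (n := N)) //=.
have : 0 <= \sum_(N <= i < a) x i by exact: sumr_ge0.
move: (\sum_(0 <= i < N) _) (\sum_(N <= i < a) _) (\sum_(a <= i < b) _) (sup A).
by move=> s1 s2 s3 s; lra.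
Qed.

Lemma cauchy_series_cvg0 x : cauchy_series x -> forall e : R, 0 < e ->
  exists N, forall n, (N <= n)%N -> `|x n| <= e.
Proof.
move=> cx e /cx[N h]; exists N => n Nn.
by have := h n n.+1 Nn (leqnSn n); rewrite big_nat1.
Qed.

End CauchySeries.

Section Martingale.
Context {R : realType} {dO : measure_display} {Omega : measurableType dO}
  (P : probability Omega R).

(** Square-integrable martingale convergence: the square of the martingale
   restarted at time m is a submartingale whose total drift is the tail of the
   series of variances, so the maximal inequality bounds the expected
   oscillation after time m by twice the square root of that tail. *)
Lemma ae_martingale_cauchy (F : nat -> set (set Omega)) (D : nat -> Omega -> R) (C : R) :
  (forall n, sub_sigma (F n)) -> (forall n, F n `<=` F n.+1) ->
  (forall n, Hmeas (F n.+1) (D n)) -> (forall n, integ P (fun w => D n w ^+ 2)) ->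
  (forall n h, bmeas (F n) h -> Ex P (fun w => h w * D n w) = 0) ->
  (forall N, \sum_(n < N) Ex P (fun w => D n w ^+ 2) <= C) ->
  {ae P, forall w, cauchy_series (fun n => D n w)}.
Proof.
move=> sF FS mD iD2 ED sumC.
have F_le m n : (m <= n)%N -> F m `<=` F n.
  move=> /subnK<-; elim: (n - m)%N => [|k IH]; first by rewrite add0n.
  by rewrite addSn; apply: subset_trans (FS _).
pose T m n w := \sum_(i < n) D (m + i)%N w.
have mT m n : Hmeas (F (m + n)%N) (T m n).
  apply: (Hmeas_sum _ n (fun i => D (m + i)%N)) => i ni.
  apply: (HmeasW (F (m + i).+1) _ _ _ _ _ (mD (m + i)%N)) => //.
  by apply: F_le; rewrite -addnS leq_add2l.
have mD' n : measurable_fun [set: Omega] (D n).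
  exact: (Hmeas_measurable _ _ (sF n.+1) (mD n)).
have iD n : integ P (D n).
  apply: (integ_le _ _ (fun w => 1 + D n w ^+ 2)) => // [w|].
    have := sqr_ge0 (`|D n w| - 1); rewrite sqrrB1 real_normK ?num_real//.
    by have := normr_ge0 (D n w); lra.
  by apply: integD => //; exact: integ_cst.
have mT' m n : measurable_fun [set: Omega] (T m n).
  exact: (Hmeas_measurable _ _ (sF _) (mT m n)).
have iT2 m n : integ P (fun w => T m n w ^+ 2).
  elim: n => [|n IH].
    have -> : (fun w => T m 0 w ^+ 2) = (fun=> 0).
      by apply/funext => w; rewrite /T big_ord0 expr0n.
    exact: integ_cst.
  apply: (integ_le _ _ (fun w => 2 * T m n w ^+ 2 + 2 * D (m + n)%N w ^+ 2)) => [|w|].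
  - exact: measurable_funX.
  - rewrite ger0_norm ?sqr_ge0// /T big_ord_recr/= -/(T m n w).
    by have := sqr_ge0 (T m n w - D (m + n)%N w); nra.
  - by apply: integD; exact: integZ.
pose U m w := ereal_sup (range (fun n => (`|T m n w|)%:E)).
have mU m : measurable_fun [set: Omega] (U m).
  apply: measurable_sup_range => n; apply: measurableT_comp => //.
have U0 m w : (0 <= U m w)%E by apply: sup_range_ge0.
have tail (t : R) : 0 < t -> exists m, (\int[P]_w U m w <= (2 * Num.sqrt t)%:E)%E.
  move=> t0.
  have [m hm] := @bounded_cauchy_series _ (fun n => Ex P (fun w => D n w ^+ 2)) C
      (fun n => Ex_ge0 _ _ (fun w => sqr_ge0 _)) sumC t t0.
  have {}hm N : \sum_(n < N) Ex P (fun w => D (m + n)%N w ^+ 2) <= t.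
    have := hm m (m + N)%N (leqnn _) (leq_addr _ _).
    rewrite -{1}[m]add0n big_addn addnC addnK big_mkord => h.
    apply: le_trans (ler_norm _) _; under eq_bigr do rewrite addnC; exact: h.
  exists m; apply: integral_sup_runmax => // [n|N].
    apply: (integ_le _ _ (fun w => 1 + T m n w ^+ 2)) => [|w|].
    - exact: measurableT_comp.
    - have := sqr_ge0 (`|T m n w| - 1); rewrite sqrrB1 real_normK ?num_real// normr_id.
      by have := normr_ge0 (T m n w); lra.
    - by apply: integD => //; exact: integ_cst.
  have [||||||||iR hR] := @Ex_sqrt_runmax R dO Omega P (fun n => F (m + n)%N)
     (fun n w => T m n w ^+ 2) (fun n w => D (m + n)%N w ^+ 2) t t0 _ _ _ _ _ _ _ _ N.
  - by move=> n.
  - by move=> n; rewrite addnS.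
  - by move=> n; apply: HmeasX.
  - by move=> n w; exact: sqr_ge0.
  - by move=> n w; exact: sqr_ge0.
  - by move=> n.
  - by move=> n.
  - move=> n k mk k1 kT.
    have bk : bmeas (F (m + n)%N) k.
      by split=> //; exists (Num.sqrt t)^-1 => w; have /andP[? ?] := k1 w; rewrite ger0_norm.
    have bkT : bmeas (F (m + n)%N) (fun w => k w * T m n w).
      split; first exact: HmeasM.
      exists 1 => w; rewrite -(@expr_le1 _ 2)// real_normK ?num_real// exprMn.
      exact: kT.
    have ikTD := bmeas_integM (sF _) bkT (iD (m + n)%N).
    have ikD2 := bmeas_integM (sF _) bk (iD2 (m + n)%N).
    have -> : (fun w => k w * (T m n.+1 w ^+ 2 - T m n w ^+ 2)) =
       (fun w => 2 * (k w * T m n w * D (m + n)%N w) + k w * D (m + n)%N w ^+ 2).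
      by apply/funext => w; rewrite /T big_ord_recr/=; ring.
    by rewrite ExD ?ExZ// ?ED// ?mulr0 ?add0r//; exact: integZ.
  apply: (@le_trans _ _ (Ex P (fun w => Num.sqrt (runmax t (fun n => T m n w ^+ 2) N)))).
    apply: Ex_le => // [|w].
      apply: integ_runmax => // n.
      apply: (integ_le _ _ (fun w => 1 + T m n w ^+ 2)) => [|w|].
      - exact: measurableT_comp.
      - have := sqr_ge0 (`|T m n w| - 1); rewrite sqrrB1 real_normK ?num_real// normr_id.
        by have := normr_ge0 (T m n w); lra.
      - by apply: integD => //; exact: integ_cst.
    apply: runmax_le => [|k kN]; first exact: sqrtr_ge0.
    rewrite -sqrtr_sqr ler_wsqrtr//.
    exact: (@runmax_ge _ t (fun n => T m n w ^+ 2)).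
  apply: le_trans hR _.
  have -> : Ex P (fun w => T m 0 w ^+ 2) = 0.
    by rewrite -[RHS](Ex_cst P); congr Ex; apply/funext => w; rewrite /T big_ord0 expr0n.
  rewrite add0r mulr_natl mulr2n lerD2l ler_pdivrMl ?sqrtr_gt0//.
  by rewrite -expr2 sqr_sqrtr ?hm// ltW.
pose J w := ereal_inf (range (fun m => U m w)).
have mJ : measurable_fun [set: Omega] J.
  have -> : J = (fun w => einfs (fun m => U m w) 0).
    apply/funext => w; rewrite /J /einfs /sdrop; congr ereal_inf.
    by apply/seteqP; split => x [n _ <-]; exists n.
  exact: measurable_fun_einfs.
have J0 w : (0 <= J w)%E by apply: le_ereal_inf_tmp => _ [m _ <-].
have JU m w : (J w <= U m w)%E by apply: ereal_inf_lbound; exists m.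
have EJ : (\int[P]_w `|J w| = 0)%E.
  under eq_integral do rewrite gee0_abs//.
  apply/eqP; rewrite eq_le integral_ge0// andbT.
  apply/lee_addgt0Pr => e e0; rewrite add0e.
  have [m hm] := tail ((e / 2) ^+ 2) (exprn_gt0 _ (divr_gt0 e0 (ltr0n _ 2))).
  apply: (@le_trans _ _ (\int[P]_w U m w)%E); first exact: ge0_le_integral.
  apply: le_trans hm _; rewrite sqrtr_sqr ger0_norm ?divr_ge0 ?(ltW e0)//.
  by rewrite mulrCA divff// mulr1.
move/(ae_eq_integral_abs P measurableT mJ) : EJ; apply: filterS => w /(_ I) Jw e e0.
have : (J w < (e / 2)%:E)%E by rewrite Jw lte_fin divr_gt0.
move=> /ereal_inf_lt[_ [m _ <-] hm]; exists m => a b ma ab.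
have hT n : `|T m n w| <= e / 2.
  rewrite -lee_fin; apply: le_trans (ltW hm).
  by apply: ereal_sup_ubound; exists n.
have sT c : (m <= c)%N -> \sum_(m <= i < c) D i w = T m (c - m)%N w.
  move=> mc; rewrite -{1}[m]add0n big_addn big_mkord.
  by apply: eq_bigr => i _; rewrite addnC.
have -> : \sum_(a <= i < b) D i w = T m (b - m)%N w - T m (a - m)%N w.
  rewrite -!sT//; last exact: leq_trans ab.
  by rewrite [X in X - _](big_cat_nat (n := a))//= addrAC subrr add0r.
apply: le_trans (ler_normB _ _) _.
by have := hT (b - m)%N; have := hT (a - m)%N; lra.
Qed.

End Martingale.

(** * Deterministic convergence of the gradient *)

Section RealSequences.
Context {R : realType}.

Lemma last_first_crossing (p q : pred nat) m0 n0 : p m0 -> q n0 -> (m0 < n0)%N ->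
  exists m n, [/\ (m0 <= m)%N, (m < n)%N, p m, q n &
    forall k, (m < k < n)%N -> ~~ p k && ~~ q k].
Proof.
move=> pm0 qn0 mn0.
have exn : exists n, (m0 < n)%N && q n by exists n0; rewrite mn0.
have [n /andP[m0n qn] nmin] := ex_minnP exn.
have exm : exists m, [&& (m0 <= m)%N, (m < n)%N & p m] by exists m0; rewrite leqnn m0n.
have mub m : [&& (m0 <= m)%N, (m < n)%N & p m] -> (m <= n)%N by case/and3P => _ /ltnW.
have [m /and3P[m0m mn pm] mmax] := ex_maxnP exm mub.
exists m, n; split => // k /andP[mk kn].
have m0k : (m0 <= k)%N by rewrite (leq_trans m0m)// ltnW.
apply/andP; split.
  by apply: contraL mk => pk; rewrite -leqNgt mmax// m0k kn.
apply: contraL kn => qk; rewrite -leqNgt nmin// qk andbT.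
exact: leq_ltn_trans mk.
Qed.

(** Deterministic core of the gradient convergence.  While the gradient stays
   above a level, the objective cannot increase, and it must decrease in
   proportion to the change of the gradient norm.  An objective oscillating
   across [a, b] would cross upwards an interval without critical values,
   where the gradient is bounded below; so the objective converges, and then
   the gradient norm cannot keep climbing from near zero to a fixed level. *)
Lemma gradient_vanishes (g gam : nat -> R) (B : R) :
  (forall n, 0 <= g n <= B) ->
  (forall de : R, 0 < de -> exists2 c : R, 0 < c & forall eta : R, 0 < eta ->
     exists N, forall m n, (N <= m)%N -> (m <= n)%N ->
       (forall k, (m <= k < n)%N -> de <= gam k) ->
       g n - g m + c * `|gam n - gam m| <= eta) ->
  (forall eta : R, 0 < eta -> exists N, forall n, (N <= n)%N -> `|g n.+1 - g n| <= eta) ->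
  (forall eta : R, 0 < eta -> exists N, forall n, (N <= n)%N -> `|gam n.+1 - gam n| <= eta) ->
  (forall (de : R) N, 0 < de -> exists2 n, (N <= n)%N & gam n < de) ->
  (forall a b : R, a < b -> exists a' b' e : R, [/\ a < a', a' < b', b' < b, 0 < e &
     forall n, a' <= g n <= b' -> e <= gam n]) ->
  forall e : R, 0 < e -> exists N, forall n, (N <= n)%N -> gam n <= e.
Proof.
move=> gB H Sg Sgam I gap.
have no_osc (a b : R) : a < b ->
    (exists N, forall n, (N <= n)%N -> a <= g n) \/
    (exists N, forall n, (N <= n)%N -> g n <= b).
  move=> ab; apply: contrapT => /not_orP[/forallNP noa /forallNP nob].
  have [a' [b' [e [aa' ab' bb' e0 he]]]] := gap _ _ ab.
  have eta0 : 0 < (b' - a') / 4 by rewrite divr_gt0 ?subr_gt0.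
  have [c c0 /(_ _ eta0)[N1 hN1]] := H _ e0.
  have [N2 hN2] := Sg _ eta0.
  have /existsNP[m0 /not_implyP[m0N /negP]] := noa (maxn N1 N2).
  rewrite -ltNge => gm0.
  have /existsNP[n0 /not_implyP[n0N /negP]] := nob m0.+1.
  rewrite -ltNge => gn0.
  have [||m [n [m0m mn gma gnb mid]]] :=
    @last_first_crossing (fun k => g k < a') (fun k => b' < g k) m0 n0 _ _ n0N.
  - exact: lt_trans aa'.
  - exact: lt_trans gn0.
  move: m0N; rewrite geq_max => /andP[m0N1 m0N2].
  have := hN1 m.+1 n (leq_trans m0N1 (leqW m0m)) mn.
  have {}mid k : (m.+1 <= k < n)%N -> e <= gam k.
    by move=> /mid; rewrite -!leNgt => hk; apply: he.
  move=> /(_ mid) h1.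
  have := hN2 m (leq_trans m0N2 m0m); rewrite ler_norml => /andP[_ h2].
  have : 0 <= c * `|gam n - gam m.+1| by rewrite mulr_ge0// ltW.
  by lra.
have conv (eta : R) : 0 < eta ->
    exists N, forall m n, (N <= m)%N -> (N <= n)%N -> g m - g n <= eta.
  move=> eta0.
  pose A := [set a : R | exists N, forall n, (N <= n)%N -> a <= g n].
  have supA : has_sup A.
    split; first by exists 0, 0%N => n _; have /andP[] := gB n.
    exists B => a [N aN]; apply: le_trans (aN N (leqnn _)) _.
    by have /andP[] := gB N.
  have eta3 : 0 < eta / 3 by rewrite divr_gt0.
  have [a [N1 hN1] la] := sup_adherent eta3 supA.
  have [|hA|[N2 hN2]] := no_osc (sup A + eta / 3) (sup A + 2 * (eta / 3)); first by lra.
    have : sup A + eta / 3 <= sup A by apply: sup_upper_bound.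
    by lra.
  exists (maxn N1 N2) => m n; rewrite !geq_max => /andP[_ m2] /andP[n1 _].
  by have := hN2 m m2; have := hN1 n n1; lra.
move=> e e0; apply: contrapT => /forallNP no.
have de0 : 0 < e / 3 by rewrite divr_gt0.
have [c c0 Hc] := H _ de0.
have eta0 : 0 < c * (e / 3) / 2 by rewrite divr_gt0// mulr_gt0.
have [N1 hN1] := Hc _ eta0.
have [N2 hN2] := conv _ eta0.
have de20 : 0 < e / 3 / 2 by rewrite divr_gt0.
have [N3 hN3] := Sgam _ de20.
have [m0 m0N gm0] := I _ (maxn N1 (maxn N2 N3)) de0.
have /existsNP[n0 /not_implyP[n0N /negP]] := no m0.+1.
rewrite -ltNge => gn0.
have [//|m [n [m0m mn gma gnb mid]]] :=
    @last_first_crossing (fun k => gam k < e / 3) (fun k => e < gam k) m0 n0 gm0 _ n0N.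
move: m0N; rewrite !geq_max => /and3P[m0N1 m0N2 m0N3].
have {}mid k : (m.+1 <= k < n)%N -> e / 3 <= gam k.
  by move=> /mid /andP[]; rewrite -!leNgt.
have := hN1 m.+1 n (leq_trans m0N1 (leqW m0m)) mn mid.
have := hN2 m.+1 n (leq_trans m0N2 (leqW m0m)) (leq_trans m0N2 (leq_trans m0m (ltnW mn))).
have := hN3 m (leq_trans m0N3 m0m); rewrite ler_norml => /andP[_ h3] h2 h1.
have : 3 / 2 * (e / 3) <= `|gam n - gam m.+1| by apply: le_trans (ler_norm _); lra.
by move/(ler_wpM2l (ltW c0)); lra.
Qed.

Lemma sqr_small (x y : nat -> R) (C : R) : 0 <= C ->
  (forall n, x n ^+ 2 <= C * y n) ->
  (forall e : R, 0 < e -> exists N, forall n, (N <= n)%N -> `|y n| <= e) ->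
  forall e : R, 0 < e -> exists N, forall n, (N <= n)%N -> `|x n| <= e.
Proof.
move=> C0 xy hy e e0; have C1 : 0 < C + 1 by lra.
have [N hN] := hy _ (divr_gt0 (exprn_gt0 2 e0) C1); exists N => n Nn.
apply: le_of_sqr; first exact: ltW.
rewrite real_normK ?num_real//; apply: le_trans (xy n) _.
apply: (@le_trans _ _ ((C + 1) * `|y n|)).
  apply: (@le_trans _ _ (C * `|y n|)); first by rewrite ler_wpM2l// ler_norm.
  by rewrite ler_wpM2r// lerDl.
by have := hN n Nn; rewrite ler_pdivlMr// mulrC.
Qed.

(** From an index m on where the tail of the series is at most 1/2, the
   increment S n - S m is at most S n / 2. *)
Lemma bounded_of_relative_increments (S q : nat -> R) : (forall n, 0 < S n) ->
  (forall n, S n.+1 = S n + q n ^+ 2) ->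
  cauchy_series (fun n => q n ^+ 2 / S n) ->
  exists C : R, forall n, S n <= C.
Proof.
move=> S0 hS /(_ 2^-1 (ltac:(by rewrite invr_gt0)))[m hm].
have Snd a b : (a <= b)%N -> S a <= S b.
  by move: a b; apply/nondecreasing_seqP => n; rewrite hS lerDl sqr_ge0.
exists (2 * S m) => n; have [mn|nm] := leqP m n; last first.
  by have := Snd n m (ltnW nm); have := S0 m; lra.
have := hm m n (leqnn _) mn; rewrite ger0_norm; last first.
  by apply: sumr_ge0 => i _; rewrite divr_ge0 ?sqr_ge0// ltW.
move=> h; have : S n - S m <= S n * \sum_(m <= i < n) q i ^+ 2 / S i.
  rewrite -(telescope_sumr _ mn) mulr_sumr; apply: ler_sum_nat => i /andP[mi ni].
  rewrite hS addrAC subrr add0r mulrCA ler_peMr ?sqr_ge0//.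
  by rewrite ler_pdivlMr// mul1r Snd// ltnW.
have : S n * \sum_(m <= i < n) q i ^+ 2 / S i <= S n * 2^-1 by rewrite ler_wpM2l// ltW.
by lra.
Qed.

End RealSequences.

Section Trajectory.
Context {R : realType} {d : nat}.

(** Gradient convergence along one trajectory: the four series are those that
   the probabilistic estimates show to converge almost surely, and the last
   hypothesis says that single steps become negligible. *)
Lemma trajectory_gradient_vanishes (g : 'rV[R]_d -> R) (th G : nat -> 'rV[R]_d)
    (S : nat -> R) (al L c B : R) :
  (forall y, differentiable g y) -> continuous (grad g) -> weak_Sard g ->
  0 < al -> 0 < L ->
  (forall x y, enorm (grad g x - grad g y) <= L * enorm (x - y)) ->
  (forall x, 0 <= g x) ->
  (forall n, 0 < S n) -> (forall n, S n.+1 = S n + enorm (G n) ^+ 2) ->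
  (forall n, th n.+1 = th n - (al / Num.sqrt (S n.+1)) *: G n) ->
  (forall n, one_step al L c (Num.sqrt (S n)) (Num.sqrt (S n.+1)) (enorm (G n))
     (dotp (grad g (th n)) (G n)) (enorm (grad g (th n)))
     (1 + g (th n)) (1 + g (th n.+1))) ->
  (forall n, enorm (th n) <= B) -> (forall n, g (th n) <= B) ->
  cauchy_series (fun n => enorm (grad g (th n)) ^+ 2 / S n) ->
  (forall j : nat, cauchy_series (fun n =>
     ind_ge j.+1%:R^-1 (enorm (grad g (th n))) * (enorm (G n) ^+ 2 / S n))) ->
  (forall j : nat, cauchy_series (fun n =>
     ind_ge j.+1%:R^-1 (enorm (grad g (th n))) *
       (dotp (grad g (th n)) (G n) - enorm (grad g (th n)) ^+ 2) / Num.sqrt (S n))) ->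
  (forall (j : nat) (i : 'I_d), cauchy_series (fun n =>
     ind_ge j.+1%:R^-1 (enorm (grad g (th n))) *
       (G n ord0 i - grad g (th n) ord0 i) / Num.sqrt (S n))) ->
  (forall e : R, 0 < e -> exists N, forall n, (N <= n)%N ->
     `|enorm (G n) ^+ 2 / S n| <= e) ->
  forall e : R, 0 < e -> exists N, forall n, (N <= n)%N -> enorm (grad g (th n)) <= e.
Proof.
move=> dg cg sg al0 L0 hL g0 S0 hS hth os thB gB cs_grad cs_noise cs_d cs_G small.
pose gam n := enorm (grad g (th n)).
pose q n := enorm (G n).
pose u n := Num.sqrt (S n).
have u0 n : 0 < u n by rewrite sqrtr_gt0.
have u2 n : u n ^+ 2 = S n by rewrite sqr_sqrtr// ltW.
have q0 n : 0 <= q n by exact: enorm_ge0.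
have gam0 n : 0 <= gam n by exact: enorm_ge0.
have B0 : 0 <= B by exact: le_trans (enorm_ge0 _) (thB 0%N).
have uu n : u n.+1 ^+ 2 = u n ^+ 2 + q n ^+ 2 by rewrite !u2 hS.
have rho n : (q n / u n.+1) ^+ 2 <= q n ^+ 2 / S n by rewrite -u2; exact: ratio_sqr_le.
have inv_de (de : R) : 0 < de -> exists j : nat, j.+1%:R^-1 <= de.
  move=> de0; exists (Num.truncn de^-1).
  by rewrite invf_ple ?posrE// ltW// truncnS_gt.
have indE (de : R) j x : j.+1%:R^-1 <= de -> de <= gam x ->
    ind_ge j.+1%:R^-1 (enorm (grad g (th x))) = 1.
  by move=> jd dx; rewrite /ind_ge (le_trans jd).
have lam n : 0 <= ((u n)^-1 - (u n.+1)^-1) * q n <= q n ^+ 2 / S n.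
  by rewrite -u2; exact: decay_mul_le.
have lam0 n : 0 <= (u n)^-1 - (u n.+1)^-1.
  rewrite subr_ge0 lef_pV2 ?posrE//; apply: le_of_sqr; first exact: ltW.
  by rewrite uu lerDl sqr_ge0.
have gamB n : gam n <= 2 * L * (1 + B) + 1.
  have := os_gamX (os n); rewrite -/(gam n) => h.
  have : 4 * L * (1 + g (th n)) <= 4 * L * (1 + B) by rewrite ler_pM2l ?mulr_gt0// lerD2l.
  by have := sqr_ge0 (gam n - 1); nra.
pose K := al * (2 * L * (1 + B) + 1) + L * al ^+ 2.
have K0 : 0 <= K by rewrite /K; nneg.
have g_step n : g (th n.+1) - g (th n) <= - al * (gam n ^+ 2 / u n)
   - al * ((dotp (grad g (th n)) (G n) - gam n ^+ 2) / u n) + K * (q n ^+ 2 / S n).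
  have T := os_taylor (os n); rewrite -/(u n.+1) -/(q n) in T.
  set dd := dotp _ _ in T *.
  have ddq : `|dd| <= gam n * q n by exact: os_d (os n).
  have h1 : L * al ^+ 2 * (q n / u n.+1) ^+ 2 <= L * al ^+ 2 * (q n ^+ 2 / S n).
    by apply: ler_wpM2l => //; nneg.
  have h2 : ((u n)^-1 - (u n.+1)^-1) * dd <= (2 * L * (1 + B) + 1) * (q n ^+ 2 / S n).
    apply: (@le_trans _ _ (((u n)^-1 - (u n.+1)^-1) * (gam n * q n))).
      by apply: ler_wpM2l => //; exact: le_trans (ler_norm _) ddq.
    rewrite mulrCA; have /andP[l1 l2] := lam n.
    by apply: ler_pM.
  have {}h2 : al * (((u n)^-1 - (u n.+1)^-1) * dd) <= al * ((2 * L * (1 + B) + 1) * (q n ^+ 2 / S n)).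
    by rewrite ler_pM2l.
  by move: T; rewrite ler_norml /K mulrBl => /andP[_ T]; lra.
have th_step n i : `|th n.+1 ord0 i - th n ord0 i +
     al * ((G n ord0 i - grad g (th n) ord0 i) / u n)| <=
     al * (gam n / u n) + al * (q n ^+ 2 / S n).
  have -> : th n.+1 ord0 i = th n ord0 i - al / u n.+1 * G n ord0 i by rewrite hth !mxE.
  have -> : th n ord0 i - al / u n.+1 * G n ord0 i - th n ord0 i +
     al * ((G n ord0 i - grad g (th n) ord0 i) / u n) =
     al * (((u n)^-1 - (u n.+1)^-1) * G n ord0 i) - al * (grad g (th n) ord0 i / u n).
    by field; rewrite !gt_eqF.
  apply: le_trans (ler_normB _ _) _; rewrite addrC; apply: lerD.
    rewrite !normrM (gtr0_norm al0) normfV (gtr0_norm (u0 n)) ler_pM2l//.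
    by rewrite ler_pM2r ?invr_gt0// coord_le_enorm.
  rewrite !normrM (gtr0_norm al0) (ger0_norm (lam0 n)) ler_pM2l//.
  have /andP[_] := lam n; apply: le_trans; apply: ler_wpM2l => //.
  exact: coord_le_enorm.
apply: (@gradient_vanishes _ (fun n => g (th n)) gam B).
- by move=> n; rewrite g0 gB.
- move=> de de0.
  (* chosen so that the drift part of the displacement, at most
     al / de times the sum Z below in each coordinate, is paid by al * Z *)
  pose k := de / (L * (d.+1)%:R).
  have k0 : 0 < k by rewrite divr_gt0// mulr_gt0.
  exists k => // eta eta0; have [j hj] := inv_de _ de0.
  pose D := al + K + 2 * (de * al).
  have D0 : 0 < D by rewrite /D; have := mulr_gt0 de0 al0; lra.
  have ep0 : 0 < eta / D by exact: divr_gt0.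
  set ep := eta / D in ep0.
  have [N1 hN1] := cs_noise j _ ep0.
  have [N2 hN2] := cs_d j _ ep0.
  have [N3 hN3] : exists N, forall i m n, (N <= m)%N -> (m <= n)%N ->
      `|\sum_(m <= t < n) ind_ge j.+1%:R^-1 (enorm (grad g (th t))) *
       (G t ord0 i - grad g (th t) ord0 i) / Num.sqrt (S t)| <= ep.
    have /choice[Nf hNf] := fun i => cs_G j i _ ep0.
    exists (\max_(i < d) Nf i)%N => i m n Nm; apply: hNf.
    by apply: leq_trans Nm; exact: leq_bigmax.
  exists (maxn N1 (maxn N2 N3)) => m n; rewrite !geq_max => /and3P[m1 m2 m3] mn seg.
  pose Z := \sum_(m <= t < n) gam t ^+ 2 / u t.
  have e1 : \sum_(m <= t < n) q t ^+ 2 / S t <= ep.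
    apply: le_trans (ler_norm _) _; have := hN1 m n m1 mn.
    rewrite (eq_big_nat _ _ (F2 := fun t => q t ^+ 2 / S t))// => t mt.
    by rewrite (indE _ _ _ hj (seg t mt)) mul1r.
  have e2 : `|\sum_(m <= t < n) (dotp (grad g (th t)) (G t) - gam t ^+ 2) / u t| <= ep.
    have := hN2 m n m2 mn.
    rewrite (eq_big_nat _ _ (F2 := fun t => (dotp (grad g (th t)) (G t) - gam t ^+ 2) / u t))// => t mt.
    by rewrite (indE _ _ _ hj (seg t mt)) mul1r.
  have e3 i : `|\sum_(m <= t < n) (G t ord0 i - grad g (th t) ord0 i) / u t| <= ep.
    have := hN3 i m n m3 mn.
    rewrite (eq_big_nat _ _ (F2 := fun t => (G t ord0 i - grad g (th t) ord0 i) / u t))// => t mt.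
    by rewrite (indE _ _ _ hj (seg t mt)) mul1r.
  have Z0 : 0 <= Z by apply: sumr_ge0 => t _; rewrite divr_ge0 ?sqr_ge0// ltW.
  have gdec : g (th n) - g (th m) <= - (al * Z) + al * ep + K * ep.
    rewrite -(telescope_sumr (fun t => g (th t)) mn).
    apply: le_trans (ler_sum_nat (fun t _ => g_step t)) _.
    rewrite !big_split/= sumrN -!mulr_sumr -/Z.
    have : K * (\sum_(m <= i < n) q i ^+ 2 / S i) <= K * ep by rewrite ler_wpM2l.
    have : - (al * (\sum_(m <= t < n) (dotp (grad g (th t)) (G t) - gam t ^+ 2) / u t)) <= al * ep.
      rewrite -mulrN ler_pM2l//; apply: le_trans (ler_norm _) _; by rewrite normrN.
    by lra.
  have Zd : \sum_(m <= t < n) gam t / u t <= Z / de.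
    rewrite ler_pdivlMr// mulrC mulr_sumr; apply: ler_sum_nat => t mt.
    rewrite mulrA ler_pM2r ?invr_gt0// expr2; apply: ler_wpM2r => //; exact: seg.
  have thi i : `|th n ord0 i - th m ord0 i| <= al * (Z / de) + 2 * (al * ep).
    have -> : th n ord0 i - th m ord0 i =
       \sum_(m <= t < n) (th t.+1 ord0 i - th t ord0 i +
           al * ((G t ord0 i - grad g (th t) ord0 i) / u t)) -
       al * \sum_(m <= t < n) ((G t ord0 i - grad g (th t) ord0 i) / u t).
      by rewrite big_split/= -mulr_sumr addrK (telescope_sumr (fun t => th t ord0 i) mn).
    apply: le_trans (ler_normB _ _) _; rewrite normrM (gtr0_norm al0).
    have : al * `|\sum_(m <= t < n) (G t ord0 i - grad g (th t) ord0 i) / u t| <= al * ep.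
      by rewrite ler_pM2l.
    have : `|\sum_(m <= t < n) (th t.+1 ord0 i - th t ord0 i +
           al * ((G t ord0 i - grad g (th t) ord0 i) / u t))| <=
        al * (\sum_(m <= t < n) gam t / u t) + al * (\sum_(m <= t < n) q t ^+ 2 / S t).
      apply: le_trans (ler_norm_sum _ _ _) _; rewrite !mulr_sumr -big_split/=.
      by apply: ler_sum_nat => t _; exact: th_step.
    have : al * (\sum_(m <= t < n) gam t / u t) <= al * (Z / de) by rewrite ler_pM2l.
    have : al * (\sum_(m <= t < n) q t ^+ 2 / S t) <= al * ep by rewrite ler_pM2l.
    by lra.
  have gdiff : `|gam n - gam m| <= L * (d%:R * (al * (Z / de) + 2 * (al * ep))).
    apply: le_trans (ler_dist_enorm _ _) _; apply: le_trans (hL _ _) _.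
    rewrite ler_pM2l//; apply: le_trans (enorm_le_sum _) _.
    apply: (@le_trans _ _ (\sum_(i < d) (al * (Z / de) + 2 * (al * ep)))).
      by apply: ler_sum => i _; rewrite !mxE.
    by rewrite sumr_const card_ord -[leLHS]mulr_natl.
  have kk : k * `|gam n - gam m| <= al * Z + 2 * (de * al) * ep.
    apply: le_trans (ler_wpM2l (ltW k0) gdiff) _.
    have -> : k * (L * (d%:R * (al * (Z / de) + 2 * (al * ep)))) =
       (d%:R / d.+1%:R) * (al * Z + 2 * (de * al) * ep).
      by rewrite /k; field; rewrite !gt_eqF.
    apply: ler_piMl; first by have ? := ltW ep0; have ? := ltW de0; nneg.
    by rewrite ler_pdivrMr// mul1r ler_nat.
  have : D * ep = eta by rewrite /ep mulrCA divff ?mulr1// gt_eqF.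
  by rewrite /D; lra.
- apply: (@sqr_small _ _ (fun n => q n ^+ 2 / S n)
    ((8 * L * al ^+ 2 + 2 * L ^+ 2 * al ^+ 4) * (1 + B))) => // [|n].
    by nneg.
  have := one_step_increment_sqr _ _ _ _ _ _ _ _ _ _ al0 L0 (os n).
  have -> : 1 + g (th n.+1) - (1 + g (th n)) = g (th n.+1) - g (th n) by ring.
  move/le_trans; apply; rewrite -/(u n.+1) -/(q n).
  apply: ler_pM => //; [|exact: sqr_ge0|].
    by apply: mulr_ge0; [nneg|rewrite addr_ge0].
  by apply: ler_wpM2l; [nneg|rewrite lerD2l].
- apply: (@sqr_small _ _ (fun n => q n ^+ 2 / S n) ((L * al) ^+ 2)) => // [|n].
    exact: sqr_ge0.
  have : `|gam n.+1 - gam n| <= L * al * (q n / u n.+1).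
    apply: le_trans (ler_dist_enorm _ _) _; apply: le_trans (hL _ _) _.
    rewrite hth addrAC subrr add0r enormN enormZ -/(u n.+1) -/(q n).
    rewrite gtr0_norm ?divr_gt0//.
    by have -> : L * (al / u n.+1 * q n) = L * al * (q n / u n.+1) by ring.
  move=> h; rewrite -real_normK ?num_real//.
  apply: (@le_trans _ _ ((L * al * (q n / u n.+1)) ^+ 2)).
    by apply: lerXn2r => //; rewrite nnegrE (le_trans _ h).
  by rewrite exprMn ler_wpM2l ?sqr_ge0.
- (* if the gradient stayed above de, all noise terms would be summable, S
     would be bounded, and gam^2 / S could not tend to 0 *)
  move=> de N de0; apply: contrapT => /forall2NP no.
  have seg n : (N <= n)%N -> de <= gam n.
    by move=> Nn; have [//|/negP] := no n; rewrite -leNgt.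
  have [j hj] := inv_de _ de0.
  have cs : cauchy_series (fun n => q n ^+ 2 / S n).
    move=> e e0; have [M hM] := cs_noise j _ e0; exists (maxn M N) => a b.
    rewrite geq_max => /andP[Ma Na] ab; have := hM a b Ma ab.
    rewrite (eq_big_nat _ _ (F2 := fun t => q t ^+ 2 / S t))// => t /andP[at_ _].
    by rewrite (indE _ _ _ hj (seg t (leq_trans Na at_))) mul1r.
  have [C hC] := bounded_of_relative_increments S0 hS cs.
  have C0 : 0 < C by exact: lt_le_trans (S0 0%N) (hC 0%N).
  have dC : 0 < de ^+ 2 / C / 2 by rewrite !divr_gt0// exprn_gt0.
  have [M hM] := cauchy_series_cvg0 cs_grad dC.
  have := hM (maxn M N) (leq_maxl _ _).
  have h := seg (maxn M N) (leq_maxr _ _); have s0 := S0 (maxn M N).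
  have hc := hC (maxn M N).
  rewrite ger0_norm; last by rewrite divr_ge0 ?sqr_ge0// ltW.
  have : de ^+ 2 / C <= gam (maxn M N) ^+ 2 / S (maxn M N).
    apply: ler_pM; rewrite ?sqr_ge0 ?invr_ge0 ?(ltW C0)//.
      by apply: lerXn2r; rewrite ?nnegrE ?(ltW de0).
    by rewrite lef_pV2 ?posrE.
  by rewrite -/(gam _); lra.
- move=> a b ab; have [a' [b' [e [h1 h2 h3 e0 he]]]] := weak_Sard_gap g B a b dg cg sg ab.
  by exists a', b', e; split => // n; apply: he.
Qed.

End Trajectory.

(** * Almost sure convergence of the noise series *)

(** With u = S / (S + q^2), this is 1 + b * (1 - u) <= u^-b. *)
Lemma powR_decay_ge {R : realType} (S q b : R) : 0 < S -> 0 < b ->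
  q ^+ 2 / (S + q ^+ 2) `^ (1 + b) <= b^-1 * ((S `^ b)^-1 - ((S + q ^+ 2) `^ b)^-1).
Proof.
move=> S0 b0; set S' := S + q ^+ 2.
have S'0 : 0 < S' by rewrite ltr_wpDr ?sqr_ge0.
pose u := S / S'.
have u0 : 0 < u by exact: divr_gt0.
have uS : S = u * S' by rewrite /u divfK ?gt_eqF.
have p0 : 0 < S' `^ b by exact: powR_gt0.
have -> : S' `^ (1 + b) = S' * S' `^ b.
  by rewrite powRD ?powRr1 ?(ltW S'0)// gt_eqF ?implybT// addr_gt0.
have -> : (S `^ b)^-1 = u `^ (- b) * (S' `^ b)^-1.
  have -> : S `^ b = u `^ b * S' `^ b by rewrite -powRM ?(ltW u0) ?(ltW S'0)// -uS.
  by rewrite invfM powRN.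
have h : 1 + b * (1 - u) <= u `^ (- b).
  rewrite /powR gt_eqF//; apply: le_trans (expR_ge1Dx _); rewrite lerD2l mulNr -mulrN.
  rewrite ler_pM2l// lerNr opprB.
  have : -1 < u - 1 by lra.
  by move/le_ln1Dx; rewrite [1 + _]addrC subrK.
have -> : q ^+ 2 / (S' * S' `^ b) = (1 - u) * (S' `^ b)^-1.
  have -> : q ^+ 2 = S' - S by rewrite /S' addrAC subrr add0r.
  by rewrite /u; field; rewrite !gt_eqF.
have -> : u `^ (- b) * (S' `^ b)^-1 - (S' `^ b)^-1 = (u `^ (- b) - 1) * (S' `^ b)^-1 by ring.
rewrite mulrA ler_pM2r ?invr_gt0//.
by rewrite mulrC ler_pdivlMr//; lra.
Qed.

Section AlmostSure.
Context {R : realType} {dO : measure_display} {Omega : measurableType dO}.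
Context (P : probability Omega R).
Context (F : nat -> set (set Omega)) (X q d gam S : nat -> Omega -> R)
  (al L c beta sig S0 : R).

Local Notation run := (scalar_run P F X q d gam S al L c beta sig S0).

Lemma run_integ_grad_energy : run -> forall n,
  integ P (fun w => X n w ^+ 2 * gam n w ^+ 2 / S n w).
Proof.
move=> r n; apply: bmeas_integ (sr_F r n) _; apply: bmeasM; last exact: run_bmeas_SV r n.
by apply: bmeasM; apply: bmeasX; [exact: sr_mX r n|exact: sr_mgam r n].
Qed.

(** The partial sums form a martingale; its variances are dominated by the
   summable noise and gradient energies. *)
Lemma ae_noise_cauchy (z : nat -> Omega -> R) (de k : R) : 0 < de -> 0 <= k -> run ->
  (forall n, Hmeas (F n.+1) (z n)) ->
  (forall n w, z n w ^+ 2 <= k * (X n w ^+ 2 * (q n w ^+ 2 + gam n w ^+ 2))) ->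
  (forall n h, bmeas (F n) h -> Ex P (fun w => h w * z n w) = 0) ->
  {ae P, forall w, cauchy_series (fun n =>
     ind_ge de (gam n w) * z n w / Num.sqrt (S n w))}.
Proof.
move=> de0 k0 r mz zq zE.
have [C1 C10 hC1] := summable_noise_energy de0 r.
have [C2 C20 hC2] := summable_grad_energy r.
pose D n w := ind_ge de (gam n w) * z n w / Num.sqrt (S n w).
pose h n w := ind_ge de (gam n w) / Num.sqrt (S n w).
have bh n : bmeas (F n) (h n).
  apply: bmeasM; last exact: run_bmeas_sqrtSV r n.
  by apply: bmeas_ind_ge; exact: (sr_mgam r n).1.
have DE n : D n = (fun w => h n w * z n w) by apply/funext => w; rewrite /D /h mulrAC.
have mD n : Hmeas (F n.+1) (D n).
  rewrite DE; apply: HmeasM; last exact: mz.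
  exact: HmeasW (sr_F r n) (sr_F r n.+1) (sr_FS r n) (bh n).1.
have iE1 n := run_integ_noise de r n.
have iE2 n := run_integ_grad_energy r n.
have D2 n w : D n w ^+ 2 <= k * (X n w ^+ 2 * ind_ge de (gam n w) * (q n w ^+ 2 / S n w) +
     X n w ^+ 2 * gam n w ^+ 2 / S n w).
  have s0 := run_S_gt0 r n w.
  rewrite /D expr_div_n sqr_sqrtr ?(ltW s0)// exprMn /ind_ge; case: ifPn => _; last first.
    rewrite expr0n/= !mul0r mulr0 mul0r add0r.
    have ? := ltW s0; by nneg.
  rewrite expr1n mul1r mulr1 mulrA -mulrDl mulrA ler_pM2r ?invr_gt0// -mulrDr.
  exact: zq.
have iD2' n : integ P (fun w => k * (X n w ^+ 2 * ind_ge de (gam n w) * (q n w ^+ 2 / S n w) +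
     X n w ^+ 2 * gam n w ^+ 2 / S n w)) by apply: integZ; exact: integD.
have iD2 n : integ P (fun w => D n w ^+ 2).
  apply: (integ_le _ _ _ _ _ (iD2' n)) => [|w].
    by apply: measurable_funX; exact: (Hmeas_measurable _ _ (sr_F r n.+1) (mD n)).
  by rewrite ger0_norm ?sqr_ge0.
apply: (@ae_martingale_cauchy _ _ _ P F D (k * (C1 + C2)) (sr_F r) (sr_FS r) mD iD2).
  move=> n f bf; rewrite DE; have := zE n _ (bmeasM bf (bh n)).
  by under eq_fun do rewrite -mulrA.
move=> N; apply: (@le_trans _ _ (\sum_(n < N) k * (Ex P (fun w =>
     X n w ^+ 2 * ind_ge de (gam n w) * (q n w ^+ 2 / S n w)) +
     Ex P (fun w => X n w ^+ 2 * gam n w ^+ 2 / S n w)))).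
  apply: ler_sum => n _; rewrite -ExD// -ExZ//; last exact: integD.
  by apply: Ex_le => //; exact: D2.
rewrite -mulr_sumr big_split/=; apply: ler_wpM2l => //; apply: lerD; [exact: hC1|exact: hC2].
Qed.

Lemma ae_grad_energy : run ->
  {ae P, forall w, cauchy_series (fun n => gam n w ^+ 2 / S n w)}.
Proof.
move=> r; have [C C0 hC] := summable_grad_energy r.
have S_0 := run_S_gt0 r; have X1 := run_X_ge1 r.
have := ae_summable P (fun n w => X n w ^+ 2 * gam n w ^+ 2 / S n w) C _
   (run_integ_grad_energy r) hC.
have H0 n w : 0 <= X n w ^+ 2 * gam n w ^+ 2 / S n w by have ? := ltW (S_0 n w); nneg.
move=> /(_ H0); apply: filterS => w [M hM].
apply: (@bounded_cauchy_series _ _ M) => [n|N].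
  by rewrite divr_ge0 ?sqr_ge0// ltW.
apply: le_trans (hM N); apply: ler_sum => n _.
rewrite ler_pM2r ?invr_gt0// ler_peMl ?sqr_ge0// exprn_ege1//.
Qed.

Lemma ae_noise_energy (de : R) : 0 < de -> run ->
  {ae P, forall w, cauchy_series (fun n => ind_ge de (gam n w) * (q n w ^+ 2 / S n w))}.
Proof.
move=> de0 r; have [C C0 hC] := summable_noise_energy de0 r.
have S_0 := run_S_gt0 r; have X1 := run_X_ge1 r.
have := ae_summable P (fun n w => X n w ^+ 2 * ind_ge de (gam n w) * (q n w ^+ 2 / S n w)) C _
   (run_integ_noise de r) hC.
have g0 n w : 0 <= ind_ge de (gam n w) by have /andP[] := ind_ge01 de (gam n w).
have H0 n w : 0 <= X n w ^+ 2 * ind_ge de (gam n w) * (q n w ^+ 2 / S n w).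
  by have ? := ltW (S_0 n w); nneg.
move=> /(_ H0); apply: filterS => w [M hM].
apply: (@bounded_cauchy_series _ _ M) => [n|N].
  by have ? := ltW (S_0 n w); nneg.
apply: le_trans (hM N); apply: ler_sum => n _.
rewrite -mulrA ler_peMl ?exprn_ege1//.
by have ? := ltW (S_0 n w); nneg.
Qed.

(** In the region of small gradients, the relative-moment condition shows that
   truncating q at a fixed level k loses at most half of its second moment;
   after truncation S may be replaced by S + q^2, and the resulting series
   telescopes.  The weight ind_ge (- de) (- gam) is the indicator of gam <= de. *)
Lemma ae_small_gradient_noise (de rho kappa : R) : 0 < rho -> 0 <= kappa -> run ->
  (forall n, integ P (fun w => ind_ge (- de) (- gam n w) * q n w `^ (2 + rho))) ->
  (forall n h, bmeas (F n) h -> (forall w, 0 <= h w) ->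
     Ex P (fun w => h w * (ind_ge (- de) (- gam n w) * q n w `^ (2 + rho))) <=
     kappa * Ex P (fun w => h w * (ind_ge (- de) (- gam n w) * q n w ^+ 2))) ->
  {ae P, forall w, cauchy_series (fun n =>
     ind_ge (- de) (- gam n w) * q n w `^ (2 + rho) / S n w `^ (1 + rho / 2))}.
Proof.
move=> rho0 ka0 r iq hq.
have S_0 := run_S_gt0 r.
have q0 n w : 0 <= q n w by exact: os_q (sr_step r n w).
pose I n w := ind_ge (- de) (- gam n w).
have I01 n w : 0 <= I n w <= 1 by exact: ind_ge01.
have I0 n w : 0 <= I n w by have /andP[] := I01 n w.
have bI n : bmeas (F n) (I n).
  apply: bmeas_ind_ge; have -> : (fun w => - gam n w) = (fun w => 0 - gam n w).
    by apply/funext => w; rewrite sub0r.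
  by apply: HmeasB; [exact: Hmeas_cst|exact: (sr_mgam r n).1].
pose b := rho / 2.
have b0 : 0 < b by rewrite divr_gt0.
have SpV (a : R) : 0 <= a -> forall n, bmeas (F n) (fun w => (S n w `^ a)^-1).
  move=> a0 n; apply: (@bmeasV _ _ _ _ _ (S0 `^ a)); first by rewrite powR_gt0 ?(sr_S0 r).
    move=> w; rewrite ge0_ler_powR// ?nnegrE ?(ltW (sr_S0 r)) ?(ltW (S_0 _ _))//.
    exact: run_S_ge r n w.
  by apply: Hmeas_powR; exact: sr_mS r n.
pose h n w := (S n w `^ (1 + b))^-1.
have bh n : bmeas (F n) (h n) by apply: SpV; rewrite addr_ge0// ltW.
have h0 n w : 0 <= h n w by rewrite invr_ge0 powR_ge0.
pose hb n w := (S n w `^ b)^-1.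
have bhb n : bmeas (F n) (hb n) by apply: SpV; exact: ltW.
have hb0 n w : 0 <= hb n w by rewrite invr_ge0 powR_ge0.
(* truncation level: kappa * k^-rho <= 1/2 *)
pose k := (2 * kappa + 1) `^ rho^-1.
have k1 : 0 < 2 * kappa + 1 by lra.
have k0 : 0 < k by exact: powR_gt0.
have krho : k `^ rho = 2 * kappa + 1 by rewrite /k -powRrM mulVf ?gt_eqF// powRr1// ltW.
pose A := (1 + k ^+ 2 / S0) `^ (1 + b).
have A0 : 0 <= A by exact: powR_ge0.
pose tr n w := ind_ge (- k) (- q n w).
have tr01 n w : 0 <= tr n w <= 1 by exact: ind_ge01.
pose V1 n w := h n w * (I n w * q n w `^ (2 + rho)).
pose V2 n w := h n w * (I n w * q n w ^+ 2).
have iV1 n : integ P (V1 n) by exact: bmeas_integM (sr_F r n) (bh n) (iq n).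
have iIq n : integ P (fun w => I n w * q n w ^+ 2).
  exact: bmeas_integM (sr_F r n) (bI n) (sr_iq r n).
have iV2 n : integ P (V2 n) by exact: bmeas_integM (sr_F r n) (bh n) (iIq n).
have ihb n : integ P (hb n) by exact: bmeas_integ (sr_F r n) (bhb n).
have V10 n w : 0 <= V1 n w by rewrite /V1 mulr_ge0// mulr_ge0// powR_ge0.
have key n w : V2 n w <= A / b * (hb n w - hb n.+1 w) + (2 * kappa + 1)^-1 * V1 n w.
  have s0 := S_0 n w; have s0' := S_0 n.+1 w.
  have dec := powR_decay_ge (q n w) s0 b0.
  rewrite -(sr_Sstep r) -/(hb n w) -/(hb n.+1 w) in dec.
  have dec0 : 0 <= hb n w - hb n.+1 w.
    have : 0 <= q n w ^+ 2 / S n.+1 w `^ (1 + b) by rewrite divr_ge0 ?sqr_ge0// powR_ge0.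
    by move/le_trans => /(_ _ dec); rewrite pmulr_rge0// invr_gt0.
  have Ab : 0 <= A / b * (hb n w - hb n.+1 w) by rewrite mulr_ge0// divr_ge0// ltW.
  have V1' : 0 <= (2 * kappa + 1)^-1 * V1 n w by rewrite mulr_ge0// invr_ge0 ltW.
  have [qk|kq] := leP (q n w) k.
    suff : V2 n w <= A / b * (hb n w - hb n.+1 w) by lra.
    have SA : S n.+1 w `^ (1 + b) <= A * S n w `^ (1 + b).
      rewrite /A -powRM; last 2 first.
      - by have ? := ltW (sr_S0 r); nneg.
      - exact: ltW.
      apply: ge0_ler_powR; rewrite ?nnegrE ?(ltW s0') ?addr_ge0 ?(ltW b0)//.
        by have ? := ltW (sr_S0 r); have ? := ltW s0; nneg.
      rewrite (sr_Sstep r) mulrDl mul1r lerD2l.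
      apply: (@le_trans _ _ (k ^+ 2)); first by apply: lerXn2r; rewrite ?nnegrE// ltW.
      rewrite mulrAC ler_pdivlMr ?(sr_S0 r)// ler_wpM2l ?sqr_ge0//.
      exact: run_S_ge r n w.
    have hA : h n w <= A / S n.+1 w `^ (1 + b).
      rewrite /h ler_pdivlMr ?powR_gt0// mulrC ler_pdivrMr ?powR_gt0//.
    apply: (@le_trans _ _ (A / S n.+1 w `^ (1 + b) * q n w ^+ 2)).
      rewrite /V2; apply: ler_pM => //; first by rewrite mulr_ge0// sqr_ge0.
      by rewrite ler_piMl ?sqr_ge0//; have /andP[] := I01 n w.
    have -> : A / S n.+1 w `^ (1 + b) * q n w ^+ 2 = A * (q n w ^+ 2 / S n.+1 w `^ (1 + b)) by ring.
    by rewrite -mulrA ler_wpM2l.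
  suff : V2 n w <= (2 * kappa + 1)^-1 * V1 n w by lra.
  have -> : (2 * kappa + 1)^-1 * V1 n w =
      h n w * (I n w * ((2 * kappa + 1)^-1 * q n w `^ (2 + rho))) by rewrite /V1; ring.
  apply: ler_wpM2l => //; apply: ler_wpM2l => //.
  rewrite -krho powRD ?powR_mulrn//; last by rewrite (gt_eqF (lt_trans k0 kq)) implybT.
  rewrite mulrCA ler_peMr ?sqr_ge0// mulrC ler_pdivlMr ?powR_gt0// mul1r.
  by apply: ge0_ler_powR; rewrite ?nnegrE ?(ltW k0) ?(ltW rho0) ?q0 ?(ltW kq).
have EV1 n : Ex P (V1 n) <= 2 * kappa * (A / b) * (Ex P (hb n) - Ex P (hb n.+1)).
  have h1 : Ex P (V1 n) <= kappa * Ex P (V2 n) by exact: hq.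
  have h2 : Ex P (V2 n) <= A / b * (Ex P (hb n) - Ex P (hb n.+1)) + (2 * kappa + 1)^-1 * Ex P (V1 n).
    rewrite -ExB// -ExZ//; last exact: integB.
    rewrite -ExZ// -ExD; last 2 first.
    - by apply: integZ; exact: integB.
    - exact: integZ.
    apply: Ex_le => //; apply: integD; first by apply: integZ; exact: integB.
    exact: integZ.
  have h3 : kappa * Ex P (V2 n) <= kappa * (A / b * (Ex P (hb n) - Ex P (hb n.+1)) +
      (2 * kappa + 1)^-1 * Ex P (V1 n)) by rewrite ler_wpM2l.
  have E0 : 0 <= Ex P (V1 n) by exact: Ex_ge0.
  have h4 : kappa * ((2 * kappa + 1)^-1 * Ex P (V1 n)) <= 2^-1 * Ex P (V1 n).
    rewrite mulrA ler_wpM2r// ler_pdivrMr//; lra.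
  by lra.
pose C := 2 * kappa * (A / b).
have C0 : 0 <= C by rewrite /C; have ? := ltW b0; nneg.
have sumV N : \sum_(n < N) Ex P (V1 n) <= C * (Ex P (hb 0%N) - Ex P (hb N)).
  elim: N => [|N IH]; first by rewrite big_ord0 subrr mulr0.
  by rewrite big_ord_recr/=; have := EV1 N; rewrite -/C; lra.
have := ae_summable P V1 (C * Ex P (hb 0%N)) V10 iV1 _.
have sumC N : \sum_(n < N) Ex P (V1 n) <= C * Ex P (hb 0%N).
  apply: le_trans (sumV N) _; apply: ler_wpM2l => //; rewrite gerBl; exact: Ex_ge0.
move=> /(_ sumC); apply: filterS => w [M hM].
have VE n : ind_ge (- de) (- gam n w) * q n w `^ (2 + rho) / S n w `^ (1 + rho / 2) = V1 n w.
  by rewrite /V1 /h mulrC.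
have -> : (fun n => ind_ge (- de) (- gam n w) * q n w `^ (2 + rho) / S n w `^ (1 + rho / 2)) =
    (fun n => V1 n w) by apply/funext.
exact: bounded_cauchy_series hM.
Qed.

End AlmostSure.

(** * AdaGrad-Norm runs *)

Section Conditional.
Context {R : realType} {dO : measure_display} {Omega : measurableType dO}.
Context (P : probability Omega R).
Implicit Types (H : set (set Omega)).

Lemma ewrt_measurable H (Z : Omega -> \bar R) : sub_sigma H ->
  measurable_wrt H Z -> measurable_fun [set: Omega] Z.
Proof. by move=> sH mZ _ B mB; rewrite setTI; apply: sH.2; exact: mZ. Qed.

(** Integrability of Y is part of the conclusion: the conditional expectation Z
   is almost surely below a bounded function. *)
Lemma condexp_ge0_le H (Y v : Omega -> R) (Z : Omega -> \bar R) : sub_sigma H ->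
  measurable_fun [set: Omega] Y -> cond_expectation_ge0 P H (fun w => (Y w)%:E) Z ->
  bmeas H v -> (forall w, 0 <= v w) -> {ae P, forall w, (Z w <= (v w)%:E)%E} ->
  integ P Y /\ forall A, H A -> Rintegral P A Y <= Rintegral P A v.
Proof.
move=> sH mY [Y0 Z0 mZ EZ] bv v0 Zv.
have mZ' := ewrt_measurable sH mZ.
have iv := bmeas_integ P sH bv.
have mv := integ_measurable _ _ iv.
have Yv A : H A -> (\int[P]_(w in A) (Y w)%:E <= \int[P]_(w in A) (v w)%:E)%E.
  move=> HA; rewrite -EZ//; have mA : measurable A by exact: sH.2.
  apply: ae_ge0_le_integral => //.
  - exact: measurable_funTS.
  - by move=> w _; rewrite lee_fin.
  - by apply/measurable_EFinP; exact: measurable_funTS.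
  - by move: Zv; apply: filterS => w ? _.
have HT : H setT by case: sH => -[H0 HC _] _; rewrite -(setD0 setT); exact: HC.
have Y0' w : 0 <= Y w by rewrite -lee_fin.
have iY : integ P Y.
  by apply: (integ_ge0 _ _ (Ex P v)%:E mY Y0' _ (ltry _)); rewrite ExE//; exact: Yv.
split=> // A HA; have mA : measurable A by exact: sH.2.
rewrite /Rintegral; apply: fine_le.
- by apply: integrable_fin_num => //; exact: integrableS iY.
- by apply: integrable_fin_num => //; exact: integrableS iv.
- exact: Yv.
Qed.

Lemma integ_sumI m (f : 'I_m -> Omega -> R) : (forall i, integ P (f i)) ->
  integ P (fun w => \sum_(i < m) f i w).
Proof.
move=> fi; have -> : (fun w => \sum_(i < m) f i w) = (fun w => \sum_(i <- enum 'I_m) f i w).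
  by apply/funext => w; rewrite big_enum.
elim: (enum _) => [|i s IH].
  by under eq_fun do rewrite big_nil; exact: integ_cst.
by under eq_fun do rewrite big_cons; exact: integD.
Qed.

Lemma Ex_sumI m (f : 'I_m -> Omega -> R) : (forall i, integ P (f i)) ->
  Ex P (fun w => \sum_(i < m) f i w) = \sum_(i < m) Ex P (f i).
Proof.
move=> fi; have -> : (fun w => \sum_(i < m) f i w) = (fun w => \sum_(i <- enum 'I_m) f i w).
  by apply/funext => w; rewrite big_enum.
rewrite -big_enum; elim: (enum _) => [|i s IH].
  by under eq_fun do rewrite big_nil; rewrite Ex_cst big_nil.
under eq_fun do rewrite big_cons; rewrite big_cons ExD ?IH//.
elim: s {IH} => [|j s IH].
  by under eq_fun do rewrite big_nil; exact: integ_cst.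
by under eq_fun do rewrite big_cons; exact: integD.
Qed.

End Conditional.

Section AdaGrad.
Context {R : realType} {d : nat} {dO : measure_display} {Omega : measurableType dO}.
Context (P : probability Omega R).
Context (F : nat -> set (set Omega)) (g : 'rV[R]_d -> R)
    (theta G : nat -> Omega -> 'rV[R]_d) (S : nat -> Omega -> R)
    (theta1 : 'rV[R]_d).

Lemma inf0_ge0 : bounded_below_inf0 g -> forall x, 0 <= g x.
Proof. by move=> [lb i0] x; rewrite -i0; apply: ge_inf => //; exists x. Qed.

Lemma smooth_growth (al L : R) (x h : 'rV[R]_d) : (forall y, differentiable g y) ->
  0 < L -> (forall y z, enorm (grad g y - grad g z) <= L * enorm (y - z)) ->
  (forall y, 0 <= g y) -> enorm h <= al ->
  1 + g (x + h) <= (2 + 2 * L * al ^+ 2) * (1 + g x).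
Proof.
move=> dg L0 hL g0 hal.
have T := smooth_taylor g L x h dg L0 hL.
have q := sqr_grad_le g L x dg L0 hL g0.
have D := dotp_le (grad g x) h.
have e0 := enorm_ge0 h.
have hh : enorm h ^+ 2 <= al ^+ 2 by apply: lerXn2r => //; rewrite nnegrE (le_trans e0).
have hl : L * enorm h ^+ 2 <= L * al ^+ 2 by rewrite ler_pM2l.
have : enorm (grad g x) * enorm h <= g x + L * enorm h ^+ 2.
  rewrite -(ler_pM2l (mulr_gt0 (ltr0n R 4 : 0 < 4) L0)).
  by have := sqr_ge0 (enorm (grad g x) - 2 * L * enorm h); nra.
move: T; rewrite ler_norml => /andP[_ T] h1.
have ga : 0 <= L * al ^+ 2 * g x by have ? := g0 x; nneg.
by lra.
Qed.

Lemma smooth_bounded_on_ball (L r : R) x : (forall y, differentiable g y) ->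
  0 < L -> (forall y z, enorm (grad g y - grad g z) <= L * enorm (y - z)) ->
  enorm x <= r -> g x <= g 0 + enorm (grad g 0) * r + L * r ^+ 2.
Proof.
move=> dg L0 hL xr; have := smooth_taylor g L 0 x dg L0 hL.
rewrite add0r ler_norml => /andP[_ T].
have D : dotp (grad g 0) x <= enorm (grad g 0) * r.
  by apply: le_trans (dotp_le _ _) _; rewrite ler_wpM2l ?enorm_ge0.
have : L * enorm x ^+ 2 <= L * r ^+ 2.
  by rewrite ler_pM2l// lerXn2r// ?nnegrE ?enorm_ge0// (le_trans (enorm_ge0 x)).
by lra.
Qed.

Lemma filtration_sub_sigma : filtration F -> forall n, sub_sigma (F n).
Proof. by move=> [s m _] n. Qed.

Lemma filtrationS : filtration F -> forall n, F n `<=` F n.+1.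
Proof. by move=> [_ _ m] n; exact: m. Qed.

Lemma adagrad_S_gt0 (al S0 : R) : 0 < S0 -> adagrad_norm theta G S al S0 theta1 ->
  forall n w, 0 < S n w.
Proof.
move=> S00 [h0 _ hS _]; elim=> [|n IH] w; first by rewrite h0.
by rewrite hS ltr_wpDr ?sqr_ge0.
Qed.

Lemma adagrad_step_le (al S0 : R) : 0 < al -> 0 < S0 ->
  adagrad_norm theta G S al S0 theta1 ->
  forall n w, enorm ((al / Num.sqrt (S n.+1 w)) *: G n.+1 w) <= al.
Proof.
move=> al0 S00 hr n w; have S_0 := adagrad_S_gt0 S00 hr; case: hr => _ _ hS _.
have u0 : 0 < Num.sqrt (S n.+1 w) by rewrite sqrtr_gt0.
rewrite enormZ gtr0_norm ?divr_gt0// mulrAC ler_pdivrMr// ler_pM2l//.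
apply: le_of_sqr; first exact: ltW.
by rewrite (sqr_sqrtr (ltW (S_0 n.+1 w))) hS lerDr ltW.
Qed.

Lemma adagrad_theta_bounded (al S0 : R) : 0 < al -> 0 < S0 ->
  adagrad_norm theta G S al S0 theta1 ->
  forall n w, enorm (theta n.+1 w) <= enorm theta1 + n%:R * al.
Proof.
move=> al0 S00 hr n w; have st := adagrad_step_le al0 S00 hr.
case: hr => _ h1 _ hth; elim: n => [|n IH]; first by rewrite h1 mul0r addr0.
rewrite hth; apply: le_trans (ler_enormD _ _) _; rewrite enormN -natr1 mulrDl mul1r addrA.
exact: lerD.
Qed.

Lemma adagrad_one_step (al L S0 : R) : (forall y, differentiable g y) ->
  0 < al -> 0 < L ->
  (forall y z, enorm (grad g y - grad g z) <= L * enorm (y - z)) ->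
  (forall y, 0 <= g y) -> 0 < S0 -> adagrad_norm theta G S al S0 theta1 ->
  forall n w, one_step al L (2 + 2 * L * al ^+ 2) (Num.sqrt (S n w)) (Num.sqrt (S n.+1 w))
    (enorm (G n.+1 w)) (dotp (grad g (theta n.+1 w)) (G n.+1 w))
    (enorm (grad g (theta n.+1 w))) (1 + g (theta n.+1 w)) (1 + g (theta n.+2 w)).
Proof.
move=> dg al0 L0 hL g0 S00 hr n w.
have st := adagrad_step_le al0 S00 hr n w.
have S_0 := adagrad_S_gt0 S00 hr; case: hr => _ _ hS hth.
have u0 : 0 < Num.sqrt (S n.+1 w) by rewrite sqrtr_gt0.
have eth : theta n.+2 w = theta n.+1 w + (- (al / Num.sqrt (S n.+1 w))) *: G n.+1 w.
  by rewrite hth scaleNr.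
have eth' : theta n.+1 w = theta n.+2 w + (al / Num.sqrt (S n.+1 w)) *: G n.+1 w.
  by rewrite eth -addrA -scalerDl addNr scale0r addr0.
split; rewrite ?sqrtr_gt0 ?enorm_ge0 ?lerDl//.
- by rewrite (sqr_sqrtr (ltW (S_0 n.+1 w))) (sqr_sqrtr (ltW (S_0 n w))) hS.
- have := sqr_grad_le g L (theta n.+1 w) dg L0 hL g0; have := mulr_gt0 (ltr0n R 4 : 0 < 4) L0.
  by rewrite mulrDr mulr1; lra.
- exact: ler_norm_dotp.
- by rewrite [in leLHS]eth'; apply: smooth_growth.
- by rewrite eth; apply: smooth_growth => //; rewrite scaleNr enormN.
- have := smooth_taylor g L (theta n.+1 w) ((- (al / Num.sqrt (S n.+1 w))) *: G n.+1 w) dg L0 hL.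
  rewrite -eth dotpZr enormZ normrN (gtr0_norm (divr_gt0 al0 u0)).
  have -> : 1 + g (theta n.+2 w) - (1 + g (theta n.+1 w)) + al *
      (dotp (grad g (theta n.+1 w)) (G n.+1 w) / Num.sqrt (S n.+1 w)) =
    g (theta n.+2 w) - g (theta n.+1 w) -
      - (al / Num.sqrt (S n.+1 w)) * dotp (grad g (theta n.+1 w)) (G n.+1 w) by ring.
  have -> : L * (al / Num.sqrt (S n.+1 w) * enorm (G n.+1 w)) ^+ 2 =
     L * al ^+ 2 * (enorm (G n.+1 w) / Num.sqrt (S n.+1 w)) ^+ 2 by ring.
  by [].
Qed.

End AdaGrad.

Section AdaGradRun.
Context {R : realType} {d : nat} {dO : measure_display} {Omega : measurableType dO}.
Context (P : probability Omega R).
Context (F : nat -> set (set Omega)) (g : 'rV[R]_d -> R)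
    (theta G : nat -> Omega -> 'rV[R]_d) (S : nat -> Omega -> R)
    (theta1 : 'rV[R]_d).

Lemma Ex_weight_condexp H (Y Z h : Omega -> R) : sub_sigma H ->
  cond_expectation P H Y Z -> bmeas H h ->
  Ex P (fun w => h w * Y w) = Ex P (fun w => h w * Z w).
Proof.
move=> sH [iY iZ mZ EZ] [mh [C hC]].
apply: (Ex_weight_eq P H Y Z sH iY iZ _ C h mh hC) => A HA.
by rewrite /Rintegral -EZ.
Qed.

Lemma grad_coord_continuous : continuous (grad g) ->
  forall i, continuous (fun x => grad g x ord0 i).
Proof.
move=> cg i x; apply: (@continuous_comp _ _ _ (grad g) (fun y : 'rV[R]_d => y ord0 i)).
  exact: cg.
exact: coord_continuous.
Qed.

Lemma enorm_grad_continuous : continuous (grad g) ->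
  continuous (fun x => enorm (grad g x)).
Proof.
move=> cg x; apply: (@continuous_comp _ _ _ (grad g) (@enorm R d)).
  exact: cg.
exact: continuous_enorm.
Qed.

(** A step has length at most al, so theta at a fixed time stays in a ball of
   deterministic radius; hence g and its gradient are bounded there. *)
Lemma bmeas_grad_coord (al S0 : R) : continuously_differentiable g ->
  globally_smooth g -> (forall y, 0 <= g y) ->
  filtration F -> adagrad_measurability F theta G S -> 0 < al -> 0 < S0 ->
  adagrad_norm theta G S al S0 theta1 ->
  [/\ forall n, bmeas (F n) (fun w => g (theta n.+1 w)),
      forall n, bmeas (F n) (fun w => enorm (grad g (theta n.+1 w))),
      forall n i, bmeas (F n) (fun w => grad g (theta n.+1 w) ord0 i),
      forall n, Hmeas (F n.+1) (fun w => enorm (G n.+1 w)) &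
      forall n i, Hmeas (F n.+1) (fun w => G n.+1 w ord0 i)].
Proof.
move=> [dg cg] [L L0 hL] g0 hF hm al0 S00 hr.
have sF := filtration_sub_sigma hF.
have thB := adagrad_theta_bounded al0 S00 hr.
have bg n : bmeas (F n) (fun w => g (theta n.+1 w)).
  have [mth _ _] := hm n; split.
    apply: (Hmeas_continuous _ _ _ _ (sF n) _ mth) => x.
    exact: differentiable_continuous.
  exists (g 0 + enorm (grad g 0) * (enorm theta1 + n%:R * al) + L * (enorm theta1 + n%:R * al) ^+ 2).
  by move=> w; rewrite ger0_norm//; apply: smooth_bounded_on_ball.
have bgam n : bmeas (F n) (fun w => enorm (grad g (theta n.+1 w))).
  have [mth _ _] := hm n; split.
    exact: (Hmeas_continuous _ _ (fun x => enorm (grad g x)) _ (sF n) (enorm_grad_continuous cg) mth).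
  have [_ [C hC]] := bg n; exists (4 * L * C + 1) => w.
  rewrite ger0_norm ?enorm_ge0//.
  have := sqr_grad_le g L (theta n.+1 w) dg L0 hL g0.
  have : 4 * L * g (theta n.+1 w) <= 4 * L * C.
    by rewrite ler_pM2l ?mulr_gt0// (le_trans (ler_norm _)).
  have := enorm_ge0 (grad g (theta n.+1 w)); move: (enorm _) => u.
  by have := sqr_ge0 (u - 1); nra.
split=> // [n i|n|n i].
- have [mth _ _] := hm n; split.
    exact: (Hmeas_continuous _ _ (fun x : 'rV[R]_d => grad g x ord0 i) _ (sF n) (grad_coord_continuous cg (i := i)) mth).
  have [_ [C hC]] := bgam n; exists C => w; apply: le_trans (coord_le_enorm _ _) _.
  exact: le_trans (ler_norm _) (hC w).
- have [_ _ mG] := hm n.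
  exact: (Hmeas_continuous _ _ (@enorm R d) _ (sF n.+1) (@continuous_enorm R d) mG).
- have [_ _ mG] := hm n.
  apply: (Hmeas_continuous _ _ (fun x : 'rV[R]_d => x ord0 i) _ (sF n.+1) _ mG).
  exact: coord_continuous.
Qed.

Lemma adagrad_scalar_run (al L S0 beta sigma : R) : continuously_differentiable g ->
  0 < L -> (forall y z, enorm (grad g y - grad g z) <= L * enorm (y - z)) ->
  (forall y, 0 <= g y) -> filtration F -> adagrad_measurability F theta G S ->
  0 < al -> 0 < S0 -> adagrad_norm theta G S al S0 theta1 ->
  conditionally_unbiased P g F theta G -> 0 <= beta ->
  (forall n, exists2 Z : Omega -> \bar R,
      cond_expectation_ge0 P (F n) (fun w => (enorm (G n.+1 w) ^+ 2)%:E) Z &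
      {ae P, forall w,
        (Z w <= (beta * enorm (grad g (theta n.+1 w)) ^+ 2 + sigma ^+ 2)%:E)%E}) ->
  scalar_run P F (fun n w => 1 + g (theta n.+1 w)) (fun n w => enorm (G n.+1 w))
    (fun n w => dotp (grad g (theta n.+1 w)) (G n.+1 w))
    (fun n w => enorm (grad g (theta n.+1 w))) S
    al L (2 + 2 * L * al ^+ 2) beta (sigma ^+ 2) S0.
Proof.
move=> hg L0 hL g0 hF hm al0 S00 hr hu beta0 haff.
have gs : globally_smooth g by exists L.
have [bg bgam bgrad mq mG] := bmeas_grad_coord hg gs g0 hF hm al0 S00 hr.
have sF := filtration_sub_sigma hF; have FS := filtrationS hF.
pose v n w := beta * enorm (grad g (theta n.+1 w)) ^+ 2 + sigma ^+ 2.
have bv n : bmeas (F n) (v n).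
  by apply: bmeasD (bmeas_cst _ _); apply: bmeasM (bmeas_cst _ _) _; exact: bmeasX.
have v0 n w : 0 <= v n w by rewrite /v; nneg.
have mq2 n : measurable_fun [set: Omega] (fun w => enorm (G n.+1 w) ^+ 2).
  by apply: measurable_funX; exact: (Hmeas_measurable _ _ (sF n.+1) (mq n)).
have [iq2 Eq2] : (forall n, integ P (fun w => enorm (G n.+1 w) ^+ 2)) /\
    forall n A, F n A -> Rintegral P A (fun w => enorm (G n.+1 w) ^+ 2) <= Rintegral P A (v n).
  by split=> n; have [Z hZ Zv] := haff n;
    have [] := condexp_ge0_le (sF n) (mq2 n) hZ (bv n) (v0 n) Zv.
have iGi n i : integ P (fun w => G n.+1 w ord0 i) by have [] := hu n i.
have md n : Hmeas (F n.+1) (fun w => dotp (grad g (theta n.+1 w)) (G n.+1 w)).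
  apply: Hmeas_sumI => i; apply: HmeasM => //.
  exact: HmeasW (sF n) (sF n.+1) (FS n) (bgrad n i).1.
have igG n i : integ P (fun w => grad g (theta n.+1 w) ord0 i * G n.+1 w ord0 i).
  exact: bmeas_integM (sF n) (bgrad n i) (iGi n i).
split=> //.
- have : 0 <= 2 * L * al ^+ 2 by nneg.
  by lra.
- exact: sqr_ge0.
- by move=> n; apply: bmeasD (bmeas_cst _ _) _.
- move=> n; have [_ mS _] := hm n; exact: HmeasP.
- by case: hr.
- by case: hr.
- by case: hg => dg _; exact: (adagrad_one_step dg al0 L0 hL g0 S00 hr).
- by move=> n; exact: integ_sumI.
- move=> n h bh.
  have e1 w : h w * dotp (grad g (theta n.+1 w)) (G n.+1 w) =
      \sum_(i < d) (h w * grad g (theta n.+1 w) ord0 i) * G n.+1 w ord0 i.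
    by rewrite mulr_sumr; apply: eq_bigr => i _; rewrite mulrA.
  have e2 w : h w * enorm (grad g (theta n.+1 w)) ^+ 2 =
      \sum_(i < d) (h w * grad g (theta n.+1 w) ord0 i) * grad g (theta n.+1 w) ord0 i.
    by rewrite -dotpxx mulr_sumr; apply: eq_bigr => i _; rewrite mulrA.
  under eq_fun do rewrite e1; under [in RHS]eq_fun do rewrite e2.
  rewrite !Ex_sumI.
  + apply: eq_bigr => i _; apply: (Ex_weight_condexp (sF n) (hu n i)).
    exact: bmeasM.
  + move=> i; apply: bmeas_integ (sF n) _; apply: bmeasM => //; exact: bmeasM.
  + move=> i; apply: bmeas_integM (sF n) _ (iGi n i); exact: bmeasM.
- move=> n h [mh [C hC]] h0.
  apply: (Ex_weight_le P (F n) _ _ (sF n) (iq2 n) (bmeas_integ P (sF n) (bv n)) (Eq2 n) C h mh).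
  by move=> w; rewrite h0 (le_trans (ler_norm _)).
Qed.

End AdaGradRun.

(** * Boundedness and convergence of AdaGrad-Norm *)

Section Main.
Context {R : realType} {d : nat} {dO : measure_display} {Omega : measurableType dO}.
Context (P : probability Omega R).
Context (F : nat -> set (set Omega)) (g : 'rV[R]_d -> R)
    (theta G : nat -> Omega -> 'rV[R]_d) (S : nat -> Omega -> R)
    (theta1 : 'rV[R]_d).

Lemma image_ge1 (T : Type) (f : nat -> T) :
  [set f n | n in [set n | (1 <= n)%N]] = range (fun n => f n.+1).
Proof.
apply/seteqP; split => [_ [[|n] //= _ <-]|_ [n _ <-]]; first by exists n.
by exists n.+1.
Qed.

(** The event gam <= de belongs to H, so the almost sure inequality between the
   conditional moments can be integrated over its intersection with any event
   of H.  The absolute value of kappa lets the constant be pulled out of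
   integrals of nonnegative functions. *)
Lemma weighted_relative_moment (de rho kappa : R) (Zrho Z2 : Omega -> \bar R)
    (gam q : Omega -> R) (H : set (set Omega)) :
  sub_sigma H -> Hmeas H gam -> measurable_fun [set: Omega] q ->
  integ P (fun w => q w ^+ 2) ->
  cond_expectation_ge0 P H (fun w => (q w `^ (2 + rho))%:E) Zrho ->
  cond_expectation_ge0 P H (fun w => (q w ^+ 2)%:E) Z2 ->
  {ae P, forall w, ((\1_[set w | gam w <= de] w)%:E * Zrho w <=
      kappa%:E * ((\1_[set w | gam w <= de] w)%:E * Z2 w))%E} ->
  integ P (fun w => ind_ge (- de) (- gam w) * q w `^ (2 + rho)) /\
  forall h, bmeas H h -> (forall w, 0 <= h w) ->
    Ex P (fun w => h w * (ind_ge (- de) (- gam w) * q w `^ (2 + rho))) <=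
    `|kappa| * Ex P (fun w => h w * (ind_ge (- de) (- gam w) * q w ^+ 2)).
Proof.
move=> sH mgam mq iq2 [Yr0 Zr0 mZr EZr] [Y20 Z20 mZ2 EZ2] hae.
pose I w := ind_ge (- de) (- gam w).
pose Lset := [set w | gam w <= de].
have IE w : I w = \1_Lset w.
  by rewrite /I /ind_ge lerN2 indicE /Lset; case: ifPn => h; [rewrite mem_set|rewrite memNset//; apply/negP].
have HL : H Lset.
  have -> : Lset = gam @^-1` `]-oo, de]%classic.
    by apply/seteqP; split => w /=; rewrite in_itv.
  by apply: (Hmeas_preimage _ _ _ sH mgam); exact: measurable_itv.
have bI : bmeas H I.
  apply: bmeas_ind_ge; have -> : (fun w => - gam w) = (fun w => 0 - gam w).
    by apply/funext => w; rewrite sub0r.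
  by apply: HmeasB; [exact: Hmeas_cst|].
have HI A B : H A -> H B -> H (A `&` B).
  case: sH => sig _ HA HB; rewrite -(measurable_g_measurableTypeE sig).
  by apply: measurableI; rewrite measurable_g_measurableTypeE.
have I_int A (f : Omega -> R) :
    (\int[P]_(w in A) (I w * f w)%:E = \int[P]_(w in A `&` Lset) (f w)%:E)%E.
  rewrite integral_mkcondr; apply: eq_integral => w _.
  by rewrite IE patchE indicE; case: ifP => _; rewrite ?mul1r ?mul0r.
have iIq : integ P (fun w => I w * q w ^+ 2) by exact: bmeas_integM bI iq2.
have iV : integ P (fun w => `|kappa| * (I w * q w ^+ 2)) by exact: integZ.
have mqr : measurable_fun [set: Omega] (fun w => I w * q w `^ (2 + rho)).
  apply: measurable_funM; first exact: Hmeas_measurable bI.1.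
  exact: (measurableT_comp (measurable_powR _) mq).
have le A : H A -> (\int[P]_(w in A) (I w * q w `^ (2 + rho))%:E <=
    \int[P]_(w in A) (`|kappa| * (I w * q w ^+ 2))%:E)%E.
  move=> HA; have HAL := HI _ _ HA HL; have mAL : measurable (A `&` Lset) by exact: sH.2.
  have -> : (\int[P]_(w in A) (`|kappa| * (I w * q w ^+ 2))%:E =
      \int[P]_(w in A) (I w * (`|kappa| * q w ^+ 2))%:E)%E.
    by apply: eq_integral => w _; congr (_%:E); ring.
  rewrite !I_int -EZr//.
  under [leRHS]eq_integral do rewrite EFinM.
  rewrite ge0_integralZl//; last first.
    by apply/measurable_EFinP; apply: measurable_funTS; exact: measurable_funX.
  rewrite -EZ2// -ge0_integralZl//; last exact: measurable_funTS (ewrt_measurable sH mZ2).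
  apply: ae_ge0_le_integral => //.
  - exact: measurable_funTS (ewrt_measurable sH mZr).
  - by move=> w _; rewrite mule_ge0.
  - by apply: emeasurable_funM => //; exact: measurable_funTS (ewrt_measurable sH mZ2).
  - move: hae; apply: filterS => w hw [_ wL].
    move: hw; rewrite indicE mem_set// !mul1e => /le_trans; apply.
    by apply: lee_wpmul2r => //; rewrite lee_fin ler_norm.
have HT : H setT by case: sH => -[H0 HC _] _; rewrite -(setD0 setT); exact: HC.
have I0 w : 0 <= I w by have /andP[] := ind_ge01 (- de) (- gam w).
have iU : integ P (fun w => I w * q w `^ (2 + rho)).
  apply: (integ_ge0 _ _ (Ex P (fun w => `|kappa| * (I w * q w ^+ 2)))%:E mqr _ _ (ltry _)).
    by move=> w; rewrite mulr_ge0// powR_ge0.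
  by rewrite ExE//; exact: le.
split=> // h [mh [C hC]] h0.
rewrite -ExZ//; last by apply: bmeas_integM sH _ iIq; split => //; exists C.
have -> : (fun w => `|kappa| * (h w * (ind_ge (- de) (- gam w) * q w ^+ 2))) =
    (fun w => h w * (`|kappa| * (I w * q w ^+ 2))).
  by apply/funext => w; rewrite mulrCA.
apply: (Ex_weight_le P H _ _ sH iU iV _ C h mh) => [A HA|w]; last first.
  by rewrite h0 (le_trans (ler_norm _)).
have mA : measurable A by exact: sH.2.
rewrite /Rintegral; apply: fine_le.
- by apply: integrable_fin_num => //; exact: integrableS iU.
- by apply: integrable_fin_num => //; exact: integrableS iV.
- exact: le.
Qed.

(** The supremum of the objective being almost surely finite confines the
   trajectory to a ball; the steps become negligible because q^2 / S tends to 0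
   both where the gradient is large, by the noise energy, and where it is small,
   by the relative-moment condition. *)
Lemma ae_gradient_vanishes (al L S0 beta sigma k : R) :
  continuously_differentiable g ->
  0 < L -> (forall y z, enorm (grad g y - grad g z) <= L * enorm (y - z)) ->
  (forall y, 0 <= g y) -> filtration F -> adagrad_measurability F theta G S ->
  0 < al -> 0 < S0 -> adagrad_norm theta G S al S0 theta1 ->
  conditionally_unbiased P g F theta G -> weak_Sard g ->
  scalar_run P F (fun n w => 1 + g (theta n.+1 w)) (fun n w => enorm (G n.+1 w))
    (fun n w => dotp (grad g (theta n.+1 w)) (G n.+1 w))
    (fun n w => enorm (grad g (theta n.+1 w))) S
    al L (2 + 2 * L * al ^+ 2) beta (sigma ^+ 2) S0 ->
  local_relative_moment P g F theta G ->
  0 <= k -> (forall x, enorm x <= k * (1 + g x)) ->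
  {ae P, forall w, (ereal_sup (range (fun n => (1 + g (theta n.+1 w))%:E)) < +oo)%E} ->
  {ae P, forall w, forall e : R, 0 < e -> exists N, forall n, (N <= n)%N ->
     enorm (grad g (theta n.+1 w)) <= e}.
Proof.
move=> hg L0 hL g0 hF hm al0 S00 hr hu sard run rel k0 hk supX.
have gs : globally_smooth g by exists L.
have [bg bgam bgrad mq mG] := bmeas_grad_coord hg gs g0 hF hm al0 S00 hr.
have sF := filtration_sub_sigma hF; have FS := filtrationS hF.
have S_0 := adagrad_S_gt0 S00 hr.
have iGi n i : integ P (fun w => G n.+1 w ord0 i) by have [] := hu n i.
have X1 n w : 1 <= 1 + g (theta n.+1 w) by rewrite lerDl.
have invj (j : nat) : 0 < j.+1%:R^-1 :> R by rewrite invr_gt0.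
have Xsq n w : 1 <= (1 + g (theta n.+1 w)) ^+ 2 by exact: exprn_ege1.
have H1 := ae_grad_energy run.
have H2 : {ae P, forall w, forall j : nat, cauchy_series (fun n =>
     ind_ge j.+1%:R^-1 (enorm (grad g (theta n.+1 w))) * (enorm (G n.+1 w) ^+ 2 / S n w))}.
  by apply/ae_foralln => j; exact: ae_noise_energy (invj j) run.
have H3 : {ae P, forall w, forall j : nat, cauchy_series (fun n =>
     ind_ge j.+1%:R^-1 (enorm (grad g (theta n.+1 w))) *
       (dotp (grad g (theta n.+1 w)) (G n.+1 w) - enorm (grad g (theta n.+1 w)) ^+ 2) /
       Num.sqrt (S n w))}.
  apply/ae_foralln => j.
  apply: (@ae_noise_cauchy _ _ _ P _ _ _ _ _ _ _ _ _ _ _ _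
    (fun n w => dotp (grad g (theta n.+1 w)) (G n.+1 w) - enorm (grad g (theta n.+1 w)) ^+ 2)
    _ (8 * L) (invj j) _ run) => [|n|n w|n h bh].
  - by nneg.
  - apply: HmeasB; first exact: sr_md run n.
    by apply: HmeasX; exact: HmeasW (sF n) (sF n.+1) (FS n) (bgam n).1.
  - have s := sr_step run n w; have x1 := X1 n w.
    set gam := enorm (grad g (theta n.+1 w)); set q := enorm (G n.+1 w).
    set dd := dotp _ _; set X := 1 + g (theta n.+1 w) in x1 *.
    have hd : `|dd| <= gam * q := os_d s; have hX : gam ^+ 2 <= 4 * L * X := os_gamX s.
    have q0 : 0 <= q := os_q s; have g0' : 0 <= gam := os_gam s.
    have d2 : dd ^+ 2 <= gam ^+ 2 * q ^+ 2.
      rewrite -exprMn -[X in X <= _]real_normK ?num_real//.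
      by apply: lerXn2r => //; rewrite nnegrE mulr_ge0.
    have gX2 : gam ^+ 2 <= 4 * L * X ^+ 2.
      apply: le_trans hX _; rewrite ler_pM2l ?mulr_gt0// expr2 ler_peMl//.
      exact: le_trans x1.
    apply: (@le_trans _ _ (2 * (gam ^+ 2 * (q ^+ 2 + gam ^+ 2)))).
      by have := sqr_ge0 (dd + gam ^+ 2); nra.
    have -> : 8 * L * (X ^+ 2 * (q ^+ 2 + gam ^+ 2)) = 2 * (4 * L * X ^+ 2 * (q ^+ 2 + gam ^+ 2)) by ring.
    by rewrite ler_pM2l// ler_wpM2r// addr_ge0 ?sqr_ge0.
  - under eq_fun do rewrite mulrBr.
    rewrite ExB; last 2 first.
    + exact: bmeas_integM (sF n) bh (sr_id run n).
    + by apply: bmeas_integ (sF n) _; apply: bmeasM => //; exact: bmeasX.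
    by rewrite (sr_Ed run bh) subrr.
have H4 : {ae P, forall w, forall (j : nat) (i : 'I_d), cauchy_series (fun n =>
     ind_ge j.+1%:R^-1 (enorm (grad g (theta n.+1 w))) *
       (G n.+1 w ord0 i - grad g (theta n.+1 w) ord0 i) / Num.sqrt (S n w))}.
  apply/ae_foralln => j; apply: filter_forall => i.
  apply: (@ae_noise_cauchy _ _ _ P _ _ _ _ _ _ _ _ _ _ _ _
    (fun n w => G n.+1 w ord0 i - grad g (theta n.+1 w) ord0 i)
    _ 2 (invj j) _ run) => [|n|n w|n h bh].
  - by [].
  - apply: HmeasB; first exact: mG.
    exact: HmeasW (sF n) (sF n.+1) (FS n) (bgrad n i).1.
  - have a1 : G n.+1 w ord0 i ^+ 2 <= enorm (G n.+1 w) ^+ 2.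
      by rewrite -real_normK ?num_real// lerXn2r ?nnegrE ?enorm_ge0// coord_le_enorm.
    have a2 : grad g (theta n.+1 w) ord0 i ^+ 2 <= enorm (grad g (theta n.+1 w)) ^+ 2.
      by rewrite -real_normK ?num_real// lerXn2r ?nnegrE ?enorm_ge0// coord_le_enorm.
    apply: (@le_trans _ _ (2 * (enorm (G n.+1 w) ^+ 2 + enorm (grad g (theta n.+1 w)) ^+ 2))).
      by have := sqr_ge0 (G n.+1 w ord0 i + grad g (theta n.+1 w) ord0 i); nra.
    by rewrite ler_pM2l// ler_peMl// addr_ge0 ?sqr_ge0.
  - under eq_fun do rewrite mulrBr.
    rewrite ExB; last 2 first.
    + exact: bmeas_integM (sF n) bh (iGi n i).
    + by apply: bmeas_integ (sF n) _; apply: bmeasM.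
    by rewrite (Ex_weight_condexp (sF n) (hu n i) bh) subrr.
have [de [rho [kappa [de0 rho0 [Zrho [Z2 [hZr hZ2 hae]]]]]]] := rel.
have hae_n n : {ae P, forall w,
    ((\1_(small_gradient_event g theta de n.+1) w)%:E * Zrho n w <=
     kappa%:E * ((\1_(small_gradient_event g theta de n.+1) w)%:E * Z2 n w))%E}.
  by move: hae; apply: filterS => w.
have relE n := @weighted_relative_moment de rho kappa (Zrho n) (Z2 n)
  (fun w => enorm (grad g (theta n.+1 w))) (fun w => enorm (G n.+1 w)) (F n) (sF n)
  (bgam n).1 (Hmeas_measurable _ _ (sF n.+1) (mq n)) (sr_iq run n) (hZr n) (hZ2 n) (hae_n n).
have H5 := ae_small_gradient_noise rho0 (normr_ge0 kappa) run
  (fun n => (relE n).1) (fun n => (relE n).2).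
have [j hj] : exists j : nat, j.+1%:R^-1 <= de.
  by exists (Num.truncn de^-1); rewrite invf_ple ?posrE// ltW// truncnS_gt.
move: H5; apply: filter_app; move: H4; apply: filter_app; move: H3; apply: filter_app.
move: H2; apply: filter_app; move: H1; apply: filter_app.
move: supX; apply: filterS => w sw h1 h2 h3 h4 h5.
have [M hM] : exists M : R, forall n, 1 + g (theta n.+1 w) <= M.
  move: sw; case E : (ereal_sup _) => [M||]//= _.
    by exists M => n; rewrite -lee_fin -E; apply: ereal_sup_ubound; exists n.
  have : ((1 + g (theta 1 w))%:E <= -oo)%E by rewrite -E; apply: ereal_sup_ubound; exists 0%N.
  by [].
have M1 : 1 <= M by exact: le_trans (X1 0%N w) (hM 0%N).
have kM : 0 <= k * M by rewrite mulr_ge0// (le_trans ler01).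
case: hg => dg cg.
apply: (@trajectory_gradient_vanishes R d g (fun n => theta n.+1 w) (fun n => G n.+1 w)
  (fun n => S n w) al L (2 + 2 * L * al ^+ 2) ((k + 1) * M)) => //.
- by move=> n; case: hr.
- by move=> n; case: hr.
- by move=> n; exact: sr_step run n w.
- move=> n; apply: le_trans (hk _) _; apply: (@le_trans _ _ (k * M)).
    by rewrite ler_wpM2l.
  by rewrite mulrDl mul1r; lra.
- by move=> n; have := hM n; rewrite mulrDl mul1r; lra.
move=> e e0.
have [N1 hN1] := cauchy_series_cvg0 (h2 j) e0.
have e1 : 0 < e `^ (1 + rho / 2) by exact: powR_gt0.
have [N2 hN2] := cauchy_series_cvg0 h5 e1.
exists (maxn N1 N2) => n; rewrite geq_max => /andP[n1 n2].
have s0 := S_0 n w.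
(* large gradients are covered by the noise energy, small ones by the
   relative-moment condition *)
have [hg1|hg1] := leP j.+1%:R^-1 (enorm (grad g (theta n.+1 w))).
  by have := hN1 n n1; rewrite /ind_ge hg1 mul1r.
have := hN2 n n2; rewrite /ind_ge lerN2 (ltW (lt_le_trans hg1 hj)) mul1r.
set x := enorm (G n.+1 w).
have x0 : 0 <= x by exact: enorm_ge0.
have xS0 : 0 <= x ^+ 2 / S n w by rewrite divr_ge0 ?sqr_ge0// ltW.
have -> : x `^ (2 + rho) / S n w `^ (1 + rho / 2) = (x ^+ 2 / S n w) `^ (1 + rho / 2).
  have -> : 2 + rho = 2 * (1 + rho / 2) by field.
  rewrite powRM ?sqr_ge0 ?invr_ge0 ?(ltW s0)// powRrM powR_mulrn//; congr (_ * _).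
  by rewrite -[X in _ = X `^ _]powR_inv1 ?(ltW s0)// -powRrM mulN1r powRN.
rewrite !ger0_norm ?powR_ge0//.
have r0 : 0 < 1 + rho / 2 by have := divr_gt0 rho0 (ltr0n R 2 : 0 < 2); lra.
rewrite leNgt => /negP h; rewrite leNgt; apply/negP => ex; apply: h.
by apply: gt0_ltr_powR; rewrite ?nnegrE ?(ltW e0).
Qed.

End Main.

Theorem theorem1 (R : realType) (d : nat) (dO : measure_display)
    (Omega : measurableType dO) (P : probability Omega R)
    (F : nat -> set (set Omega)) (g : 'rV[R]_d -> R)
    (theta G : nat -> Omega -> 'rV[R]_d) (S : nat -> Omega -> R)
    (theta1 : 'rV[R]_d) (S0 alpha0 : R)
    (hg : continuously_differentiable g)
    (hg0 : bounded_below_inf0 g)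
    (hF : filtration F)
    (hmeas : adagrad_measurability F theta G S)
    (hS0 : 0 < S0) (halpha0 : 0 < alpha0)
    (hrec : adagrad_norm theta G S alpha0 S0 theta1)
    (hsmooth : globally_smooth g)
    (hnonflat : nonflat_at_infinity g)
    (hunbiased : conditionally_unbiased P g F theta G)
    (haffine : affine_second_moment P g F theta G) :
  [/\ (\int[P]_w ereal_sup [set (g (theta n w))%:E | n in [set n | (1 <= n)%N]]
         < +oo)%E,
      (\int[P]_w
         ereal_sup [set (enorm (theta n w))%:E | n in [set n | (1 <= n)%N]]
         < +oo)%E /\
      {ae P, forall w,
         (ereal_sup [set (enorm (theta n w))%:E | n in [set n | (1 <= n)%N]]
            < +oo)%E} &
      local_relative_moment P g F theta G -> weak_Sard g ->
      {ae P, forall w, enorm (grad g (theta n w)) @[n --> \oo] --> (0 : R)} /\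
      ('E_P[fun w => (enorm (grad g (theta n w)) ^+ 2 : R)%R])%E @[n --> \oo]
        --> (0 : \bar R)%E].
Proof.
have [L L0 hL] := hsmooth.
have [beta [sigma [beta0 sigma0 haff]]] := haffine.
have [dg cg] := hg.
have g0 := inf0_ge0 hg0.
have run := adagrad_scalar_run hg L0 hL g0 hF hmeas halpha0 hS0 hrec hunbiased beta0 haff.
have [bg bgam bgrad mq mG] := bmeas_grad_coord hg hsmooth g0 hF hmeas halpha0 hS0 hrec.
have sF := filtration_sub_sigma hF.
have [r [e [e0 he]]] := nonflat_at_infinityP g hnonflat.
pose X n w := 1 + g (theta n.+1 w).
have X1 n w : 1 <= X n w by rewrite lerDl.
have X0 n w : 0 <= X n w by exact: le_trans (X1 n w).
(* above this level of g the point lies outside the ball of radius |r|, where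
   the gradient is bounded below *)
have [C hC] : exists C : R, (\int[P]_w ereal_sup (range (fun n => (X n w)%:E)) <= C%:E)%E.
  apply: (integral_sup_X (M0 := 2 + (g 0 + enorm (grad g 0) * `|r| + L * `|r| ^+ 2)) e0 run).
  move=> n w; rewrite leNgt => /negP hX; apply: he; rewrite leNgt; apply/negP => xr; apply: hX.
  have := smooth_bounded_on_ball dg L0 hL (ltW (lt_le_trans xr (ler_norm _))).
  by lra.
have mX n : measurable_fun [set: Omega] (X n).
  exact: (Hmeas_measurable _ _ (sF n) (sr_mX run n).1).
have supX0 w : (0 <= ereal_sup (range (fun n => (X n w)%:E)))%E by exact: sup_range_ge0.
have msupX := measurable_sup_range _ mX.
have supXy : (\int[P]_w ereal_sup (range (fun n => (X n w)%:E)) < +oo)%E.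
  exact: le_lt_trans hC (ltry _).
pose k := `|r| + 2 / e.
have k0 : 0 <= k by rewrite addr_ge0// divr_ge0// ltW.
have hk x : enorm x <= k * (1 + g x).
  have := nonflat_linear_growth g L r e x dg L0 hL g0 e0 he.
  have : r <= `|r| by exact: ler_norm.
  have : 0 <= `|r| * g x by rewrite mulr_ge0.
  have : 0 <= 2 / e by rewrite divr_ge0// ltW.
  by rewrite /k mulrDr mulr1 mulrDl; lra.
have mth n : measurable_fun [set: Omega] (fun w => enorm (theta n.+1 w)).
  have [mt _ _] := hmeas n.
  exact: (Hmeas_measurable _ _ (sF n) (Hmeas_continuous _ _ (@enorm R d) _ (sF n) (@continuous_enorm R d) mt)).
have sup_th w : (ereal_sup (range (fun n => (enorm (theta n.+1 w))%:E)) <=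
    k%:E * ereal_sup (range (fun n => (X n w)%:E)))%E.
  apply: ge_ereal_sup => _ [n _ <-].
  apply: (@le_trans _ _ (k%:E * (X n w)%:E)%E); first by rewrite -EFinM lee_fin hk.
  by apply: lee_wpmul2l => //; apply: ereal_sup_ubound; exists n.
have th0 w : (0 <= ereal_sup (range (fun n => (enorm (theta n.+1 w))%:E)))%E.
  by apply: sup_range_ge0 => n; exact: enorm_ge0.
have msupth := measurable_sup_range _ mth.
have thy : (\int[P]_w ereal_sup (range (fun n => (enorm (theta n.+1 w))%:E)) < +oo)%E.
  apply: (@le_lt_trans _ _ (\int[P]_w (k%:E * ereal_sup (range (fun n => (X n w)%:E))))%E).
    by apply: ge0_le_integral => //; exact: measurable_funeM.
  by rewrite ge0_integralZl// lte_mul_pinfty.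
split.
- under eq_integral do rewrite (image_ge1 (fun n => (g (theta n _))%:E)).
  apply: le_lt_trans supXy; apply: ge0_le_integral => //.
  + by move=> w _; apply: sup_range_ge0.
  + apply: measurable_sup_range => n; exact: (Hmeas_measurable _ _ (sF n) (bg n).1).
  + move=> w _; apply: ge_ereal_sup => _ [n _ <-].
    apply: le_ereal_sup_tmp; exists (X n w)%:E; first by exists n.
    by rewrite lee_fin /X lerDr.
- split.
    by under eq_integral do rewrite (image_ge1 (fun n => (enorm (theta n _))%:E)).
  have := ae_lty P _ msupth th0 thy; apply: filterS => w.
  by rewrite (image_ge1 (fun n => (enorm (theta n w))%:E)).
move=> hrel hsard.
have supX_ae := ae_lty P _ msupX supX0 supXy.
have lim0 := ae_gradient_vanishes hg L0 hL g0 hF hmeas halpha0 hS0 hrec hunbiased hsard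
  run hrel k0 hk supX_ae.
have lim w : (forall e : R, 0 < e -> exists N, forall n, (N <= n)%N ->
     enorm (grad g (theta n.+1 w)) <= e) ->
    enorm (grad g (theta n w)) @[n --> \oo] --> (0 : R).
  move=> h; rewrite -(cvg_shiftS (fun n => enorm (grad g (theta n w)))).
  apply/cvgrPdist_le => eps eps0; have [N hN] := h _ eps0.
  by exists N => // n Nn; rewrite sub0r normrN ger0_norm ?enorm_ge0//; exact: hN.
split; first by apply: filterS lim0 => w; exact: lim.
have mgam n : measurable_fun [set: Omega] (fun w => enorm (grad g (theta n.+1 w))).
  exact: (Hmeas_measurable _ _ (sF n) (bgam n).1).
have dom : P.-integrable [set: Omega]
    (fun w => (4 * L)%:E * ereal_sup (range (fun n => (X n w)%:E)))%E.
  apply: integrableZl => //; apply/integrableP; split => //.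
  by under eq_integral do rewrite gee0_abs//.
have [||||_ _ cv] := @dominated_convergence _ _ R P setT measurableT
  (fun n w => (enorm (grad g (theta n.+1 w)) ^+ 2)%:E) (cst 0%E) _ _ _ _ dom _.
- by move=> n; apply/measurable_EFinP; exact: measurable_funX.
- exact: measurable_cst.
- apply: filterS lim0 => w /lim h _.
  rewrite -(cvg_shiftS (fun n => enorm (grad g (theta n w)))) in h.
  have h2 : (enorm (grad g (theta n.+1 w)) ^+ 2) @[n --> \oo] --> (0 : R).
    by under eq_fun do rewrite expr2; rewrite -(mulr0 (0 : R)); exact: cvgM.
  by apply: cvg_EFin; [exact: nearW|exact: h2].
- apply: aeW => w n _; rewrite gee0_abs ?lee_fin ?sqr_ge0//.
  apply: (@le_trans _ _ ((4 * L)%:E * (X n w)%:E)%E).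
    by rewrite -EFinM lee_fin; exact: os_gamX (sr_step run n w).
  apply: lee_wpmul2l; first by rewrite lee_fin; nneg.
  by apply: ereal_sup_ubound; exists n.
rewrite -cvg_shiftS unlock; move: cv.
by rewrite integral0.
Qed.
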